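(* Let $f,g\in L_2(\mathbb{R}_+)$ and let their Mellin transforms $f^*, g^*$ satisfy the conditions $e^{\pi|s|} f^*(s),\ e^{\pi|s|} g^*(s) \in L_1(\sigma)$. If $(f*g)(x)=0$ for all $x>0$, where $f*g$ is the convolution related to the half-Hartley transform (defined in the context), then either $f(x)=0$ on $\mathbb{R}_+$ or $g(x)=0$ on $\mathbb{R}_+$.
   Context: $\mathbb{R}_+=(0,\infty)$ and $\sigma=\{s\in\mathbb{C}: s=\tfrac12+i\tau,\ \tau\in\mathbb{R}\}$, oriented upward; $L_1(\sigma)$ is taken with respect to $d\tau$. For $f\in L_2(\mathbb{R}_+)$ the Mellin transform is $$f^*(s)=\int_0^\infty f(t)t^{s-1}dt,\quad s\in\sigma,$$ the integral converging in mean square with respect to the norm of $L_2(\sigma)$, with inverse $f(x)=\frac{1}{2\pi i}\int_\sigma f^*(s)x^{-s}ds$. Functions in $L_2(\mathbb{R}_+)$ are identified when they agree almost everywhere. The convolution of $f$ and $g$ related to the half-Hartley transform is the function on $\mathbb{R}_+$ defined (provided it exists) by the double Mellin–Barnes integral $$(f*g)(x)= \frac{1}{(2\pi i)^2} \int_{\sigma}\int_{\sigma} \frac{\Gamma(s)\Gamma(w)}{\Gamma(s+w-1/2)}\, \frac{\sin(\pi(s+w)/2) + \cos(\pi(s-w)/2)}{\sin(\pi(s+w)/2)}\, f^*(1-s)\,g^*(1-w)\, x^{s+w-3/2}\, ds\, dw.$$ *)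

(* Defs.v *)
(* MathComp-Analysis; complex numbers are R[i] for R : realType. *)
From HB Require Import structures.
From mathcomp Require Export all_boot all_order all_algebra.
From mathcomp Require Export complex.
From mathcomp Require Export all_classical all_reals all_analysis.

Set Implicit Arguments.
Unset Strict Implicit.
Unset Printing Implicit Defensive.
Import Order.TTheory GRing.Theory Num.Theory.
Import numFieldNormedType.Exports.

Local Open Scope classical_set_scope.
Local Open Scope ring_scope.
Local Open Scope complex_scope.

Section HalfHartley.
Context {R : realType}.
Local Notation C := R[i].
Local Notation mu := (@lebesgue_measure R).

(* Num.Theory also exports a projection named Re. *)
Local Notation Re := complex.Re.
Local Notation Im := complex.Im.

Definition cabs (z : C) : R := ComplexField.Normc.normc z.

Definition cexp (z : C) : C :=
  (expR (Re z) * cos (Im z)) +i* (expR (Re z) * sin (Im z)).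

Definition csin (z : C) : C := (cexp ('i%C * z) - cexp (- ('i%C * z))) / (2 * 'i%C).

Definition ccos (z : C) : C := (cexp ('i%C * z) + cexp (- ('i%C * z))) / 2.

(* Principal power of a positive base; meaningless for x <= 0. *)
Definition cpow (x : R) (z : C) : C := cexp (z * (ln x)%:C).

Definition Rpos : set R := `]0, +oo[.

Definition cmeasurable (D : set R) (f : R -> C) : Prop :=
  measurable_fun D (fun t => Re (f t)) /\ measurable_fun D (fun t => Im (f t)).

(* Lebesgue integral of a complex function, taken componentwise. *)
Definition cintegral (D : set R) (f : R -> C) : C :=
  (\int[mu]_(t in D) Re (f t))%R +i* (\int[mu]_(t in D) Im (f t))%R.

(* The norm of f in L_p(D). *)
Definition cLnorm (p : \bar R) (D : set R) (f : R -> C) : \bar R :=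
  'N[mu]_p[EFin \o ((fun t => cabs (f t)) \_ D)]%E.

Definition in_Lp (p : \bar R) (D : set R) (f : R -> C) : Prop :=
  cmeasurable D f /\ (cLnorm p D f < +oo)%E.

(* The line Re s = 1/2, parametrized by tau. Functions on this line are
   represented by functions C -> C, of which only the restriction to the line
   matters; L_p of the line is L_p(d tau). *)
Definition sigma (tau : R) : C := 2^-1 +i* tau.

Definition in_Lp_sigma (p : \bar R) (F : C -> C) : Prop :=
  in_Lp p setT (F \o sigma).

(* Contour integral along the line, oriented upward: ds = i d tau. *)
Definition sigma_integral (F : C -> C) : C :=
  'i%C * cintegral setT (F \o sigma).

(* Euler's integral, valid for Re z > 0; it is only used on Re z = 1/2. *)
Definition Gamma (z : C) : C :=
  cintegral Rpos (fun t => cpow t (z - 1) * (expR (- t))%:C).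

Definition truncated_mellin (f : R -> C) (a : R) (s : C) : C :=
  cintegral `[a^-1, a] (fun t => f t * cpow t (s - 1)).

(* F represents the Mellin transform of f : F is the limit in L_2(sigma), as
   a -> +oo, of the integrals of f(t) t^(s-1) over [1/a, a]. Since such a limit
   is determined only up to null sets, this is a relation between functions. *)
Definition is_mellin (f : R -> C) (F : C -> C) : Prop :=
  in_Lp_sigma 2%:E F /\
  cLnorm 2%:E setT (fun tau => F (sigma tau) - truncated_mellin f a (sigma tau))
    @[a --> +oo] --> 0%E.

Definition half_hartley_kernel (s w : C) : C :=
  (Gamma s * Gamma w) / Gamma (s + w - 2^-1)
  * ((csin ((pi : R)%:C * (s + w) / 2) + ccos ((pi : R)%:C * (s - w) / 2))
     / csin ((pi : R)%:C * (s + w) / 2)).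

(* The convolution of f and g at x > 0, as a function of their Mellin
   transforms F and G; the inner integration variable is s. *)
Definition half_hartley_conv (F G : C -> C) (x : R) : C :=
  ((2 * (pi : R)%:C * 'i%C) ^+ 2)^-1 *
  sigma_integral (fun w => sigma_integral (fun s =>
    half_hartley_kernel s w * F (1 - s) * G (1 - w) * cpow x (s + w - 3 / 2))).

Definition zero_ae_Rpos (f : R -> C) : Prop :=
  {ae mu, forall x, Rpos x -> f x = 0}.

End HalfHartley.

(* Main.v *)
(* Let [F], [G] be the Mellin transforms of [f], [g].  With [s = 1/2 + i tau],
   [w = 1/2 + i u] and [v = tau + u], the kernel is
   [Gamma(s) ch(tau) Gamma(w) ch(u) / (Gamma(1/2 + i v) ch(v))] up to a constant,
   where [ch(x) = cosh(pi x / 2)].  So, for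
   [A(tau) = Gamma(s) ch(tau) F(1 - s)] and [B] likewise from [G], [f * g = 0]
   says that the Fourier transform in [v] of
   [A(tau) B(u) / (Gamma(1/2 + i v) ch(v))] vanishes.
   - Euler's integral writes [Gamma(1/2 + i v)] as a superposition of
     characters [e^(i v ln t)], so multiplying by it preserves the vanishing.
   - Transforms of functions with exponential decay extend to a strip, so
     multiplying by [ch(v)], that is, shifting by [+- i pi / 2], preserves it too.
   Hence the product of the transforms of [A] and [B] is zero.  Both extend
   analytically to a strip, so one of them vanishes identically, say that of
   [A]; then [F = 0] a.e.  As [F] is the mean-square limit of Fourier transforms
   of truncations of [f(t) t^(-1/2)] in the variable [ln t], Parseval's formula
   against intervals gives [f = 0] a.e. *)
From HB Require Import structures.
Require Import Defs.
From mathcomp Require Import all_boot all_order all_algebra.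
From mathcomp Require Import complex.
From mathcomp Require Import all_classical all_reals all_analysis.
From mathcomp Require Import measurable_realfun.
From mathcomp Require Import ring lra.
Import Order.TTheory GRing.Theory Num.Theory.
Import numFieldNormedType.Exports.
Local Open Scope classical_set_scope.
Local Open Scope ring_scope.
Local Open Scope complex_scope.
Set Implicit Arguments.
Unset Strict Implicit.
Unset Printing Implicit Defensive.

Local Notation Re := complex.Re.
Local Notation Im := complex.Im.

(** * Complex numbers *)

Section ComplexNumbers.
Context {R : realType}.
Local Notation C := R[i].
Implicit Types (z w : C) (x y : R).

(** The exponent in the hypothesis is spent twice: half of [e^(pi |s|)] absorbs the growth of
    [ch(tau)], the other half leaves [A] and [B] integrable against [e^(pi |tau| / 2)]. That surplus
    is what permits the division by [Gamma(1/2 + i v)]: Fubini needs the quotient to be integrable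
    in [(tau, u)], hence a lower bound for [|Gamma|] on the critical line. It is obtained without
    the reflection formula: [|Gamma(n + 1/2 + i v)|] is comparable to [Gamma(n + 1/2)] once [n]
    exceeds a multiple of [v^2], and the functional equation descends from there to [n = 0]. Gamma
    is cleared before [ch], because the factor [1 / ch(v)] that is left then pays exactly for the
    weight [e^(pi |v| / 2)] of the shift by [i pi / 2]. Analytic continuation is carried out on the
    moments of absolutely convergent integrals, with no holomorphic functions. *)

Lemma complex_ext z w : Re z = Re w -> Im z = Im w -> z = w.
Proof. by case: z w => a b [c d] /= -> ->. Qed.

Lemma ReM z w : Re (z * w) = Re z * Re w - Im z * Im w.
Proof. by case: z w => a b [c d]. Qed.

Lemma ImM z w : Im (z * w) = Re z * Im w + Im z * Re w.
Proof. by case: z w => a b [c d]. Qed.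

Lemma ReD z w : Re (z + w) = Re z + Re w.
Proof. by case: z w => a b [c d]. Qed.

Lemma ImD z w : Im (z + w) = Im z + Im w.
Proof. by case: z w => a b [c d]. Qed.

Lemma ReN z : Re (- z) = - Re z.
Proof. by case: z. Qed.

Lemma ImN z : Im (- z) = - Im z.
Proof. by case: z. Qed.

Lemma cabsE z : cabs z = Num.sqrt (Re z ^+ 2 + Im z ^+ 2).
Proof. by case: z. Qed.

Lemma cabs_ge0 z : 0 <= cabs z.
Proof. by rewrite cabsE sqrtr_ge0. Qed.

Lemma cabsM z w : cabs (z * w) = cabs z * cabs w.
Proof. exact: ComplexField.Normc.normcM. Qed.

Lemma cabsD z w : cabs (z + w) <= cabs z + cabs w.
Proof. exact: le_normcD. Qed.

Lemma cabsN z : cabs (- z) = cabs z.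
Proof. exact: normcN. Qed.

Lemma cabsV z : cabs z^-1 = (cabs z)^-1.
Proof. exact: ComplexField.Normc.normcV. Qed.

Lemma cabs0 : cabs (0 : C) = 0.
Proof. exact: ComplexField.Normc.normc0. Qed.

Lemma cabs0_eq0 z : cabs z = 0 -> z = 0.
Proof. exact: ComplexField.Normc.eq0_normc. Qed.

Lemma cabsR x : cabs x%:C = `|x|.
Proof. by rewrite cabsE /= expr0n /= addr0 sqrtr_sqr. Qed.

Lemma cabs1 : cabs (1 : C) = 1.
Proof. by rewrite (cabsR 1) normr1. Qed.

Lemma cabsX z n : cabs (z ^+ n) = cabs z ^+ n.
Proof.
elim: n => [|n IH]; first by rewrite !expr0 cabs1.
by rewrite !exprS cabsM IH.
Qed.

Lemma Re_le_cabs z : `|Re z| <= cabs z.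
Proof. by rewrite cabsE -sqrtr_sqr ler_wsqrtr// lerDl sqr_ge0. Qed.

Lemma Im_le_cabs z : `|Im z| <= cabs z.
Proof. by rewrite cabsE -sqrtr_sqr ler_wsqrtr// lerDr sqr_ge0. Qed.

Lemma cabs_le z : cabs z <= `|Re z| + `|Im z|.
Proof.
rewrite cabsE -[leRHS]ger0_norm ?addr_ge0// -sqrtr_sqr ler_wsqrtr//.
by rewrite sqrrD !real_normK ?num_real// lerD2r lerDl mulrn_wge0 ?mulr_ge0.
Qed.

Lemma cabsB z w : cabs (z - w) = cabs (w - z).
Proof. by rewrite -cabsN opprB. Qed.

Lemma cexpD z w : cexp (z + w) = cexp z * cexp w.
Proof.
case: z w => a b [c d]; apply: complex_ext => /=;
  rewrite expRD ?cosD ?sinD; ring.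
Qed.

Lemma cexp0 : cexp (0 : C) = 1.
Proof. by apply: complex_ext => /=; rewrite expR0 ?cos0 ?sin0 mul1r. Qed.

Lemma cexpMn z n : cexp (z *+ n) = cexp z ^+ n.
Proof.
by elim: n => [|n IH]; rewrite ?mulr0n ?cexp0// mulrS exprS cexpD IH.
Qed.

Lemma cabs_cexp z : cabs (cexp z) = expR (Re z).
Proof.
rewrite cabsE /= !exprMn -mulrDr cos2Dsin2 mulr1 sqrtr_sqr.
by rewrite ger0_norm// expR_ge0.
Qed.

Lemma cexpR x : cexp x%:C = (expR x)%:C.
Proof. by apply: complex_ext => /=; rewrite ?cos0 ?sin0 ?mulr1 ?mulr0. Qed.

Lemma cexpI x : cexp ('i%C * x%:C) = cos x +i* sin x.
Proof.
by apply: complex_ext => /=; rewrite !mul0r !mul1r subr0 expR0 !mul1r ?add0r.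
Qed.

Lemma cabs_cexpI x : cabs (cexp ('i%C * x%:C)) = 1.
Proof. by rewrite cabs_cexp /= !mul0r mul1r subr0 expR0. Qed.

Lemma cabsi : cabs ('i%C : C) = 1.
Proof. by rewrite cabsE /= expr0n /= add0r expr1n sqrtr1. Qed.

(** Mean value inequality anchored at 0. Applied repeatedly, it turns a bound on a derivative into
    the Taylor bounds for [sin], [cos] and [expR] that follow. *)
Lemma le_MVT0 (f df : R -> R) (K b : R) :
  (forall x, is_derive x 1 f (df x)) ->
  (forall x, `|x| <= `|b| -> `|df x| <= K) -> `|f b - f 0| <= K * `|b|.
Proof.
move=> dfE dfK.
have cf x : {for x, continuous f}.
  by apply: differentiable_continuous; apply/derivable1_diffP; have [] := dfE x.
case: (leP 0 b) => b0.
  have [] := @MVT_segment R f df 0 b b0 (fun x _ => dfE x).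
    exact/continuous_subspaceT.
  move=> c; rewrite in_itv /= => /andP[c0 cb] ->.
  rewrite subr0 normrM ler_wpM2r// dfK//.
  by rewrite !ger0_norm//.
have [] := @MVT_segment R f df b 0 (ltW b0) (fun x _ => dfE x).
  exact/continuous_subspaceT.
move=> c; rewrite in_itv /= => /andP[c0 cb].
rewrite distrC => ->.
rewrite sub0r normrM normrN ler_wpM2r// dfK//.
by rewrite !ler0_norm ?(ltW b0)// lerN2.
Qed.

Lemma sin_le x : `|sin x| <= `|x|.
Proof.
have := @le_MVT0 sin cos 1 x (@is_derive_sin R) (fun y _ => cos_max y).
by rewrite sin0 subr0 mul1r.
Qed.

Lemma cos_dist1 x : `|cos x - 1| <= `|x|.
Proof.
have := @le_MVT0 cos (fun y => - sin y) 1 x (@is_derive_cos R).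
rewrite cos0 mul1r; apply => y _; rewrite normrN; exact: sin_max.
Qed.

Lemma cos_dist_sqr x : `|cos x - 1| <= x ^+ 2.
Proof.
have := @le_MVT0 cos (fun y => - sin y) `|x| x (@is_derive_cos R).
rewrite cos0 -expr2 real_normK ?num_real//; apply => y yx.
by rewrite normrN (le_trans (sin_le y)).
Qed.

Lemma sin_dist x : `|sin x - x| <= x ^+ 2.
Proof.
have := @le_MVT0 (sin - id) (fun y => cos y - 1) `|x| x.
rewrite -expr2 real_normK ?num_real// !fctE sin0 !subr0; apply.
by move=> y yx; rewrite (le_trans (cos_dist1 y)).
Qed.

Lemma expR_dist0 x : `|expR x - 1| <= `|x| * expR `|x|.
Proof.
have := @le_MVT0 expR expR (expR `|x|) x (@is_derive_expR R).
rewrite expR0 mulrC; apply => y yx.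
rewrite ger0_norm ?expR_ge0// ler_expR; exact: le_trans (ler_norm _) yx.
Qed.

Lemma expR_dist1 x : `|expR x - 1 - x| <= x ^+ 2 * expR `|x|.
Proof.
have := @le_MVT0 (expR - id) (fun y => expR y - 1) (`|x| * expR `|x|) x.
rewrite mulrAC -expr2 real_normK ?num_real// !fctE expR0 subr0.
rewrite -!addrA [- x - 1]addrC !addrA; apply.
move=> y yx; rewrite (le_trans (expR_dist0 y))// ler_pM ?expR_ge0//.
by rewrite ler_expR.
Qed.

Lemma cabs_cexpI_dist0 x : cabs (cexp ('i%C * x%:C) - 1) <= 2 * `|x|.
Proof.
rewrite (le_trans (cabs_le _))// cexpI /= subr0 mulr2n mulrDl !mul1r.
by rewrite lerD ?cos_dist1 ?sin_le.
Qed.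

(** The constant 4 counts real error terms: the real and the imaginary part each split into two, and
    each of the four is at most [r^2 e^r]. *)
Lemma cexp_taylor1 z :
  cabs (cexp z - 1 - z) <= 4 * cabs z ^+ 2 * expR (cabs z).
Proof.
case: z => a b; set r := cabs (a +i* b).
have ar : `|a| <= r by exact: (Re_le_cabs (a +i* b)).
have br : `|b| <= r by exact: (Im_le_cabs (a +i* b)).
have r0 : 0 <= r by exact: le_trans ar.
have sq y : `|y| <= r -> y ^+ 2 <= r ^+ 2.
  by move=> yr; rewrite -(real_normK (num_real y)) lerXn2r ?nnegrE.
have ea : expR a <= expR r by rewrite ler_expR (le_trans (ler_norm _)).
have eaN : expR `|a| <= expR r by rewrite ler_expR.
rewrite (le_trans (cabs_le _))//=.
have -> : expR a * cos b - 1 - a =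
  expR a * (cos b - 1) + (expR a - 1 - a) by ring.
have -> : expR a * sin b - 0 - b =
  expR a * (sin b - b) + (expR a - 1) * b by ring.
have h1 : `|expR a * (cos b - 1)| <= r ^+ 2 * expR r.
  rewrite normrM (ger0_norm (expR_ge0 _)) mulrC ler_pM ?expR_ge0//.
  by rewrite (le_trans (cos_dist_sqr _))// sq.
have h2 : `|expR a - 1 - a| <= r ^+ 2 * expR r.
  by rewrite (le_trans (expR_dist1 _))// ler_pM ?sqr_ge0 ?expR_ge0 ?sq.
have h3 : `|expR a * (sin b - b)| <= r ^+ 2 * expR r.
  rewrite normrM (ger0_norm (expR_ge0 _)) mulrC ler_pM ?expR_ge0//.
  by rewrite (le_trans (sin_dist _))// sq.
have h4 : `|(expR a - 1) * b| <= r ^+ 2 * expR r.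
  rewrite normrM expr2 mulrAC ler_pM//.
  by rewrite (le_trans (expR_dist0 _))// ler_pM ?expR_ge0.
have := ler_normD (expR a * (cos b - 1)) (expR a - 1 - a).
have := ler_normD (expR a * (sin b - b)) ((expR a - 1) * b).
rewrite -mulrA; move: h1 h2 h3 h4; set K := r ^+ 2 * expR r.
move=> h1 h2 h3 h4 h5 h6; lra.
Qed.

(* [(1 + w/n)^n -> e^w]: compare [a^n - b^n] termwise, with [a = 1 + w/n] and
   [b = e^(w/n)]. *)
Lemma cabs_expB_le z w (K : R) n : 0 <= K -> cabs z <= K -> cabs w <= K ->
  cabs (z ^+ n.+1 - w ^+ n.+1) <= n.+1%:R * K ^+ n * cabs (z - w).
Proof.
move=> K0 zK wK; elim: n => [|n IH]; first by rewrite !expr1 expr0 !mul1r.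
rewrite exprS [w ^+ _]exprS.
have -> : z * z ^+ n.+1 - w * w ^+ n.+1 =
  z * (z ^+ n.+1 - w ^+ n.+1) + (z - w) * w ^+ n.+1 by ring.
rewrite (le_trans (cabsD _ _))// !cabsM cabsX.
have -> : n.+2%:R * K ^+ n.+1 * cabs (z - w) =
  K * (n.+1%:R * K ^+ n * cabs (z - w)) + cabs (z - w) * K ^+ n.+1.
  by rewrite -[n.+2%:R]natr1 exprS; ring.
rewrite lerD ?ler_pM ?cabs_ge0// ?exprn_ge0 ?cabs_ge0//.
by rewrite lerXn2r ?nnegrE ?cabs_ge0.
Qed.

(** From [1 + x <= e^x]. Being uniform in [n], this is the domination used when [(1 + w/n)^n] passes
    to its limit under an integral. *)
Lemma cexp_approx_le w n : cabs ((1 + w / n.+1%:R) ^+ n.+1) <= expR (cabs w).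
Proof.
have -> : cabs w = cabs (w / n.+1%:R) * n.+1%:R.
  rewrite cabsM cabsV.
  have -> : cabs n.+1%:R = n.+1%:R :> R.
    by have := cabsR n.+1%:R; rewrite rmorph_nat normr_nat.
  by rewrite divfK// pnatr_eq0.
rewrite expRM_natr cabsX lerXn2r ?nnegrE ?cabs_ge0 ?expR_ge0//.
rewrite (le_trans (cabsD _ _))// cabs1; exact: expR_ge1Dx.
Qed.

Lemma cabsXn1 n : cabs n.+1%:R = n.+1%:R :> R.
Proof. by have := cabsR n.+1%:R; rewrite rmorph_nat normr_nat. Qed.

Lemma cexp_approx w n : cabs ((1 + w / n.+1%:R) ^+ n.+1 - cexp w) <=
  4 * cabs w ^+ 2 * expR (cabs w) ^+ 2 / n.+1%:R.
Proof.
set u := w / n.+1%:R.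
have n0 : (0 : R) < n.+1%:R by [].
have uE : cabs u = cabs w / n.+1%:R by rewrite cabsM cabsV cabsXn1.
have -> : cexp w = cexp u ^+ n.+1.
  by rewrite -cexpMn -mulr_natr divfK// pnatr_eq0.
have h1 : cabs (1 + u) <= expR (cabs u).
  rewrite (le_trans (cabsD _ _))// cabs1; exact: expR_ge1Dx.
have h2 : cabs (cexp u) <= expR (cabs u).
  by rewrite cabs_cexp ler_expR (le_trans (ler_norm _))// Re_le_cabs.
rewrite (le_trans (cabs_expB_le n (expR_ge0 _) h1 h2))//.
rewrite cabsB opprD addrA.
rewrite (le_trans (ler_wpM2l _ (cexp_taylor1 _)))//.
have -> : n.+1%:R * expR (cabs u) ^+ n * (4 * cabs u ^+ 2 * expR (cabs u)) =
  4 * (n.+1%:R * cabs u ^+ 2) * expR (cabs u) ^+ n.+1 by rewrite [expR _ ^+ n.+1]exprSr; ring.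
rewrite -expRM_natr {2}uE divfK ?gt_eqF//.
(* The termwise comparison costs a factor [n + 1], while the Taylor remainder of [u = w / (n + 1)]
   gains its square: a rate [1 / (n + 1)] remains. *)
have -> : n.+1%:R * cabs u ^+ 2 = cabs w ^+ 2 / n.+1%:R.
  rewrite uE; move: (gt_eqF n0); move: (n.+1%:R) => m mn0.
  by field; rewrite mn0.
rewrite mulrA [leRHS]mulrAC; apply: ler_wpM2l.
  by rewrite mulr_ge0 ?invr_ge0// mulr_ge0 ?sqr_ge0.
rewrite expr2 ler_peMl ?expR_ge0//.
by rewrite -expR0 ler_expR cabs_ge0.
Qed.

End ComplexNumbers.

(** * Integrals of complex functions *)

Section ComplexIntegral.
Context d {T : measurableType d} {R : realType}.
Local Notation C := R[i].
Implicit Types (f g : T -> C).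

Definition cmeas f :=
  measurable_fun setT (fun t => Re (f t)) /\
  measurable_fun setT (fun t => Im (f t)).

Lemma cmeas_cst (c : C) : cmeas (fun=> c).
Proof. by split; exact: measurable_cst. Qed.

Lemma cmeasD f g : cmeas f -> cmeas g -> cmeas (fun t => f t + g t).
Proof.
move=> [fr fi] [gr gi]; split.
  by under eq_fun do rewrite ReD; exact: measurable_funD.
by under eq_fun do rewrite ImD; exact: measurable_funD.
Qed.

Lemma cmeasM f g : cmeas f -> cmeas g -> cmeas (fun t => f t * g t).
Proof.
move=> [fr fi] [gr gi]; split.
  by under eq_fun do rewrite ReM; apply: measurable_funB; exact: measurable_funM.
by under eq_fun do rewrite ImM; apply: measurable_funD; exact: measurable_funM.
Qed.

Lemma cmeasX f n : cmeas f -> cmeas (fun t => f t ^+ n).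
Proof.
move=> mf; elim: n => [|n IH].
  by under eq_fun do rewrite expr0; exact: cmeas_cst.
by under eq_fun do rewrite exprS; exact: cmeasM.
Qed.

Lemma cmeasN f : cmeas f -> cmeas (fun t => - f t).
Proof.
move=> mf; under eq_fun do rewrite -mulN1r; apply: cmeasM => //.
Qed.

Lemma cmeasR (r : T -> R) : measurable_fun setT r -> cmeas (fun t => (r t)%:C).
Proof. by move=> mr; split => //=; exact: measurable_cst. Qed.

Lemma cmeas_cexp f : cmeas f -> cmeas (fun t => cexp (f t)).
Proof.
move=> [fr fi]; split => /=; apply: measurable_funM;
  apply: measurableT_comp => //; apply: continuous_measurable_fun.
- exact: continuous_cos.
- exact: continuous_sin.
Qed.

Lemma measurable_cabs f : cmeas f -> measurable_fun setT (fun t => cabs (f t)).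
Proof.
move=> [fr fi]; under eq_fun do rewrite cabsE.
apply: (measurableT_comp (continuous_measurable_fun (@sqrt_continuous R))).
by apply: measurable_funD; apply: measurable_funX.
Qed.

Variable mu : {measure set T -> \bar R}.

Definition cintegrable f :=
  mu.-integrable setT (EFin \o (fun t => Re (f t))) /\
  mu.-integrable setT (EFin \o (fun t => Im (f t))).

(** The componentwise integral of [cintegral], over an arbitrary measure: it is needed on the line
    and on the plane of pairs [(tau, u)]. *)
Definition Cint f : C :=
  (\int[mu]_t Re (f t))%R +i* (\int[mu]_t Im (f t))%R.

Lemma le_integrable_real (r g : T -> R) : measurable_fun setT r ->
  (forall t, `|r t| <= g t) -> mu.-integrable setT (EFin \o g) ->
  mu.-integrable setT (EFin \o r).
Proof.
move=> mr rg ig; apply: le_integrable ig => //; first exact/measurable_EFinP.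
move=> t _ /=; rewrite lee_fin (le_trans (rg t))// ler_norm//.
Qed.

Lemma cintegrable_le f (g : T -> R) : cmeas f ->
  (forall t, cabs (f t) <= g t) -> mu.-integrable setT (EFin \o g) ->
  cintegrable f.
Proof.
move=> [fr fi] fg ig; split; apply: (le_integrable_real _ _ ig) => // t;
  apply: le_trans (fg t); [exact: Re_le_cabs|exact: Im_le_cabs].
Qed.

Lemma cintegrable_cmeas f : cintegrable f -> cmeas f.
Proof.
by move=> [/measurable_int/measurable_EFinP fr /measurable_int/measurable_EFinP].
Qed.

Lemma integrable_cabs f : cintegrable f ->
  mu.-integrable setT (EFin \o (fun t => cabs (f t))).
Proof.
move=> fi; have mf := cintegrable_cmeas fi; case: fi => fr fi.
have := integrableD (@measurableT _ T) (integrable_norm fr) (integrable_norm fi).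
apply: le_integrable_real; first exact: measurable_cabs.
by move=> t; rewrite ger0_norm ?cabs_ge0 ?cabs_le.
Qed.

Lemma cintegrableD f g : cintegrable f -> cintegrable g ->
  cintegrable (fun t => f t + g t).
Proof.
move=> fi gi; have := integrableD (@measurableT _ T)
  (integrable_cabs fi) (integrable_cabs gi).
apply: cintegrable_le; first by apply: cmeasD; exact: cintegrable_cmeas.
by move=> t; exact: cabsD.
Qed.

Lemma cintegrableM (c : C) f : cintegrable f -> cintegrable (fun t => c * f t).
Proof.
move=> fi; have := integrableZl (@measurableT _ T) (cabs c) (integrable_cabs fi).
apply: cintegrable_le.
  by apply: cmeasM; [exact: cmeas_cst|exact: cintegrable_cmeas].
by move=> t; rewrite cabsM.
Qed.

Lemma CintD f g : cintegrable f -> cintegrable g ->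
  Cint (fun t => f t + g t) = Cint f + Cint g.
Proof.
move=> [fr fi] [gr gi]; apply: complex_ext; rewrite ?ReD ?ImD /=.
  by rewrite -RintegralD//; apply: eq_Rintegral => t _; rewrite ReD.
by rewrite -RintegralD//; apply: eq_Rintegral => t _; rewrite ImD.
Qed.

Lemma CintM (c : C) f : cintegrable f -> Cint (fun t => c * f t) = c * Cint f.
Proof.
move=> [fr fi].
have iZ k (r : T -> R) : mu.-integrable setT (EFin \o r) ->
    mu.-integrable setT (EFin \o (fun t => k * r t)).
  by move=> ri; exact: (integrableZl measurableT k ri).
apply: complex_ext; rewrite ?ReM ?ImM /= -!RintegralZl//.
  rewrite -RintegralB//; [|exact: iZ|exact: iZ].
  by apply: eq_Rintegral => t _; rewrite ReM.
rewrite -RintegralD//; [|exact: iZ|exact: iZ].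
by apply: eq_Rintegral => t _; rewrite ImM.
Qed.

(** The factor 2 comes from bounding the real and imaginary integrals separately, instead of
    rotating the integral onto the real axis. *)
Lemma cabs_Cint_le f (g : T -> R) : cintegrable f ->
  mu.-integrable setT (EFin \o g) -> (forall t, cabs (f t) <= g t) ->
  cabs (Cint f) <= 2 * (\int[mu]_t g t)%R.
Proof.
move=> [fr fi] ig fg; rewrite (le_trans (cabs_le _))//= mulr2n mulrDl !mul1r.
have h (r : T -> R) : mu.-integrable setT (EFin \o r) ->
    (forall t, `|r t| <= cabs (f t)) -> `|(\int[mu]_t r t)%R| <= (\int[mu]_t g t)%R.
  move=> ri rf; rewrite (le_trans (le_normr_Rintegral _ _))//.
  apply: le_Rintegral => //; first exact: integrable_norm.
  by move=> t _; rewrite (le_trans (rf t)).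
by apply: lerD; apply: h => // t; [exact: Re_le_cabs|exact: Im_le_cabs].
Qed.

Lemma eq_Cint f g : (forall t, f t = g t) -> Cint f = Cint g.
Proof. by move=> /funext ->. Qed.

Lemma Cint0 : Cint (fun=> 0) = 0.
Proof.
by apply: complex_ext => /=; rewrite /Rintegral integral0_eq.
Qed.

(** An a priori bound survives dominated convergence. With [M = 0] it transports the vanishing of
    integrals; the general case serves Parseval's formula. *)
Lemma cvg_Cint_le (F : (T -> C)^nat) f (g : T -> R) (M : R) :
  (forall n, cmeas (F n)) -> cmeas f ->
  (forall t, cabs (F n t - f t) @[n --> \oo] --> (0 : R)) ->
  mu.-integrable setT (EFin \o g) -> (forall n t, cabs (F n t) <= g t) ->
  (forall n, cabs (Cint (F n)) <= M) -> cabs (Cint f) <= 2 * M.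
Proof.
move=> mF mf Ff gi Fg F0.
(* [p] stands for [Re] or [Im], so that real dominated convergence applies. *)
have key (p : C -> R) : (forall z, `|p z| <= cabs z) ->
    (forall z w, p (z - w) = p z - p w) ->
    (forall n, measurable_fun setT (fun t => p (F n t))) ->
    measurable_fun setT (fun t => p (f t)) ->
    (forall n, `|(\int[mu]_t p (F n t))%R| <= M) -> `|(\int[mu]_t p (f t))%R| <= M.
  move=> pz pB mpF mpf pFM.
  have [] := @dominated_convergence _ T R mu setT measurableT
    (fun n => EFin \o (fun t => p (F n t))) (EFin \o (fun t => p (f t)))
    (EFin \o g).
  - by move=> n; exact/measurable_EFinP.
  - exact/measurable_EFinP.
  - apply: aeW => t _; apply: cvg_EFin; first exact: nearW.
    apply/cvgrPdistC_le => e e0.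
    have /cvgrPdistC_le /(_ e e0) := Ff t.
    apply: filterS => n; rewrite subr0 /= => h.
    by rewrite -pB (le_trans (pz _))// (le_trans (ler_norm _)).
  - exact: gi.
  - by apply: aeW => t n _ /=; rewrite lee_fin (le_trans (pz _)).
  move=> pfi _ h.
  have pFi n : mu.-integrable setT (EFin \o (fun t => p (F n t))).
    by apply: (le_integrable_real (mpF n) _ gi) => t; rewrite (le_trans (pz _)).
  have le1 n : (- M%:E <= \int[mu]_t (p (F n t))%:E <= M%:E)%E.
    have := pFM n; rewrite /Rintegral ler_norml -!lee_fin fineK//.
    by rewrite integrable_fin_num//; exact: pFi.
  move: h => /= h.
  have h1 : (\int[mu]_t (EFin \o (fun t => p (f t))) t <= M%:E)%E.
    apply: (cvge_to_le h); apply: nearW => n; by have /andP[] := le1 n.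
  have h2 : (- M%:E <= \int[mu]_t (EFin \o (fun t => p (f t))) t)%E.
    apply: (cvge_to_ge h); apply: nearW => n; by have /andP[] := le1 n.
  rewrite ler_norml -!lee_fin /Rintegral fineK ?integrable_fin_num//.
  by rewrite EFinN h1 h2.
have ReF n : `|Re (Cint (F n))| <= M by exact: le_trans (Re_le_cabs _) (F0 n).
have ImF n : `|Im (Cint (F n))| <= M by exact: le_trans (Im_le_cabs _) (F0 n).
rewrite (le_trans (cabs_le _))// mulr2n mulrDl !mul1r lerD//.
- apply: (key (@Re R)) => //.
  + exact: Re_le_cabs.
  + by move=> z w; rewrite ReD ReN.
  + by move=> n; have [] := mF n.
  + by have [] := mf.
- apply: (key (@Im R)) => //.
  + exact: Im_le_cabs.
  + by move=> z w; rewrite ImD ImN.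
  + by move=> n; have [] := mF n.
  + by have [] := mf.
Qed.

Lemma cvg_Cint_eq0 (F : (T -> C)^nat) f (g : T -> R) :
  (forall n, cmeas (F n)) -> cmeas f ->
  (forall t, cabs (F n t - f t) @[n --> \oo] --> (0 : R)) ->
  mu.-integrable setT (EFin \o g) -> (forall n t, cabs (F n t) <= g t) ->
  (forall n, Cint (F n) = 0) -> Cint f = 0.
Proof.
move=> mF mf Ff gi Fg F0; apply: cabs0_eq0; apply: le_anti.
rewrite cabs_ge0 andbT -[leRHS](mulr0 2).
by apply: (cvg_Cint_le mF mf Ff gi Fg) => n; rewrite F0 cabs0.
Qed.

End ComplexIntegral.

Lemma exprn_le_expR {R : realType} (x : R) n : 0 <= x -> x ^+ n <= n`!%:R * expR x.
Proof.
move=> x0; case: n => [|n].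
  by rewrite expr0 fact0 mul1r -expR0 ler_expR.
rewrite -ler_pdivrMl ?ltr0n ?fact_gt0// mulrC.
by rewrite (le_trans _ (expR_ge1Dxn n x0))// lerDr.
Qed.

(** * Analytic continuation of Fourier integrals *)

Section AnalyticExtension.
Context d {T : measurableType d} {R : realType}.
Local Notation C := R[i].
Variables (mu : {measure set T -> \bar R}) (k : T -> C) (theta : T -> R).
Variable delta : R.
Hypothesis mk : cmeas k.
Hypothesis mtheta : measurable_fun setT theta.
Hypothesis delta_gt0 : 0 < delta.
Hypothesis ik : mu.-integrable setT
  (EFin \o (fun t => cabs (k t) * expR (delta * `|theta t|))).

(** Growth slower than every exponential of [|theta|]. The class contains powers of [theta] and
    characters, is stable under sums and products, and [k] times a member is integrable. *)
Definition subexp (phi : T -> C) := cmeas phi /\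
  forall e, 0 < e -> exists2 M, 0 <= M &
    forall t, cabs (phi t) <= M * expR (e * `|theta t|).

Lemma subexp_bounded phi M : cmeas phi -> 0 <= M ->
  (forall t, cabs (phi t) <= M) -> subexp phi.
Proof.
move=> mphi M0 phiM; split => // e e0; exists M => // t.
rewrite (le_trans (phiM t))// ler_peMr// -expR0 ler_expR.
by rewrite mulr_ge0// ltW.
Qed.

Lemma subexp_cst c : subexp (fun=> c).
Proof. by apply: (@subexp_bounded _ (cabs c)); rewrite ?cabs_ge0//; exact: cmeas_cst. Qed.

Lemma subexp_theta : subexp (fun t => (theta t)%:C).
Proof.
split; first exact: cmeasR.
move=> e e0; exists e^-1; first by rewrite invr_ge0 ltW.
move=> t; rewrite cabsR -ler_pdivrMl ?invr_gt0// invrK.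
have := @exprn_le_expR R (e * `|theta t|) 1 (mulr_ge0 (ltW e0) (normr_ge0 _)).
by rewrite expr1 (_ : 1`! = 1)%N// mul1r.
Qed.

Lemma subexpM phi psi : subexp phi -> subexp psi ->
  subexp (fun t => phi t * psi t).
Proof.
move=> [mphi phiM] [mpsi psiM]; split; first exact: cmeasM.
move=> e e0; have e20 : 0 < e / 2 by rewrite divr_gt0.
have [M M0 hM] := phiM _ e20; have [N N0 hN] := psiM _ e20.
exists (M * N); first exact: mulr_ge0.
move=> t; rewrite cabsM.
have -> : e * `|theta t| = e / 2 * `|theta t| + e / 2 * `|theta t| by field.
by rewrite expRD mulrACA ler_pM ?cabs_ge0.
Qed.

Lemma subexpD phi psi : subexp phi -> subexp psi ->
  subexp (fun t => phi t + psi t).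
Proof.
move=> [mphi phiM] [mpsi psiM]; split; first exact: cmeasD.
move=> e e0; have [M M0 hM] := phiM _ e0; have [N N0 hN] := psiM _ e0.
exists (M + N); first exact: addr_ge0.
by move=> t; rewrite (le_trans (cabsD _ _))// mulrDl lerD.
Qed.

Lemma subexpX phi n : subexp phi -> subexp (fun t => phi t ^+ n).
Proof.
move=> sphi; elim: n => [|n IH].
  under eq_fun do rewrite expr0; exact: subexp_cst.
by under eq_fun do rewrite exprS; exact: subexpM.
Qed.

Lemma cmeas_cexpI (y : R) : cmeas (fun t => cexp ('i%C * (y * theta t)%:C)).
Proof.
apply: cmeas_cexp; apply: cmeasM; first exact: cmeas_cst.
by apply: cmeasR; exact: measurable_funM.
Qed.

Lemma subexp_cexpI (y : R) : subexp (fun t => cexp ('i%C * (y * theta t)%:C)).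
Proof.
apply: (@subexp_bounded _ 1) => //; first exact: cmeas_cexpI.
by move=> t; rewrite cabs_cexpI.
Qed.

Lemma cintegrable_kM phi M : cmeas phi ->
  (forall t, cabs (phi t) <= M * expR (delta * `|theta t|)) ->
  cintegrable mu (fun t => k t * phi t).
Proof.
move=> mphi phiM.
have := integrableZl measurableT M ik.
apply: cintegrable_le; first exact: cmeasM.
move=> t; rewrite cabsM mulrCA ler_wpM2l ?cabs_ge0//.
Qed.

Lemma cintegrable_subexp phi : subexp phi -> cintegrable mu (fun t => k t * phi t).
Proof.
by move=> [mphi /(_ _ delta_gt0)[M _]]; exact: cintegrable_kM.
Qed.

Let E y t : C := cexp ('i%C * (y * theta t)%:C).

Let L phi := Cint mu (fun t => k t * phi t).

(** Differentiation under the integral sign: each derivative in [y] brings down a factor [i theta].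
    It is done by a first-order Taylor estimate with explicit error, so that no derivative is
    formed. *)
Lemma Cint_moments_eq0 (y0 r : R) : 0 < r ->
  (forall y : R, `|y - y0| < r -> L (E y) = 0) ->
  forall n (y : R), `|y - y0| < r -> L (fun t => (theta t)%:C ^+ n * E y t) = 0.
Proof.
move=> r0 E0; elim=> [|n IH] y yr.
  by rewrite -(E0 y yr); apply: eq_Cint => t; rewrite expr0 mul1r.
set l := L _.
have sn : subexp (fun t => (theta t)%:C ^+ n) by apply/subexpX/subexp_theta.
have sE z : subexp (fun t => (theta t)%:C ^+ n * E z t).
  by apply: subexpM => //; exact: subexp_cexpI.
(* Half of the rate [delta] pays for [theta^(n+2)]; the other half pays for [e^(h |theta|)] in the
   Taylor remainder, whence the condition [h < delta / 2]. *)
have [M M0 hM] := (subexpX n.+2 subexp_theta).2 _ (divr_gt0 delta_gt0 (ltr0Sn R 1)).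
pose K := 2 * \int[mu]_t (4 * M * (cabs (k t) * expR (delta * `|theta t|))).
have step (h : R) : 0 < h -> h < r - `|y - y0| -> h < delta / 2 -> cabs l <= h * K.
  move=> h0 hr hd.
  have h1 : L (fun t => (theta t)%:C ^+ n * E (y + h) t) = 0.
    apply: IH; rewrite addrAC (le_lt_trans (ler_normD _ _))//.
    by rewrite (gtr0_norm h0); lra.
  have h2 := IH y yr.
  have i1 := cintegrable_subexp (sE (y + h)).
  have i2 := cintegrableM (-1) (cintegrable_subexp (sE y)).
  have i3 : cintegrable mu (fun t => k t * ((theta t)%:C ^+ n.+1 * E y t)).
    apply: cintegrable_subexp; apply: subexpM; last exact: subexp_cexpI.
    exact/subexpX/subexp_theta.
  have i4 := cintegrableM (- ('i%C * h%:C)) i3.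
  (* The integrals at [y + h] and [y] vanish by induction, so the integral of the Taylor remainder
     reduces to [- i h l]; it is of order [h^2]. *)
  have := CintD (cintegrableD i1 i2) i4.
  rewrite (CintD i1 i2) !CintM//; last exact: cintegrable_subexp.
  rewrite -/(L (fun t => (theta t)%:C ^+ n * E (y + h) t)) h1.
  rewrite -/(L (fun t => (theta t)%:C ^+ n * E y t)) h2 mulr0 addr0 add0r.
  rewrite -/l => lE.
  rewrite -(ler_pM2l h0).
  have -> : h * cabs l = cabs (- ('i%C * h%:C) * l).
    by rewrite cabsM cabsN cabsM cabsi mul1r cabsR gtr0_norm.
  have -> : h * (h * K) = 2 * \int[mu]_t
      (h ^+ 2 * (4 * M * (cabs (k t) * expR (delta * `|theta t|)))).
    rewrite RintegralZl//; last exact: (integrableZl measurableT (4 * M) ik).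
    by rewrite /K; ring.
  rewrite -lE; apply: cabs_Cint_le.
  - by apply: cintegrableD => //; exact: cintegrableD.
  - have iM := integrableZl measurableT (4 * M) ik.
    exact: (integrableZl measurableT (h ^+ 2) iM).
  move=> t; pose w := 'i%C * (h * theta t)%:C.
  have -> : k t * ((theta t)%:C ^+ n * E (y + h) t) +
     -1 * (k t * ((theta t)%:C ^+ n * E y t)) +
     - ('i%C * h%:C) * (k t * ((theta t)%:C ^+ n.+1 * E y t)) =
     k t * (theta t)%:C ^+ n * E y t * (cexp w - 1 - w).
    have -> : E (y + h) t = E y t * cexp w.
      by rewrite /E mulrDl rmorphD mulrDr cexpD.
    rewrite /w rmorphM exprS; ring.
  rewrite !cabsM cabs_cexpI mulr1 cabsX cabsR.
  have w_le : cabs w = h * `|theta t|.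
    by rewrite cabsM cabsi mul1r cabsR normrM gtr0_norm.
  rewrite (le_trans (ler_wpM2l _ (cexp_taylor1 _)))//.
    by rewrite mulr_ge0 ?cabs_ge0 ?exprn_ge0.
  rewrite w_le.
  have -> : cabs (k t) * `|theta t| ^+ n *
      (4 * (h * `|theta t|) ^+ 2 * expR (h * `|theta t|)) =
      h ^+ 2 * (4 * (cabs (k t) * (`|theta t| ^+ n.+2 * expR (h * `|theta t|)))).
    by rewrite !exprS expr0; ring.
  rewrite ler_wpM2l ?sqr_ge0// -[leRHS]mulrA ler_wpM2l//.
  rewrite [leRHS]mulrCA ler_wpM2l ?cabs_ge0//.
  have -> : delta * `|theta t| =
    delta / 2 * `|theta t| + delta / 2 * `|theta t| by field.
  rewrite expRD mulrA ler_pM ?expR_ge0 ?exprn_ge0//.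
    by have := hM t; rewrite cabsX cabsR.
  by rewrite ler_expR ler_wpM2r// ltW.
apply: cabs0_eq0; apply: le_anti; rewrite cabs_ge0 andbT.
apply/ler_addgt0Pr => e e0; rewrite add0r.
pose rho := r - `|y - y0|; rewrite -/rho in step.
have rho0 : 0 < rho by rewrite subr_gt0.
have K0 : 0 <= K.
  rewrite /K mulr_ge0// Rintegral_ge0// => t _.
  by rewrite !mulr_ge0 ?cabs_ge0 ?expR_ge0.
(* The three bounds keep [y + h] in the ball, stay below [delta / 2], and make [h * K] at most
   [e]. *)
pose h := Num.min (rho / 2) (Num.min (delta / 4) (e / (K + 1))).
have h0 : 0 < h by rewrite !lt_min !divr_gt0// ltr_wpDl.
have hr : h <= rho / 2 by rewrite /h ge_min lexx.
have hd : h <= delta / 4 by rewrite /h !ge_min lexx !orbT.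
have he : h <= e / (K + 1) by rewrite /h !ge_min lexx !orbT.
have h_rho : h < rho by apply: le_lt_trans hr _; lra.
have h_delta : h < delta / 2.
  by apply: le_lt_trans hd _; have := delta_gt0; lra.
rewrite (le_trans (step h h0 h_rho h_delta))//.
rewrite (le_trans (ler_wpM2r K0 he))// mulrAC ler_pdivrMr ?ltr_wpDl//.
by rewrite ler_wpM2l ?(ltW e0)// lerDl.
Qed.

(** The factors [1 + c theta] are expanded one at a time; each may raise the moment by one, which is
    why the induction on [j] keeps [n] general. *)
Lemma Cint_poly_eq0 y : (forall n, L (fun t => (theta t)%:C ^+ n * E y t) = 0) ->
  forall c j n, L (fun t => (theta t)%:C ^+ n * E y t * (1 + c * (theta t)%:C) ^+ j) = 0.
Proof.
move=> E0 c; elim=> [|j IH] n.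
  by rewrite -(E0 n); apply: eq_Cint => t; rewrite expr0 mulr1.
have s1 : subexp (fun t => 1 + c * (theta t)%:C).
  apply: subexpD; first exact: subexp_cst.
  by apply: subexpM; [exact: subexp_cst|exact: subexp_theta].
have i m : cintegrable mu
    (fun t => k t * ((theta t)%:C ^+ m * E y t * (1 + c * (theta t)%:C) ^+ j)).
  apply: cintegrable_subexp; apply: subexpM; last exact: subexpX.
  apply: subexpM; last exact: subexp_cexpI.
  exact/subexpX/subexp_theta.
have := CintD (i n) (cintegrableM c (i n.+1)); rewrite CintM//.
rewrite (IH n : Cint _ _ = 0) (IH n.+1 : Cint _ _ = 0) mulr0 addr0 => <-.
by apply: eq_Cint => t; rewrite !exprS; ring.
Qed.

(* Both the identity theorem for the Fourier transform of an exponentially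
   decaying function ([z] imaginary) and its continuation to a strip ([z] real):
   all moments vanish, and [(1 + z theta / n)^n -> e^(z theta)] dominatedly. *)
Lemma Cint_cexp_extend (y0 r : R) z : 0 < r ->
  (forall y : R, `|y - y0| < r ->
    Cint mu (fun t => k t * cexp ('i%C * (y * theta t)%:C)) = 0) ->
  cabs z <= delta ->
  Cint mu (fun t => k t * (cexp ('i%C * (y0 * theta t)%:C) *
    cexp (z * (theta t)%:C))) = 0.
Proof.
move=> r0 E0 zd.
have y0r : `|y0 - y0| < r by rewrite subrr normr0.
have Q0 := Cint_poly_eq0 (fun n => Cint_moments_eq0 r0 E0 n y0r).
have Em := cmeas_cexpI y0.
have zm : cmeas (fun t => z * (theta t)%:C).
  by apply: cmeasM; [exact: cmeas_cst|exact: cmeasR].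
have zt t : cabs (z * (theta t)%:C) <= delta * `|theta t|.
  by rewrite cabsM cabsR ler_wpM2r.
apply: (@cvg_Cint_eq0 _ _ _ mu
  (fun n t => k t * (E y0 t * (1 + z * (theta t)%:C / n.+1%:R) ^+ n.+1)) _
  (fun t => cabs (k t) * expR (delta * `|theta t|))) => //.
- move=> n; apply: cmeasM => //; apply: cmeasM => //; apply: cmeasX.
  apply: cmeasD; first exact: cmeas_cst.
  by apply: cmeasM => //; exact: cmeas_cst.
- by apply: cmeasM => //; apply: cmeasM => //; exact: cmeas_cexp.
- move=> t; move: (z * (theta t)%:C) => w.
  apply: (@squeeze_cvgr _ _ _ _ (fun=> 0)
    (fun n => cabs (k t) * (4 * cabs w ^+ 2 * expR (cabs w) ^+ 2) * n.+1%:R^-1)).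
  + apply: nearW => n; rewrite cabs_ge0/= -mulrBr -mulrBr !cabsM cabs_cexpI mul1r.
    by rewrite -[leRHS]mulrA ler_wpM2l ?cabs_ge0 ?cexp_approx.
  + exact: cvg_cst.
  + rewrite -[X in _ --> X](mulr0 (cabs (k t) * (4 * cabs w ^+ 2 * expR (cabs w) ^+ 2))).
    by apply: cvgM; [exact: cvg_cst|exact: cvg_harmonic].
- move=> n t; rewrite !cabsM cabs_cexpI mul1r ler_wpM2l ?cabs_ge0//.
  by rewrite (le_trans (cexp_approx_le _ _))// ler_expR.
move=> n; rewrite -[RHS](Q0 (z / n.+1%:R) n.+1 0%N).
apply: eq_Cint => t; rewrite expr0 mul1r; congr (_ * (_ * _ ^+ _)).
by rewrite mulrAC.
Qed.

End AnalyticExtension.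

(** * Product measures and Fubini's theorem *)

Section ProductMeasure.
Local Open Scope ereal_scope.
Context d1 d2 (T1 : measurableType d1) (T2 : measurableType d2) (R : realType).
Variable m1 : {sigma_finite_measure set T1 -> \bar R}.
Variable m2 : {sigma_finite_measure set T2 -> \bar R}.

(* An alias of [m1 \x m2]: the sigma-finite instance inferred for the latter
   requires [m1] and [m2] to be subprobabilities. *)
Definition prodm : set (T1 * T2) -> \bar R := m1 \x m2.

HB.instance Definition _ := Measure.on prodm.

Lemma prodm_sigma_finite : sigma_finite setT prodm.
Proof.
have /sigma_finiteP[F [TF ndF Foo]] := sigma_finiteT m1.
have /sigma_finiteP[G [TG ndG Goo]] := sigma_finiteT m2.
exists (fun n => F n `*` G n).
  rewrite -setXTT TF TG predeqE => -[x y]; split.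
    move=> [/= [n _ Fnx] [k _ Gky]]; exists (maxn n k) => //; split.
    - by move: x Fnx; exact/subsetPset/ndF/leq_maxl.
    - by move: y Gky; exact/subsetPset/ndG/leq_maxr.
  by move=> [n _ []/= ? ?]; split; exists n.
move=> k; have [? ?] := Foo k; have [? ?] := Goo k.
split; first exact: measurableX.
by rewrite /prodm product_measure1E// lte_mul_pinfty// ge0_fin_numE.
Qed.

HB.instance Definition _ :=
  Measure_isSigmaFinite.Build _ _ _ prodm prodm_sigma_finite.

(** The inner integral is finite for almost every [x] only. On the exceptional null set [fine] sends
    an infinite value to 0, which the outer integral does not see. *)
Lemma Rintegral_fubini1 (f : T1 * T2 -> R) : prodm.-integrable setT (EFin \o f) ->
  (\int[m1]_x \int[m2]_y f (x, y) = \int[prodm]_z f z)%R.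
Proof.
move=> fi; rewrite /Rintegral.
have Fi := integrable_fubini_F (fi : (m1 \x m2).-integrable setT (EFin \o f)).
congr fine; rewrite -[RHS](integral12_prod_meas1 fi).
apply: ae_eq_integral => //.
- apply/measurable_EFinP; apply: measurableT_comp => //.
  exact: measurable_int Fi.
- exact: measurable_int Fi.
- have := integrable_ae measurableT Fi; apply: filterS => x h _.
  by rewrite fineK//; exact: h.
Qed.

Lemma Rintegral_fubini2 (f : T1 * T2 -> R) : prodm.-integrable setT (EFin \o f) ->
  (\int[m2]_y \int[m1]_x f (x, y) = \int[prodm]_z f z)%R.
Proof.
move=> fi; rewrite /Rintegral.
have mf : measurable_fun setT (EFin \o f) by exact: measurable_int fi.
have mG := measurable_fubini_G (fi : (m1 \x m2).-integrable setT (EFin \o f)).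
(* The inner integral is dominated by that of the absolute value, whose total is finite by
   Tonelli. *)
have Fi : m2.-integrable setT (fubini_G m1 (EFin \o f)).
  apply/integrableP; split=> //.
  apply: le_lt_trans ((integrable21ltyP m1 m2 mf).1 fi).
  apply: ge0_le_integral => //.
  - exact: measurableT_comp.
  - apply: (measurable_fun_fubini_tonelli_G (abse \o (EFin \o f))) => //.
      exact: measurableT_comp.
    by move=> z; exact: abse_ge0.
  - move=> y _; apply: le_abse_integral => //.
    exact/measurable_EFinP/(measurable_fun_pair1 y)/measurable_EFinP.
congr fine; rewrite -[RHS](integral21_prod_meas1 fi).
apply: ae_eq_integral => //.
- apply/measurable_EFinP; apply: measurableT_comp => //.
- have := integrable_ae measurableT Fi; apply: filterS => x h _.
  by rewrite fineK//; exact: h.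
Qed.

Lemma integrable_prodM (a : T1 -> R) (b : T2 -> R) :
  m1.-integrable setT (EFin \o a) -> m2.-integrable setT (EFin \o b) ->
  prodm.-integrable setT (EFin \o (fun z => (a z.1 * b z.2)%R)).
Proof.
move=> ai bi.
have ma : measurable_fun setT a by exact/measurable_EFinP/(measurable_int _ ai).
have mb : measurable_fun setT b by exact/measurable_EFinP/(measurable_int _ bi).
have mab : measurable_fun setT (fun z : T1 * T2 => (a z.1 * b z.2)%R).
  by apply: measurable_funM; apply: measurableT_comp.
apply/(integrable12ltyP m1 m2); first exact/measurable_EFinP.
rewrite /=.
under eq_integral => x _.
  under eq_integral => y _ do rewrite normrM EFinM.
  rewrite ge0_integralZl//; last exact/measurable_EFinP/measurableT_comp.
  over.
move/integrableP : ai => [_ ai]; move/integrableP : bi => [_ bi].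
set c := \int[m2]_y _.
have c0 : 0 <= c by apply: integral_ge0 => y _; rewrite lee_fin.
rewrite ge0_integralZr//; last exact/measurable_EFinP/measurableT_comp.
have a0 : 0 <= \int[m1]_x `|a x|%:E by apply: integral_ge0 => x _; rewrite lee_fin.
by apply: lte_mul_pinfty => //; rewrite ge0_fin_numE.
Qed.

End ProductMeasure.

Section ComplexFubini.
Context d1 d2 (T1 : measurableType d1) (T2 : measurableType d2) (R : realType).
Variable m1 : {sigma_finite_measure set T1 -> \bar R}.
Variable m2 : {sigma_finite_measure set T2 -> \bar R}.
Variable f : T1 * T2 -> R[i].
Hypothesis fi : cintegrable (prodm m1 m2) f.

Lemma Cint_fubini1 :
  Cint m1 (fun x => Cint m2 (fun y => f (x, y))) = Cint (prodm m1 m2) f.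
Proof.
have [fr fim] := fi.
by apply: complex_ext => /=; [exact: Rintegral_fubini1 fr|exact: Rintegral_fubini1 fim].
Qed.

Lemma Cint_fubini2 :
  Cint m2 (fun y => Cint m1 (fun x => f (x, y))) = Cint (prodm m1 m2) f.
Proof.
have [fr fim] := fi.
by apply: complex_ext => /=; [exact: Rintegral_fubini2 fr|exact: Rintegral_fubini2 fim].
Qed.

End ComplexFubini.

(** * The Gamma function on the critical line *)

Section HalfLine.
Context {R : realType}.
Local Notation mu := (@lebesgue_measure R).

Implicit Types x t : R.

Lemma FTC2_pos (f F : R -> R) (a b : R) : 0 < a -> a < b ->
  (forall x, 0 < x -> is_derive x 1 F (f x)) ->
  (forall x, 0 < x -> {for x, continuous f}) ->
  (\int[mu]_(x in `[a, b]) (f x)%:E = (F b)%:E - (F a)%:E)%E.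
Proof.
move=> a0 ab dF cf.
have cF x : 0 < x -> {for x, continuous F}.
  move=> x0; apply: differentiable_continuous; apply/derivable1_diffP.
  by have [] := dF x x0.
apply: continuous_FTC2 => //.
- apply: continuous_in_subspaceT => x; rewrite inE/= in_itv/= => /andP[ax _].
  by apply: cf; exact: lt_le_trans ax.
- split.
  + move=> x; rewrite in_itv/= => /andP[ax _].
    by have [] := dF x (lt_trans a0 ax).
  + by apply: cvg_at_right_filter; exact: cF.
  + by apply: cvg_at_left_filter; apply: cF; exact: lt_trans ab.
- move=> x; rewrite in_itv/= => /andP[ax _].
  by rewrite derive1E; have [_ ->] := dF x (lt_trans a0 ax).
Qed.

Let A n : set R := `[n.+1%:R^-1, n.+1%:R].

Let ndA : nondecreasing_seq A.
Proof.
move=> m n mn; apply/subsetPset => x; rewrite /A /= !in_itv/= => /andP[mx xm].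
have mn' : (m.+1%:R : R) <= n.+1%:R by rewrite ler_nat.
rewrite (le_trans xm mn') andbT (le_trans _ mx)//.
by rewrite lef_pV2// posrE.
Qed.

Let A_pos n : A n `<=` Rpos.
Proof.
move=> x; rewrite /A /Rpos /= !in_itv/= andbT => /andP[nx _].
by rewrite (lt_le_trans _ nx)// invr_gt0.
Qed.

Let A_near x : 0 < x -> \forall n \near \oo, A n x.
Proof.
move=> x0; exists (Num.truncn x + Num.truncn x^-1)%N => // n /= hn.
rewrite /A /= in_itv /=; apply/andP; split.
  rewrite invf_ple ?posrE//; apply: le_trans (ltW (truncnS_gt _)) _.
  by rewrite ler_nat ltnS (leq_trans _ hn)// leq_addl.
apply: le_trans (ltW (truncnS_gt _)) _.
by rewrite ler_nat ltnS (leq_trans _ hn)// leq_addr.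
Qed.

Let bigcupA : \bigcup_n A n = Rpos.
Proof.
apply/seteqP; split => x; first by move=> [n _]; exact: A_pos.
rewrite /Rpos /= in_itv/= andbT => /A_near[n _ h].
by exists n => //; exact: (h n (leqnn n)).
Qed.

Lemma measurable_fun_pos (f : R -> R) :
  (forall x, 0 < x -> {for x, continuous f}) -> measurable_fun Rpos f.
Proof.
move=> cf; apply: open_continuous_measurable_fun; first exact: interval_open.
by move=> x; rewrite inE /Rpos /= in_itv/= andbT; exact: cf.
Qed.

Section FTC.
Variables (f F : R -> R) (l0 l1 : R).
Hypothesis dF : forall x, 0 < x -> is_derive x 1 F (f x).
Hypothesis cf : forall x, 0 < x -> {for x, continuous f}.
Hypothesis F0 : F n.+1%:R^-1 @[n --> \oo] --> l0.
Hypothesis F1 : F n.+1%:R @[n --> \oo] --> l1.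

Let cvgA : (\int[mu]_(x in A n) (f x)%:E)%E @[n --> \oo] --> (l1 - l0)%:E.
Proof.
have : (F n.+1%:R - F n.+1%:R^-1)%:E @[n --> \oo] --> (l1 - l0)%:E.
  by apply: cvg_EFin; [exact: nearW|exact: cvgB F1 F0].
apply: cvg_trans; apply: near_eq_cvg; exists 1%N => // n /= n1.
rewrite (@FTC2_pos f F) ?EFinB ?invr_gt0//.
by apply: (@lt_trans _ _ 1); rewrite ?invf_lt1// ltr1n.
Qed.

Lemma measurable_Rpos : measurable (Rpos : set R).
Proof. exact: measurable_itv. Qed.

(** Dominated convergence along [[1/(n+1), n+1]], where the primitive is regular; its values at 0
    and at infinity enter only as limits along these endpoints. *)
Lemma FTC_pos : mu.-integrable Rpos (EFin \o f) ->
  (\int[mu]_(x in Rpos) f x = l1 - l0)%R.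
Proof.
move=> fi; have mf := measurable_fun_pos cf.
have [] := @dominated_convergence _ _ R mu Rpos measurable_Rpos
  (fun n => (EFin \o f) \_ (A n)) (EFin \o f) (abse \o (EFin \o f)).
- move=> n; apply: measurable_funS (measurableT) _ _ => //.
  apply/(measurable_restrictT (EFin \o f)); first exact: measurable_itv.
  apply/measurable_EFinP; exact: (measurable_funS measurable_Rpos (@A_pos n) mf).
- exact/measurable_EFinP.
- apply: aeW => x; rewrite /Rpos /= in_itv/= andbT => /A_near xA.
  apply: cvg_near_cst; apply: filterS xA => n xn.
  by rewrite patchE mem_set.
- by apply: integrable_abse => //; exact: measurable_Rpos.
- by apply: aeW => x n _; rewrite patchE; case: ifPn => //= _; rewrite normr0 lee_fin.
move=> _ _ h.
have {}h : (\int[mu]_(x in A n) (f x)%:E)%E @[n --> \oo] -->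
    (\int[mu]_(x in Rpos) (f x)%:E)%E.
  apply: cvg_trans h; apply: near_eq_cvg; apply: nearW => n.
  by rewrite /= -integral_mkcondr setIidr//; exact: A_pos.
have := cvg_unique (@ereal_hausdorff R) h cvgA.
by rewrite /Rintegral => ->.
Qed.

(** For a nonnegative integrand, monotone convergence turns finite limits of a primitive into
    integrability. The explicit majorants [e^(-e t)], [t^(-1/2) / (1 + t)] and [1 / (1 + t^2)] are
    obtained in this way. *)
Lemma FTC_pos_ge0 : (forall x, 0 < x -> 0 <= f x) ->
  mu.-integrable Rpos (EFin \o f).
Proof.
move=> f0; have mf := measurable_fun_pos cf.
apply/integrableP; split; first exact/measurable_EFinP.
have f0' x : Rpos x -> 0 <= f x.
  by rewrite /Rpos /= in_itv/= andbT; exact: f0.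
have mA n : measurable (A n) by exact: measurable_itv.
have mfA n : measurable_fun (A n) (EFin \o f).
  apply/measurable_EFinP.
  exact: (measurable_funS measurable_Rpos (@A_pos n) mf).
have fA n x : A n x -> (0 <= (EFin \o f) x)%E by move=> /A_pos /f0'; rewrite lee_fin.
have := ge0_nondecreasing_set_cvg_integral (mu := mu) ndA mA mfA fA.
rewrite bigcupA => h.
have h2 := cvg_unique (@ereal_hausdorff R) h cvgA.
have -> : (\int[mu]_(x in Rpos) `|(EFin \o f) x| = (l1 - l0)%:E)%E.
  rewrite -h2; apply: eq_integral => x.
  by rewrite inE => /f0' fx /=; rewrite ger0_norm.
exact: ltry.
Qed.

End FTC.

Lemma is_derive_continuous (f : R -> R) x (d : R) : is_derive x 1 f d -> {for x, continuous f}.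
Proof. by move=> [df _]; apply: differentiable_continuous; apply/derivable1_diffP. Qed.

Lemma cvg_natS (f : R -> R) (l : R) : f t @[t --> +oo%R] --> l ->
  f n.+1%:R @[n --> \oo] --> l.
Proof.
move=> h; have h1 : (n.+1%:R : R) @[n --> \oo] --> +oo%R.
  apply/cvgryPge => M; exists (Num.truncn M) => // n /= hn.
  by rewrite (le_trans (ltW (truncnS_gt _)))// ler_nat ltnS.
exact: (cvg_comp _ _ h1 h).
Qed.

Lemma cvg_invS (f : R -> R) : {for 0, continuous f} ->
  f n.+1%:R^-1 @[n --> \oo] --> f 0.
Proof.
move=> cf; have h1 : (n.+1%:R^-1 : R) @[n --> \oo] --> (0 : R) by exact: cvg_harmonic.
exact: (cvg_comp _ _ h1 cf).
Qed.

Lemma cvg_expRN (e : R) : 0 < e -> expR (- (e * n.+1%:R)) @[n --> \oo] --> (0 : R).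
Proof.
move=> e0.
apply: (@squeeze_cvgr _ _ _ _ (fun=> 0) (fun n => e^-1 * n.+1%:R^-1)).
- apply: nearW => n; rewrite expR_ge0/= expRN -invfM.
  rewrite lef_pV2 ?posrE ?expR_gt0 ?mulr_gt0//.
  by rewrite (le_trans _ (expR_ge1Dx _))// lerDr.
- exact: cvg_cst.
- rewrite -[X in _ --> X](mulr0 e^-1).
  by apply: cvgM; [exact: cvg_cst|exact: cvg_harmonic].
Qed.

Lemma is_derive_expRN (e x : R) :
  is_derive x 1 (fun t => expR (- (e * t))) (- e * expR (- (e * x))).
Proof.
have h : is_derive x 1 (fun t => - (e * t)) (- e).
  have := @is_deriveN _ _ _ _ x 1 _ (@is_deriveZ _ _ _ id e x 1 1 (is_derive_id _ _)).
  by rewrite /GRing.scale /= mulr1.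
have := @is_derive1_comp _ expR (fun t => - (e * t)) x _ _ (is_derive_expR _) h.
by rewrite mulrC.
Qed.

Lemma integrable_expRN (e : R) : 0 < e ->
  mu.-integrable Rpos (EFin \o (fun t => expR (- (e * t)))).
Proof.
move=> e0.
have dF x := @is_deriveZ _ _ _ _ (- e^-1) x 1 _ (is_derive_expRN e x).
apply: (@FTC_pos_ge0 _ (- e^-1 \*: (fun t => expR (- (e * t)))) (- e^-1 * 1) (- e^-1 * 0)).
- move=> x _; have := dF x; rewrite /GRing.scale /= mulrA mulrNN mulVf ?gt_eqF//.
  by rewrite mul1r.
- by move=> x _; exact: is_derive_continuous (is_derive_expRN e x).
- apply: cvgM; first exact: cvg_cst.
  have := @cvg_invS (fun t => expR (- (e * t))) (is_derive_continuous (is_derive_expRN e 0)).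
  by rewrite mulr0 oppr0 expR0.
- by apply: cvgM; [exact: cvg_cst|exact: cvg_expRN].
- by move=> x _; exact: expR_ge0.
Qed.

(** The real part of [e^((i x - e) t) / (i x - e)]: the primitive of [e^(-e t) cos(x t)] that
    vanishes at infinity. *)
Let poissonF (e x t : R) :=
  expR (- (e * t)) * ((e ^+ 2 + x ^+ 2)^-1 * (x * sin (x * t) - e * cos (x * t))).

Let is_derive_poissonF (e x t : R) : 0 < e ->
  is_derive t 1 (poissonF e x) (expR (- (e * t)) * cos (x * t)).
Proof.
move=> e0.
have dx : is_derive t 1 (fun t => x * t) x.
  have := @is_deriveZ _ _ _ id x t 1 1 (is_derive_id _ _).
  by rewrite /GRing.scale /= mulr1.
have ds := @is_derive1_comp _ sin (fun t => x * t) t _ _ (is_derive_sin _) dx.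
have dc := @is_derive1_comp _ cos (fun t => x * t) t _ _ (is_derive_cos _) dx.
have de := is_derive_expRN e t.
have d1 := is_deriveB (is_deriveZ x ds) (is_deriveZ e dc).
have d2 := is_deriveM de (is_deriveZ (e ^+ 2 + x ^+ 2)^-1 d1).
have ex0 : e ^+ 2 + x ^+ 2 != 0.
  by rewrite gt_eqF// ltr_wpDr ?sqr_ge0// exprn_gt0.
apply: (is_derive_eq d2); rewrite !fctE /GRing.scale /= /GRing.scale /=.
by field.
Qed.

Lemma integrable_expRN_cos (e x : R) : 0 < e ->
  mu.-integrable Rpos (EFin \o (fun t => expR (- (e * t)) * cos (x * t))).
Proof.
move=> e0; apply: le_integrable (integrable_expRN e0); first exact: measurable_Rpos.
  apply/measurable_EFinP; apply: measurable_funTS; apply: measurable_funM.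
    apply: measurableT_comp => //; apply: measurableT_comp => //.
  apply: measurableT_comp => //.
  exact: continuous_measurable_fun (@continuous_cos R).
move=> t _ /=; rewrite lee_fin normrM ler_piMr// cos_max//.
Qed.

Lemma poisson_pos (e x : R) : 0 < e ->
  \int[mu]_(t in Rpos) (expR (- (e * t)) * cos (x * t)) = e / (e ^+ 2 + x ^+ 2).
Proof.
move=> e0.
have ex0 : 0 < e ^+ 2 + x ^+ 2 by rewrite ltr_wpDr ?sqr_ge0// exprn_gt0.
transitivity (0 - poissonF e x 0); last first.
  rewrite /poissonF !mulr0 oppr0 expR0 cos0 sin0 mul1r mulr0 mulr1 !sub0r.
  by rewrite mulrN opprK mulrC.
apply: (FTC_pos (fun t _ => is_derive_poissonF x t e0)).
- move=> t _; apply: continuousM; first exact: is_derive_continuous (is_derive_expRN e t).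
  apply: (@continuous_comp _ _ _ (fun t => x * t) cos); last exact: continuous_cos.
  exact: mulrl_continuous.
- by apply: cvg_invS; exact: is_derive_continuous (is_derive_poissonF _ _ e0).
- pose K := (e ^+ 2 + x ^+ 2)^-1 * (`|x| + e).
  apply/cvgr0Pnorm_le => d d0.
  have h : expR (- (e * n.+1%:R)) * K @[n --> \oo] --> (0 : R).
    by rewrite -[X in _ --> X](mul0r K); apply: cvgM; [exact: cvg_expRN|exact: cvg_cst].
  move/cvgr0Pnorm_le : h => /(_ d d0); apply: filterS => n; apply: le_trans.
  rewrite /poissonF normrM [leRHS]normrM ler_wpM2l// [leRHS]ger0_norm; last first.
    by rewrite mulr_ge0 ?addr_ge0 ?invr_ge0// ltW.
  rewrite normrM ger0_norm ?invr_ge0 ?(ltW ex0)// ler_wpM2l ?invr_ge0 ?(ltW ex0)//.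
  rewrite (le_trans (ler_normB _ _))// !normrM (gtr0_norm e0).
  by rewrite lerD// ler_piMr ?(ltW e0)// ?sin_max ?cos_max.
exact: integrable_expRN_cos.
Qed.

Lemma is_derive_sqrt_atan t : 0 < t ->
  is_derive t 1 (fun u => 2 * atan (Num.sqrt u)) ((Num.sqrt t)^-1 / (1 + t)).
Proof.
move=> t0; have ds := @is_derive1_sqrt R t t0.
have da := @is_derive1_comp _ atan Num.sqrt t _ _ (is_derive1_atan _) ds.
have d2 := is_deriveZ 2 da.
apply: (is_derive_eq d2); rewrite sqr_sqrtr ?ltW// /GRing.scale /=.
have s0 : Num.sqrt t != 0 by rewrite gt_eqF// sqrtr_gt0.
by field; rewrite s0 gt_eqF// addr_gt0.
Qed.

(** A common majorant, up to constants, of all the Euler weights: it has their singularity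
    [t^(-1/2)] at 0 and an elementary primitive. *)
Lemma integrable_invsqrt_oneD :
  mu.-integrable Rpos (EFin \o (fun t => (Num.sqrt t)^-1 / (1 + t))).
Proof.
apply: (FTC_pos_ge0 (F := fun u => 2 * atan (Num.sqrt u)) (l0 := 2 * atan (Num.sqrt 0)) (l1 := 2 * (pi / 2))) => [x x0|x x0| | |x x0].
- exact: is_derive_sqrt_atan.
- apply: continuousM; apply: cvgV; rewrite ?gt_eqF ?sqrtr_gt0 ?addr_gt0//.
    exact: sqrt_continuous.
  by apply: continuousD; [exact: cvg_cst|exact: cvg_id].
- apply: (@cvg_invS (fun u => 2 * atan (Num.sqrt u))).
  apply: continuousM; first exact: cvg_cst.
  apply: (@continuous_comp _ _ _ Num.sqrt atan); first exact: sqrt_continuous.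
  exact: continuous_atan.
- apply: cvgM; first exact: cvg_cst.
  apply: (@cvg_comp _ _ _ (fun n => Num.sqrt n.+1%:R) atan _ +oo%R); last exact: cvgy_atan.
  apply/cvgryPge => M; exists (Num.truncn (M ^+ 2)) => // n /= hn.
  rewrite (le_trans (ler_norm _))// -sqrtr_sqr ler_wsqrtr//.
  by rewrite (le_trans (ltW (truncnS_gt _)))// ler_nat ltnS.
- by rewrite divr_ge0 ?invr_ge0 ?sqrtr_ge0// addr_ge0// ltW.
Qed.

Lemma powR_half t n : 0 < t ->
  t `^ (n%:R - 2^-1) = t ^+ n * (Num.sqrt t)^-1.
Proof.
move=> t0; rewrite powRB; last by rewrite (gt_eqF t0) implybT.
by rewrite powR_mulrn ?powR12_sqrt ?ltW.
Qed.

(* The weight of Euler's integral for [Gamma (n + 1/2)]. *)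
Definition euler_weight (n : nat) (t : R) : R := t `^ (n%:R - 2^-1) * expR (- t).

Lemma euler_weight_ge0 n t : 0 <= euler_weight n t.
Proof. by rewrite mulr_ge0 ?powR_ge0 ?expR_ge0. Qed.

Lemma euler_weightS n t : 0 < t -> euler_weight n.+1 t = t * euler_weight n t.
Proof.
by move=> t0; rewrite /euler_weight !powR_half// exprS !mulrA.
Qed.

Lemma continuous_euler_weight n t : 0 < t -> {for t, continuous (euler_weight n)}.
Proof.
move=> t0; apply: continuousM.
  exact: is_derive_continuous (@is_derive1_powR _ _ _ t0).
by apply: (@continuous_comp _ _ _ -%R expR); [exact: opp_continuous|exact: continuous_expR].
Qed.

(** After cancelling [t^(-1/2)] this reads [t^n + t^(n+1) <= (n! + (n+1)!) e^t], two terms of the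
    exponential series. *)
Lemma euler_weight_le n t : 0 < t ->
  euler_weight n t <= (n`! + n.+1`!)%:R * ((Num.sqrt t)^-1 / (1 + t)).
Proof.
move=> t0; rewrite /euler_weight powR_half//.
rewrite mulrAC mulrC [leRHS]mulrCA ler_wpM2l ?invr_ge0 ?sqrtr_ge0//.
rewrite ler_pdivlMr ?addr_gt0// expRN mulrAC ler_pdivrMr ?expR_gt0//.
rewrite mulrDr mulr1 -exprSr natrD mulrDl.
by rewrite lerD// exprn_le_expR// ltW.
Qed.

Let integrableZ_pos (k : R) (f : R -> R) : mu.-integrable Rpos (EFin \o f) ->
  mu.-integrable Rpos (EFin \o (fun t => k * f t)).
Proof. by move=> fi; exact: (@integrableZl _ _ R mu Rpos measurable_Rpos k _ fi). Qed.

Let integrableD_pos (f g : R -> R) : mu.-integrable Rpos (EFin \o f) ->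
  mu.-integrable Rpos (EFin \o g) ->
  mu.-integrable Rpos (EFin \o (fun t => f t + g t)).
Proof. by move=> fi gi; exact: (@integrableD _ _ R mu Rpos measurable_Rpos _ _ fi gi). Qed.

Let integrableB_pos (f g : R -> R) : mu.-integrable Rpos (EFin \o f) ->
  mu.-integrable Rpos (EFin \o g) ->
  mu.-integrable Rpos (EFin \o (fun t => f t - g t)).
Proof. by move=> fi gi; exact: (@integrableB _ _ R mu Rpos measurable_Rpos _ _ fi gi). Qed.

Lemma integrable_euler_weight n : mu.-integrable Rpos (EFin \o euler_weight n).
Proof.
have := integrableZ_pos (n`! + n.+1`!)%:R integrable_invsqrt_oneD.
apply: le_integrable; first exact: measurable_Rpos.
  apply/measurable_EFinP; apply: measurable_fun_pos => x.
  exact: continuous_euler_weight.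
move=> t; rewrite /Rpos /= in_itv/= andbT => t0.
rewrite lee_fin ger0_norm ?euler_weight_ge0// (le_trans (euler_weight_le n t0))//.
exact: ler_norm.
Qed.

(** As [t^(i v) = e^(i v ln t)], the choices [cos] and [sin] for [q] give the real and imaginary
    parts of [Gamma(n + 1/2 + i v)]. *)
Let gam n (q : R -> R) (v : R) :=
  \int[mu]_(t in Rpos) (euler_weight n t * q (v * ln t)).

Lemma integrable_euler_weightM n (q : R -> R) (v : R) : continuous q ->
  (forall y, `|q y| <= 1) ->
  mu.-integrable Rpos (EFin \o (fun t => euler_weight n t * q (v * ln t))).
Proof.
move=> cq q1; have := integrable_euler_weight n.
apply: le_integrable; first exact: measurable_Rpos.
  apply/measurable_EFinP; apply: measurable_fun_pos => x x0.
  apply: continuousM; first exact: continuous_euler_weight.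
  apply: (@continuous_comp _ _ _ (fun u => v * ln u) q); last exact: cq.
  by apply: continuousM; [exact: cvg_cst|exact: continuous_ln].
move=> t; rewrite /Rpos /= in_itv/= andbT => t0.
by rewrite lee_fin normrM ler_piMr.
Qed.

(* Integrate the derivative of [t^(n + 1/2) e^(-t) q(v ln t)]. *)
Lemma gam_rec n (q q1 : R -> R) (v : R) :
  (forall y : R, is_derive y 1 q (q1 y)) -> continuous q1 ->
  (forall y, `|q y| <= 1) -> (forall y, `|q1 y| <= 1) ->
  gam n.+1 q v = (n%:R + 2^-1) * gam n q v + v * gam n q1 v.
Proof.
move=> dq cq1 q_le q1_le.
have cq : continuous q by move=> y; exact: is_derive_continuous (dq y).
have i0 := integrable_euler_weightM n v cq q_le.
have i1 := integrable_euler_weightM n v cq1 q1_le.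
have i2 := integrable_euler_weightM n.+1 v cq q_le.
pose f t := (n%:R + 2^-1) * (euler_weight n t * q (v * ln t)) +
  v * (euler_weight n t * q1 (v * ln t)) - euler_weight n.+1 t * q (v * ln t).
pose F t := t `^ (n.+1%:R - 2^-1) * (expR (- t) * q (v * ln t)).
have nE : n.+1%:R - 2^-1 = n%:R + 2^-1 :> R by rewrite -natr1; lra.
have dF t : 0 < t -> is_derive t 1 F (f t).
  move=> t0.
  have dp := @is_derive1_powR R (n.+1%:R - 2^-1) t t0.
  have dl := is_deriveZ v (@is_derive1_ln R t t0).
  have dqq := @is_derive1_comp _ q (fun u => v * ln u) t _ _ (dq _) dl.
  have de := @is_derive1_comp _ expR -%R t _ _ (is_derive_expR _) (is_deriveNid _ _).
  have d := is_deriveM dp (is_deriveM de dqq).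
  apply: (is_derive_eq d).
  rewrite !fctE /GRing.scale /= /f /euler_weight /GRing.scale /=.
  rewrite nE.
  have -> : n%:R + 2^-1 - 1 = n%:R - 2^-1 :> R by lra.
  rewrite -nE !powR_half// exprS; move: (Num.sqrt t)^-1 => s.
  by field; rewrite gt_eqF.
have if1 := integrableZ_pos (n%:R + 2^-1) i0.
have if2 := integrableZ_pos v i1.
have if12 := integrableD_pos if1 if2.
have fi : mu.-integrable Rpos (EFin \o f).
  exact: integrableB_pos if12 i2.
have F_le t : 0 < t -> `|F t| <= t ^+ n.+1 * (Num.sqrt t)^-1 * expR (- t).
  move=> t0; rewrite /F mulrA normrM.
  apply: le_trans (ler_piMr (normr_ge0 _) (q_le _)) _.
  rewrite powR_half// ger0_norm// mulr_ge0 ?expR_ge0//.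
  by rewrite mulr_ge0 ?invr_ge0 ?sqrtr_ge0 ?exprn_ge0 ?(ltW t0).
have sqE t : 0 < t -> t * (Num.sqrt t)^-1 = Num.sqrt t.
  move=> t0; rewrite -{1}(sqr_sqrtr (ltW t0)) expr2 mulfK//.
  by rewrite gt_eqF// sqrtr_gt0.
have : \int[mu]_(t in Rpos) f t = 0 - 0.
  apply: (FTC_pos dF) => //.
  - move=> t t0.
    have c (p : R -> R) m : continuous p ->
        {for t, continuous (fun t => euler_weight m t * p (v * ln t))}.
      move=> cp; apply: continuousM; first exact: continuous_euler_weight.
      apply: (@continuous_comp _ _ _ (fun u => v * ln u) p); last exact: cp.
      by apply: continuousM; [exact: cvg_cst|exact: continuous_ln].
    apply: continuousB; last exact: c.
    by apply: continuousD; apply: continuousM; (exact: cvg_cst || exact: c).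
  (* At 0 the boundary term is at most [sqrt t]. *)
  - apply/cvgr0Pnorm_le => d d0.
    have := @cvg_invS (@Num.sqrt R) (@sqrt_continuous R 0).
    rewrite sqrtr0 => /cvgr0Pnorm_le /(_ d d0); apply: filterS => m.
    apply: le_trans; set t := _^-1; have t0 : 0 < t by rewrite invr_gt0.
    rewrite (le_trans (F_le t t0))// exprSr -[_ * t * _]mulrA sqE//.
    rewrite mulrAC ger0_norm ?sqrtr_ge0// ler_piMl ?sqrtr_ge0//.
    rewrite mulr_ile1 ?exprn_ge0 ?expR_ge0 ?(ltW t0)//.
      by rewrite exprn_ile1 ?(ltW t0)// invf_le1// ler1n.
    by rewrite -expR0 ler_expR oppr_le0 ltW.
  (* At infinity it is at most [t^(n+1) e^(-t) <= (n+2)! / t]. *)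
  - apply/cvgr0Pnorm_le => d d0.
    have h : n.+2`!%:R * m.+1%:R^-1 @[m --> \oo] --> (0 : R).
      rewrite -[X in _ --> X](mulr0 (n.+2`!%:R : R)).
      by apply: cvgM; [exact: cvg_cst|exact: cvg_harmonic].
    move/cvgr0Pnorm_le : h => /(_ d d0); apply: filterS => m.
    apply: le_trans; set t := m.+1%:R; have t0 : 0 < t by [].
    rewrite (le_trans (F_le t t0))// [leRHS]ger0_norm ?mulr_ge0 ?invr_ge0//.
    have h := exprn_le_expR n.+2 (ltW t0).
    rewrite ler_pdivlMr// expRN mulrAC -ler_pdivlMr ?invr_gt0 ?expR_gt0// invrK.
    rewrite mulrAC -exprSr (le_trans _ h)// ler_piMr ?exprn_ge0 ?(ltW t0)//.
    rewrite invf_le1 ?sqrtr_gt0// -[leLHS]sqrtr1 ler_wsqrtr//.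
    by rewrite /t ler1n.
rewrite subr0 /f RintegralB//; last exact: measurable_Rpos.
rewrite RintegralD//; last exact: measurable_Rpos.
rewrite !RintegralZl//; try exact: measurable_Rpos.
by move=> /eqP; rewrite subr_eq0 => /eqP h; exact/esym.
Qed.

(** With [gam_sinS], the functional equation [Gamma(z + 1) = z Gamma(z)] at [z = n + 1/2 + i v],
    split into real and imaginary parts. *)
Lemma gam_cosS n v :
  gam n.+1 cos v = (n%:R + 2^-1) * gam n cos v - v * gam n sin v.
Proof.
rewrite (@gam_rec n cos (fun y => - sin y))//; last 3 first.
- by move=> y; apply: continuousN; exact: continuous_sin.
- exact: cos_max.
- by move=> y; rewrite normrN sin_max.
congr (_ + _); rewrite -mulrN; congr (_ * _).
rewrite /gam -mulN1r -RintegralZl; [|exact: measurable_Rpos|].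
  by apply: eq_Rintegral => t _; rewrite mulrN mulN1r.
exact: (integrable_euler_weightM n v (@continuous_sin R) (@sin_max R)).
Qed.

Lemma gam_sinS n v :
  gam n.+1 sin v = (n%:R + 2^-1) * gam n sin v + v * gam n cos v.
Proof.
by apply: gam_rec => //; [exact: continuous_cos|exact: sin_max|exact: cos_max].
Qed.

(** The value [Gamma(n + 1/2)]. *)
Let eweight n := \int[mu]_(t in Rpos) euler_weight n t.

Lemma eweightE n : eweight n = gam n cos 0.
Proof. by apply: eq_Rintegral => t _; rewrite mul0r cos0 mulr1. Qed.

Lemma eweightS n : eweight n.+1 = (n%:R + 2^-1) * eweight n.
Proof. by rewrite !eweightE gam_cosS mul0r subr0. Qed.

Lemma eweight_gt0 n : 0 < eweight n.
Proof.
elim: n => [|n IH]; last by rewrite eweightS mulr_gt0// ltr_wpDl.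
(* A lower bound for [t^(-1/2) e^(-t)] on [[1, 2]], where [sqrt t <= 2]. *)
pose c : R := (2 * expR 2)^-1.
have c0 : 0 < c by rewrite invr_gt0 mulr_gt0// expR_gt0.
have sub : `[1, 2]%classic `<=` (Rpos : set R).
  by move=> t; rewrite /Rpos /= !in_itv/= andbT => /andP[t1 _]; exact: lt_le_trans t1.
have i12 : mu.-integrable `[1, 2] (EFin \o euler_weight 0).
  exact: (@integrableS _ _ _ mu Rpos _ _ measurable_Rpos (measurable_itv _) sub
    (integrable_euler_weight 0)).
have : \int[mu]_(t in `[1, 2]) c <= \int[mu]_(t in `[1, 2]) euler_weight 0 t.
  apply: le_Rintegral => //.
    apply/integrableP; split; first exact: measurable_cst.
    rewrite integral_cst//= lebesgue_measure_itv/= lte_fin ltr1n.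
    by rewrite -EFinD -EFinM ltry.
  move=> t; rewrite /= in_itv/= => /andP[t1 t2].
  have t0 : 0 < t by exact: lt_le_trans t1.
  rewrite /euler_weight powR_half// expr0 mul1r expRN -invfM.
  rewrite lef_pV2 ?posrE ?mulr_gt0 ?sqrtr_gt0 ?expR_gt0//.
  rewrite ler_pM ?sqrtr_ge0 ?expR_ge0 ?ler_expR//.
  have -> : (2 : R) = Num.sqrt (2 ^+ 2) by rewrite sqrtr_sqr ger0_norm.
  by rewrite ler_wsqrtr//; lra.
rewrite Rintegral_cst; last exact: measurable_itv.
rewrite /= lebesgue_measure_itv/= lte_fin ltr1n -EFinD /=.
have -> : (2 - 1 : R) = 1 by lra.
rewrite mulr1 => cle; apply: lt_le_trans c0 (le_trans cle _).
apply: fine_le.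
- by rewrite integrable_fin_num.
- by rewrite integrable_fin_num//; [exact: measurable_Rpos|exact: integrable_euler_weight].
apply: ge0_subset_integral => //; first exact: measurable_Rpos.
  apply/measurable_EFinP; apply: measurable_fun_pos => x.
  exact: continuous_euler_weight.
by move=> t _; rewrite lee_fin euler_weight_ge0.
Qed.

(** This is [|ln s| <= |s - 1/s|] at [s = sqrt t]. The bound combines [t], 1 and [1/t], whose
    integrals against an Euler weight are again values of [eweight]. *)
Lemma ln_sqr_le t : 0 < t -> ln t ^+ 2 <= 4 * (t - 2 + t^-1).
Proof.
move=> t0; pose s := Num.sqrt t; have s0 : 0 < s by rewrite sqrtr_gt0.
have tE : t = s ^+ 2 by rewrite sqr_sqrtr// ltW.
have h (u : R) : 0 < u -> ln u <= u - 1.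
  move=> u0; have -> : ln u = ln (1 + (u - 1)) by congr ln; ring.
  by apply: le_ln1Dx; lra.
have h1 := h s s0; have h2 := h s^-1; rewrite invr_gt0 lnV ?posrE// in h2.
have {}h2 := h2 s0.
have -> : ln t = 2 * ln s by rewrite tE lnXn// mulr_natl.
have -> : t - 2 + t^-1 = (s - s^-1) ^+ 2 by rewrite tE; field; rewrite gt_eqF.
rewrite exprMn -natrX ler_wpM2l//.
have sV : s * s^-1 = 1 by rewrite mulfV// gt_eqF.
have sV0 : 0 < s^-1 by rewrite invr_gt0.
rewrite -(real_normK (num_real (ln s))) -(real_normK (num_real (s - s^-1))).
rewrite lerXn2r ?nnegrE//.
have [s1|s1] := leP 1 s.
  have v1 : s^-1 <= 1 by rewrite invf_le1.
  by rewrite !ger0_norm ?ln_ge0//; lra.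
have v1 : 1 <= s^-1 by rewrite invf_ge1// ltW.
by rewrite !ler0_norm ?ln_le0 ?(ltW s1)//; lra.
Qed.

Let RintZ_pos (k : R) (f : R -> R) : mu.-integrable Rpos (EFin \o f) ->
  \int[mu]_(t in Rpos) (k * f t) = k * \int[mu]_(t in Rpos) f t.
Proof. by move=> fi; apply: RintegralZl fi; exact: measurable_Rpos. Qed.

Let RintD_pos (f g : R -> R) : mu.-integrable Rpos (EFin \o f) ->
  mu.-integrable Rpos (EFin \o g) ->
  \int[mu]_(t in Rpos) (f t + g t) =
  \int[mu]_(t in Rpos) f t + \int[mu]_(t in Rpos) g t.
Proof. by move=> fi gi; apply: RintegralD fi gi; exact: measurable_Rpos. Qed.

Let RintB_pos (f g : R -> R) : mu.-integrable Rpos (EFin \o f) ->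
  mu.-integrable Rpos (EFin \o g) ->
  \int[mu]_(t in Rpos) (f t - g t) =
  \int[mu]_(t in Rpos) f t - \int[mu]_(t in Rpos) g t.
Proof. by move=> fi gi; apply: RintegralB fi gi; exact: measurable_Rpos. Qed.

(* [cos y >= 1 - y^2] at [y = v ln (t / c)] with [c = n + 3/2], the mean of the
   Gamma distribution of density proportional to [euler_weight n.+1]. *)
Lemma gam_lower n v : 8 * v ^+ 2 <= n%:R + 2^-1 ->
  exists y, eweight n.+1 / 2 <= `|cos y * gam n.+1 cos v + sin y * gam n.+1 sin v|.
Proof.
move=> hv; pose c : R := n%:R + 1 + 2^-1; pose y := v * ln c; exists y.
have n0 : (0 : R) <= n%:R by [].
have c0 : 0 < c by rewrite /c; lra.
have ic := integrable_euler_weightM n.+1 v (@continuous_cos R) (@cos_max R).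
have is_ := integrable_euler_weightM n.+1 v (@continuous_sin R) (@sin_max R).
rewrite (le_trans _ (ler_norm _))//.
rewrite /gam -(RintZ_pos _ ic) -(RintZ_pos _ is_).
rewrite -(RintD_pos (integrableZ_pos _ ic) (integrableZ_pos _ is_)).
pose b t := euler_weight n.+1 t -
  4 * v ^+ 2 * (c^-1 * euler_weight n.+2 t - 2 * euler_weight n.+1 t + c * euler_weight n t).
have w0 := integrable_euler_weight n.
have w1 := integrable_euler_weight n.+1.
have w2 := integrable_euler_weight n.+2.
have i1 := integrableB_pos (integrableZ_pos c^-1 w2) (integrableZ_pos 2 w1).
have i2 := integrableD_pos i1 (integrableZ_pos c w0).
have i3 := integrableZ_pos (4 * v ^+ 2) i2.
have bi := integrableB_pos w1 i3.
have bE : \int[mu]_(t in Rpos) b t = eweight n.+1 -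
    4 * v ^+ 2 * (c^-1 * eweight n.+2 - 2 * eweight n.+1 + c * eweight n).
  rewrite /b (RintB_pos w1 i3) (RintZ_pos _ i2) (RintD_pos i1 (integrableZ_pos c w0)).
  rewrite (RintB_pos (integrableZ_pos c^-1 w2) (integrableZ_pos 2 w1)).
  by rewrite (RintZ_pos _ w2) (RintZ_pos _ w1) (RintZ_pos _ w0).
apply: (@le_trans _ _ (\int[mu]_(t in Rpos) b t)).
  rewrite bE.
  have e1 := eweightS n; have e2 := eweightS n.+1.
  have e0 := eweight_gt0 n; have e10 := eweight_gt0 n.+1.
  (* By the functional equation [t / c] has mean 1 and [c / t] has mean [(n + 3/2) / (n + 1/2)], so
     [t/c - 2 + c/t] has mean [1 / (n + 1/2)]. The hypothesis on [v] then costs at most half of the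
     mass. *)
  have -> : c^-1 * eweight n.+2 - 2 * eweight n.+1 + c * eweight n =
      eweight n.+1 * (n%:R + 2^-1)^-1.
    rewrite e2 -natr1 -/c mulKf ?gt_eqF// e1 /c.
    by field; lra.
  rewrite mulrCA -[leLHS]/(_ / _).
  have hq : 4 * v ^+ 2 * (n%:R + 2^-1)^-1 <= 2^-1.
    by rewrite ler_pdivrMr; lra.
  have -> : eweight n.+1 - eweight n.+1 * (4 * v ^+ 2 * (n%:R + 2^-1)^-1) =
    eweight n.+1 * (1 - 4 * v ^+ 2 * (n%:R + 2^-1)^-1) by ring.
  by rewrite ler_wpM2l ?(ltW e10)//; lra.
apply: le_Rintegral => //; first exact: measurable_Rpos.
  exact: integrableD_pos (integrableZ_pos _ ic) (integrableZ_pos _ is_).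
move=> t; rewrite /Rpos /= in_itv/= andbT => t0.
have -> : cos y * (euler_weight n.+1 t * cos (v * ln t)) +
    sin y * (euler_weight n.+1 t * sin (v * ln t)) =
    euler_weight n.+1 t * cos (v * ln (t / c)).
  by rewrite ln_div ?posrE// mulrBr cosB -/y; ring.
have -> : b t = euler_weight n.+1 t *
    (1 - v ^+ 2 * (4 * (t / c - 2 + (t / c)^-1))).
  rewrite /b [euler_weight n.+2 t]euler_weightS// [euler_weight n.+1 t]euler_weightS//.
  by field; rewrite !gt_eqF.
rewrite ler_wpM2l ?euler_weight_ge0//.
have h1 := cos_dist_sqr (v * ln (t / c)).
have h2 := ln_sqr_le (divr_gt0 t0 c0).
have h3 := ler_wpM2l (sqr_ge0 v) h2.
move: h1; rewrite exprMn ler_norml => /andP[h1 _]; lra.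
Qed.

(** [|Gamma(n + 1/2 + i v)|^2]. *)
Let gam2 n v := gam n cos v ^+ 2 + gam n sin v ^+ 2.

Lemma gam2S n v : gam2 n.+1 v = ((n%:R + 2^-1) ^+ 2 + v ^+ 2) * gam2 n v.
Proof. by rewrite /gam2 gam_cosS gam_sinS; ring. Qed.

(** The modulus is at least the projection onto the direction [y] provided by [gam_lower]. *)
Lemma gam2_ge n v : 8 * v ^+ 2 <= n%:R + 2^-1 ->
  eweight n.+1 ^+ 2 / 4 <= gam2 n.+1 v.
Proof.
move=> /gam_lower[y hy]; rewrite /gam2.
set a := gam _ _ _ in hy *; set b := gam _ _ _ in hy *.
have e0 := eweight_gt0 n.+1.
have : (eweight n.+1 / 2) ^+ 2 <= (cos y * a + sin y * b) ^+ 2.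
  rewrite -(real_normK (num_real (cos y * a + sin y * b))).
  by rewrite lerXn2r ?nnegrE// ltW// divr_gt0.
have := cos2Dsin2 y; have := sqr_ge0 (cos y * b - sin y * a).
move: (cos y) (sin y) (eweight n.+1) => C S G h1 h2 h3.
have -> : a ^+ 2 + b ^+ 2 = (C ^+ 2 + S ^+ 2) * (a ^+ 2 + b ^+ 2) by rewrite h2 mul1r.
by nra.
Qed.

(** Partial products of Euler's product for [sinh(pi M) / (pi M)]. *)
Let prodQ (M : R) j := \prod_(k < j) (1 + M ^+ 2 / k.+1%:R ^+ 2).

(** For [k <= M] the term 1 is at most [M^2 / k^2], so each factor is at most [2 M^2 / k^2]. *)
Let prodQ_small (M : nat) j : (j <= M)%N ->
  prodQ M%:R j <= 2 ^+ j * (M%:R ^+ j / j`!%:R) ^+ 2.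
Proof.
elim: j => [|j IH] jM.
  by rewrite /prodQ big_ord0 !expr0 fact0 divr1 expr1n mulr1.
rewrite /prodQ big_ord_recr /= -/(prodQ _ j).
have j0 : (0 : R) < j.+1%:R by [].
have f0 : (0 : R) < j`!%:R by rewrite ltr0n fact_gt0.
have -> : 2 ^+ j.+1 * (M%:R ^+ j.+1 / (j.+1)`!%:R) ^+ 2 =
    2 ^+ j * (M%:R ^+ j / j`!%:R) ^+ 2 * (2 * (M%:R ^+ 2 / j.+1%:R ^+ 2)) :> R.
  rewrite factS natrM !exprS; move: (M%:R) (2 ^+ j) (M%:R ^+ j) => a b c.
  by field; rewrite !gt_eqF.
apply: ler_pM; rewrite ?prodr_ge0//; first exact/IH/ltnW.
rewrite mulr2n mulrDl !mul1r lerD2r ler_pdivlMr ?exprn_gt0// mul1r.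
by rewrite lerXn2r ?nnegrE// ler_nat.
Qed.

(** Beyond [M] use [1 + x <= e^x]; the exponents telescope because
    [1 / (k+1)^2 <= 1/k - 1/(k+1)]. *)
Let prodQ_large (M : nat) j : (0 < M)%N ->
  prodQ M%:R (M + j) <= prodQ M%:R M * expR (M%:R - M%:R ^+ 2 / (M + j)%:R).
Proof.
move=> M0; have M0' : (0 : R) < M%:R by rewrite ltr0n.
elim: j => [|j IH].
  rewrite addn0 expr2 mulfK ?gt_eqF// subrr expR0 mulr1//.
rewrite addnS /prodQ big_ord_recr /= -!/(prodQ _ _).
set k := (M + j)%N in IH *; have k0 : (0 : R) < k%:R by rewrite ltr0n addn_gt0 M0.
apply: le_trans (ler_wpM2r _ IH) _; first by rewrite addr_ge0// divr_ge0 ?sqr_ge0.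
rewrite -mulrA ler_wpM2l//.
  by apply: prodr_ge0 => i _; rewrite addr_ge0// divr_ge0 ?sqr_ge0.
apply: le_trans (ler_wpM2l (expR_ge0 _) (expR_ge1Dx _)) _.
rewrite -expRD ler_expR -natr1.
have -> : M%:R - M%:R ^+ 2 / k%:R + M%:R ^+ 2 / (k%:R + 1) ^+ 2 =
  M%:R - M%:R ^+ 2 * (k%:R^-1 - ((k%:R + 1) ^+ 2)^-1) :> R by ring.
rewrite lerD2l lerN2 ler_wpM2l ?sqr_ge0//.
have -> : (k%:R^-1 - ((k%:R + 1) ^+ 2)^-1 : R) =
    (k%:R + 1)^-1 + (k%:R * (k%:R + 1) ^+ 2)^-1.
  by field; rewrite !gt_eqF ?addr_gt0.
by rewrite lerDl invr_ge0 mulr_ge0 ?sqr_ge0// ltW.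
Qed.

(** The exponent is [19/5 = 4/5 + 2 + 1]: [2^M <= e^(4 M / 5)] since [(6/5)^4 > 2], then
    [(M^j / j!)^2 <= e^(2 M)], and the factors beyond [M] contribute at most [e^M]. *)
Let prodQ_le (M : nat) j : (0 < M)%N -> prodQ M%:R j <= expR (19 / 5 * M%:R).
Proof.
move=> M0; have M0' : (0 : R) < M%:R by rewrite ltr0n.
have e2 : 2 <= expR (4 / 5) :> R.
  have -> : 4 / 5 = (1 / 5) * 4%:R :> R by lra.
  rewrite expRM_natr; have := @expR_ge1Dx R (1 / 5) => h.
  apply: (@le_trans _ _ ((6 / 5) ^+ 4)); first lra.
  by rewrite lerXn2r ?nnegrE ?expR_ge0//; lra.
have small i : (i <= M)%N -> prodQ M%:R i <= expR (14 / 5 * M%:R).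
  move=> iM; apply: le_trans (prodQ_small iM) _.
  have -> : 14 / 5 * M%:R = 4 / 5 * M%:R + M%:R * 2%:R :> R by lra.
  rewrite expRD; apply: ler_pM; rewrite ?exprn_ge0 ?divr_ge0 ?exprn_ge0//.
    rewrite expRM_natr; apply: (@le_trans _ _ (expR (4 / 5) ^+ i)).
      by rewrite lerXn2r ?nnegrE ?expR_ge0.
    by rewrite ler_weXn2l//; lra.
  rewrite expRM_natr lerXn2r ?nnegrE ?divr_ge0 ?exprn_ge0 ?expR_ge0//.
  rewrite ler_pdivrMr ?ltr0n ?fact_gt0// mulrC.
  exact: exprn_le_expR.
have [jM|Mj] := leqP j M.
  apply: le_trans (small j jM) _; rewrite ler_expR ler_wpM2r ?(ltW M0')//; lra.
rewrite -(subnKC (ltnW Mj)); apply: le_trans (prodQ_large _ M0) _.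
have -> : 19 / 5 * M%:R = 14 / 5 * M%:R + M%:R :> R by lra.
rewrite [leRHS]expRD; apply: ler_pM; rewrite ?expR_ge0 ?small//.
  by apply: prodr_ge0 => i _; rewrite addr_ge0// divr_ge0 ?sqr_ge0.
by rewrite ler_expR lerBlDr lerDl divr_ge0// sqr_ge0.
Qed.

(* The infinite product is [cosh (pi v)]; any exponent at most [2 pi] would do,
   but the library only provides [2 <= pi]. *)
Let prod_half_le (v : R) n :
  \prod_(k < n) (1 + v ^+ 2 / (k%:R + 2^-1) ^+ 2) <=
  400 * expR (19 / 5) * expR (4 * `|v|).
Proof.
(* Rounding [|v|] up to an integer costs the constant [e^(19/5)]. *)
pose M := (Num.truncn `|v|).+1.
have vM : `|v| <= M%:R by exact/ltW/truncnS_gt.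
have Mv : M%:R <= `|v| + 1.
  have /andP[h _] := truncn_itv (normr_ge0 v).
  by rewrite /M -natr1 lerD2r.
have v2 : v ^+ 2 <= M%:R ^+ 2.
  by rewrite -(real_normK (num_real v)) lerXn2r ?nnegrE.
(* The factor at [k = 0] is treated alone and uses the slack [4 - 19/5 = 1/5]; the constant 400
   makes [400 (|v| / 10)^2 = 4 v^2]. The other factors decrease when [k + 1/2] is replaced by
   [k]. *)
have h1 : 1 + 4 * v ^+ 2 <= 400 * expR (1 / 5 * `|v|).
  have -> : 1 / 5 * `|v| = `|v| / 10 * 2%:R by field.
  rewrite expRM_natr; have := @expR_ge1Dx R (`|v| / 10).
  have := normr_ge0 v; rewrite -(real_normK (num_real v)).
  move: (`|v|) (expR _) => a b a0 ab.
  have : (1 + a / 10) ^+ 2 <= b ^+ 2 by rewrite lerXn2r ?nnegrE; lra.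
  nra.
case: n => [|n].
  rewrite big_ord0; have := @expR_ge1Dx R (19 / 5).
  have := @expR_ge1Dx R (4 * `|v|); have := normr_ge0 v.
  move: (expR _) (expR _) => a b h2 h3 h4; nra.
rewrite big_ord_recl /= add0r -exprVn invrK.
have -> : 400 * expR (19 / 5) * expR (4 * `|v|) =
    400 * expR (1 / 5 * `|v|) * expR (19 / 5 * (`|v| + 1)).
  by rewrite -!mulrA -!expRD; congr (_ * expR _); field.
apply: ler_pM.
- by rewrite addr_ge0// mulr_ge0 ?sqr_ge0.
- by apply: prodr_ge0 => i _; rewrite addr_ge0// divr_ge0 ?sqr_ge0.
- by rewrite mulrC -natrX.
apply: (@le_trans _ _ (prodQ M%:R n)).
  apply: ler_prod => i _; rewrite addr_ge0 ?divr_ge0 ?sqr_ge0//=.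
  rewrite lerD2l ler_pM ?invr_ge0 ?sqr_ge0// lef_pV2 ?posrE ?exprn_gt0//.
  by rewrite lerXn2r ?nnegrE ?addr_ge0// lerDl.
apply: le_trans (prodQ_le _ _) _ => //.
by rewrite ler_expR ler_wpM2l.
Qed.

(** Divide [gam2_ge], at an index of order [v^2], by the product that the functional equation
    accumulates down to 0. Relative to the same product for [eweight] it is the product of
    [1 + v^2 / (k + 1/2)^2], bounded uniformly in the index. *)
Lemma gam2_lower : exists2 c, 0 < c &
  forall v, c * expR (- (4 * `|v|)) <= gam2 0 v.
Proof.
pose K : R := 400 * expR (19 / 5).
have K0 : 0 < K by rewrite mulr_gt0// expR_gt0.
exists (eweight 0 ^+ 2 / 4 / K); first by rewrite !divr_gt0 ?exprn_gt0 ?eweight_gt0.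
move=> v; pose n := (Num.truncn (8 * v ^+ 2)).+1.
have hv : 8 * v ^+ 2 <= n%:R + 2^-1.
  by rewrite (le_trans (ltW (truncnS_gt _)))// lerDl.
have := gam2_ge hv; set m := n.+1.
have e j : eweight j = eweight 0 * \prod_(k < j) (k%:R + 2^-1).
  elim: j => [|j IH]; first by rewrite big_ord0 mulr1.
  by rewrite eweightS IH big_ord_recr /=; ring.
have g j : gam2 j v = gam2 0 v * \prod_(k < j) ((k%:R + 2^-1) ^+ 2 + v ^+ 2).
  elim: j => [|j IH]; first by rewrite big_ord0 mulr1.
  by rewrite gam2S IH big_ord_recr /=; ring.
rewrite e g exprMn -prodrXl.
have k0 k : 0 < k%:R + 2^-1 :> R by rewrite ltr_wpDl.
have -> : \prod_(k < m) ((k%:R + 2^-1) ^+ 2 + v ^+ 2) =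
    \prod_(k < m) ((k%:R + 2^-1) ^+ 2) *
    \prod_(k < m) (1 + v ^+ 2 / (k%:R + 2^-1) ^+ 2) :> R.
  rewrite -big_split /=; apply: eq_bigr => k _; field.
  by rewrite gt_eqF.
have := prod_half_le v m; rewrite -/K.
set P := \prod_(k < m) ((k%:R + 2^-1) ^+ 2).
set Q := \prod_(k < m) (1 + _).
have P0 : 0 < P by apply: prodr_gt0 => k _; rewrite exprn_gt0.
have g0 : 0 <= gam2 0 v by rewrite addr_ge0 ?sqr_ge0.
rewrite expRN => QK h.
rewrite ler_pdivrMr ?expR_gt0// ler_pdivrMr//.
rewrite -(ler_pM2r P0) mulrAC (le_trans h)//.
rewrite [gam2 0 v * (P * Q)]mulrCA mulrC -!mulrA.
by rewrite ler_wpM2l// !mulrA ler_wpM2r ?(ltW P0)// -[leRHS]mulrA [leRHS]mulrC.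
Qed.

(** Extended by 0, so that [Gamma] on the critical line becomes a Fourier integral over the whole
    line with phase [ln t]. *)
Definition euler_density (t : R) : R := (euler_weight 0 \_ Rpos) t.

Lemma integrable_euler_density : mu.-integrable setT (EFin \o euler_density).
Proof.
have := (@integrable_mkcond _ _ R mu Rpos (EFin \o euler_weight 0) measurable_Rpos).1
  (integrable_euler_weight 0).
apply: eq_integrable => // t _; rewrite /euler_density /= !patchE.
by case: ifPn.
Qed.

Let cpow_sigmaE (v t : R) : Rpos t -> cpow t (sigma v - 1) * (expR (- t))%:C =
  (euler_weight 0 t)%:C * cexp ('i%C * (v * ln t)%:C).
Proof.
rewrite /Rpos /= in_itv/= andbT => t0.
have -> : euler_weight 0 t = expR ((2^-1 - 1) * ln t) * expR (- t).
  have e : 0%:R - 2^-1 = 2^-1 - 1 :> R by field.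
  by rewrite /euler_weight e /powR (gt_eqF t0).
have -> : cpow t (sigma v - 1) =
    (expR ((2^-1 - 1) * ln t))%:C * cexp ('i%C * (v * ln t)%:C).
  rewrite -cexpR -cexpD; congr cexp.
  by apply: complex_ext => /=; ring.
by rewrite [(_ * expR (- t))%:C]rmorphM mulrAC.
Qed.

Lemma Gamma_sigmaE (v : R) : Gamma (sigma v) =
  Cint mu (fun t => (euler_density t)%:C * cexp ('i%C * (v * ln t)%:C)).
Proof.
have E (p : R[i] -> R) : p 0 = 0 ->
    \int[mu]_(t in Rpos) p (cpow t (sigma v - 1) * (expR (- t))%:C) =
    \int[mu]_t p ((euler_density t)%:C * cexp ('i%C * (v * ln t)%:C)).
  move=> p0; rewrite Rintegral_mkcond; apply: eq_Rintegral => t _.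
  rewrite /euler_density !patchE; case: ifPn => [|_]; last by rewrite mul0r.
  by rewrite inE => /cpow_sigmaE ->.
by apply: complex_ext; [exact: (E (@Re R) erefl)|exact: (E (@Im R) erefl)].
Qed.

Lemma Gamma_sigma_gam (v : R) : Gamma (sigma v) = gam 0 cos v +i* gam 0 sin v.
Proof.
apply: complex_ext; apply: eq_Rintegral => t; rewrite inE => tpos.
  by apply: (etrans (congr1 (@Re R) (cpow_sigmaE v tpos))); rewrite cexpI /= mul0r subr0.
by apply: (etrans (congr1 (@Im R) (cpow_sigmaE v tpos))); rewrite cexpI /= mul0r addr0.
Qed.

Lemma cabs_Gamma_sigma_le : exists2 K, 0 < K & forall v : R, cabs (Gamma (sigma v)) <= K.
Proof.
exists (2 * eweight 0); first by rewrite mulr_gt0 ?eweight_gt0.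
move=> v; rewrite Gamma_sigma_gam (le_trans (cabs_le _))//= mulr2n mulrDl !mul1r.
have h (q : R -> R) : continuous q -> (forall y, `|q y| <= 1) ->
    `|gam 0 q v| <= eweight 0.
  move=> cq q1; have qi := integrable_euler_weightM 0 v cq q1.
  rewrite /gam (le_trans (le_normr_Rintegral _ qi))//; first exact: measurable_Rpos.
  apply: le_Rintegral; first exact: measurable_Rpos.
  - exact: (integrable_norm qi).
  - exact: integrable_euler_weight.
  by move=> t _; rewrite normrM ger0_norm ?euler_weight_ge0// ler_piMr ?euler_weight_ge0.
apply: lerD; apply: h.
- exact: continuous_cos.
- exact: cos_max.
- exact: continuous_sin.
- exact: sin_max.
Qed.

(** The true decay is [e^(- pi |v| / 2)]. The cruder exponent 2 is affordable because [k_le] asks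
    only for an exponent at most [pi]. *)
Lemma cabs_Gamma_sigma_ge : exists2 c, 0 < c &
  forall v : R, c * expR (- (2 * `|v|)) <= cabs (Gamma (sigma v)).
Proof.
have [c c0 hc] := gam2_lower; exists (Num.sqrt c); first by rewrite sqrtr_gt0.
move=> v; rewrite Gamma_sigma_gam cabsE /=.
apply: le_trans (ler_wsqrtr (hc v)).
rewrite sqrtrM ?(ltW c0)//.
have -> : - (4 * `|v|) = - (2 * `|v|) * 2%:R by ring.
by rewrite expRM_natr sqrtr_sqr (ger0_norm (expR_ge0 _)).
Qed.

End HalfLine.

(** * The Poisson kernel *)

Section WholeLine.
Context {R : realType}.
Local Notation mu := (@lebesgue_measure R).
Implicit Types x t : R.

Let measurable_oppR :
  measurable_fun setT (-%R : measurableTypeR R -> measurableTypeR R).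
Proof. exact: oppr_measurable. Qed.

Lemma integrable_opp (f : R -> R) : mu.-integrable setT (EFin \o f) ->
  mu.-integrable setT (EFin \o (fun t => f (- t))).
Proof.
move=> /integrableP[mf fi]; apply/integrableP; split.
  exact: (measurableT_comp mf measurable_oppR).
apply: le_lt_trans fi.
have := @ge0_integral_pushforward _ _ _ _ R _ measurable_oppR mu setT
  (abse \o (EFin \o f)) measurableT (measurableT_comp (@abse_measurable R setT) mf)
  (fun _ _ => abse_ge0 _).
rewrite preimage_setT => <-.
rewrite le_eqVlt; apply/orP; left; apply/eqP.
by apply: eq_measure_integral => //= A mA _; exact: lebesgue_measureN.
Qed.

Lemma Rintegral_opp (f : R -> R) : mu.-integrable setT (EFin \o f) ->
  \int[mu]_t f (- t) = \int[mu]_t f t.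
Proof.
move=> fi; rewrite /Rintegral; congr fine.
have mf := measurable_int _ fi.
have := @integral_pushforward _ _ _ _ R _ measurable_oppR mu setT
  (EFin \o f) mf (integrable_opp fi) measurableT.
rewrite preimage_setT => <-.
by apply: eq_measure_integral => //= A mA _; exact: lebesgue_measureN.
Qed.

Lemma ae_opp (P : R -> Prop) : {ae mu, forall t, P t} -> {ae mu, forall t, P (- t)}.
Proof.
move=> [N [mN N0 NP]]; exists (-%R @^-1` N); split.
- by rewrite -[X in measurable X]setTI; exact: measurable_oppR.
- by rewrite -N0 -(lebesgue_measureN mN).
- by move=> t /= Pt; apply: NP.
Qed.

Lemma integrable_even (f : R -> R) : (forall t, 0 <= f t) -> continuous f ->
  (forall t, f (- t) = f t) -> mu.-integrable Rpos (EFin \o f) ->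
  mu.-integrable setT (EFin \o f).
Proof.
move=> f0 cf fN /integrableP[_ fi]; apply/integrableP; split.
  by apply/measurable_EFinP; exact: continuous_measurable_fun.
have absE : (fun t => `|(EFin \o f) t|)%E = EFin \o f.
  by apply/funext => t /=; rewrite ger0_norm.
move: fi; rewrite absE => fi.
rewrite ge0_symfun_integralT//; last by move=> t; rewrite /= fN.
rewrite -set_itvcy -integral_itv_obnd_cbnd.
  by rewrite lte_mul_pinfty// ge0_fin_numE.
by apply/measurable_EFinP; apply: measurable_funTS; exact: continuous_measurable_fun.
Qed.

Lemma Rintegral_even (f : R -> R) : (forall t, 0 <= f t) -> continuous f ->
  (forall t, f (- t) = f t) -> mu.-integrable Rpos (EFin \o f) ->
  \int[mu]_t f t = 2 * \int[mu]_(t in Rpos) f t.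
Proof.
move=> f0 cf fN fi; rewrite /Rintegral.
rewrite ge0_symfun_integralT//; last by move=> t; rewrite /= fN.
rewrite -set_itvcy -integral_itv_obnd_cbnd; last first.
  by apply/measurable_EFinP; apply: measurable_funTS; exact: continuous_measurable_fun.
by rewrite fineM// -/(Rpos : set R) integrable_fin_num//; exact: measurable_Rpos.
Qed.

Let cont_expR_abs (e : R) : continuous (fun t => expR (- (e * `|t|))).
Proof.
move=> t; apply: (@continuous_comp _ _ _ (fun t => - (e * `|t|)) expR).
  apply: continuousN; apply: continuousM; first exact: cvg_cst.
  exact: norm_continuous.
exact: continuous_expR.
Qed.

Let expR_abs_pos (e : R) (f : R -> R) : mu.-integrable Rpos
    (EFin \o (fun t => expR (- (e * t)) * f t)) ->
  mu.-integrable Rpos (EFin \o (fun t => expR (- (e * `|t|)) * f t)).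
Proof.
apply: eq_integrable; first exact: measurable_Rpos.
move=> t; rewrite inE /Rpos /= in_itv/= andbT => t0.
by rewrite (gtr0_norm t0).
Qed.

Lemma integrable_expR_abs (e : R) : 0 < e ->
  mu.-integrable setT (EFin \o (fun t => expR (- (e * `|t|)))).
Proof.
move=> e0; apply: integrable_even.
- by move=> t; exact: expR_ge0.
- exact: cont_expR_abs.
- by move=> t; rewrite normrN.
have h := @expR_abs_pos e (fun=> 1).
have h1 : mu.-integrable Rpos (EFin \o (fun t => expR (- (e * t)) * 1)).
  apply: eq_integrable (integrable_expRN e0) => //; first exact: measurable_Rpos.
  by move=> t _ /=; rewrite mulr1.
apply: eq_integrable (h h1) => //; first exact: measurable_Rpos.
by move=> t _ /=; rewrite mulr1.
Qed.

Let cont_mul (f g : R -> R) : continuous f -> continuous g ->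
  continuous (fun t => f t * g t).
Proof. by move=> cf cg t; apply: continuousM; [exact: cf|exact: cg]. Qed.

Let cont_add (f g : R -> R) : continuous f -> continuous g ->
  continuous (fun t => f t + g t).
Proof. by move=> cf cg t; apply: continuousD; [exact: cf|exact: cg]. Qed.

Lemma poisson_cos (e x : R) : 0 < e ->
  \int[mu]_t (expR (- (e * `|t|)) * cos (x * t)) = 2 * (e / (e ^+ 2 + x ^+ 2)).
Proof.
move=> e0.
have ic y : mu.-integrable Rpos (EFin \o (fun t => expR (- (e * t)) * cos (y * t))).
  exact: integrable_expRN_cos.
have ccos y : continuous (fun t : R => cos (y * t)).
  move=> t; apply: (@continuous_comp _ _ _ (fun t => y * t) cos).
    exact: mulrl_continuous.
  exact: continuous_cos.
have icT y : mu.-integrable setT (EFin \o (fun t => expR (- (e * `|t|)) * cos (y * t))).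
  have := integrable_expR_abs e0; apply: le_integrable => //.
    apply/measurable_EFinP; apply: continuous_measurable_fun.
    by apply: cont_mul; [exact: cont_expR_abs|exact: ccos].
  by move=> t _ /=; rewrite lee_fin normrM ler_piMr// cos_max.
(* [1 + cos] is nonnegative, so that the integral can be halved. *)
pose F y t := expR (- (e * `|t|)) * cos (0 * t) + expR (- (e * `|t|)) * cos (y * t).
have FE y : \int[mu]_t F y t = 2 * (e / (e ^+ 2 + 0 ^+ 2) + e / (e ^+ 2 + y ^+ 2)).
  rewrite Rintegral_even.
  - congr (2 * _); rewrite -(poisson_pos 0 e0) -(poisson_pos y e0).
    rewrite -RintegralD//; [|exact: measurable_Rpos].
    apply: eq_Rintegral => t; rewrite inE /Rpos /= in_itv/= andbT => t0.
    by rewrite /F (gtr0_norm t0).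
  - move=> t; rewrite /F mul0r cos0 -mulrDr mulr_ge0 ?expR_ge0//.
  - by apply: cont_add; apply: cont_mul => //; exact: cont_expR_abs.
  - by move=> t; rewrite /F normrN !mulrN !cosN.
  - have := @integrableD _ _ R mu Rpos measurable_Rpos _ _
      (expR_abs_pos (ic 0)) (expR_abs_pos (ic y)).
    exact.
have FD y : \int[mu]_t F y t =
    \int[mu]_t (expR (- (e * `|t|)) * cos (0 * t)) +
    \int[mu]_t (expR (- (e * `|t|)) * cos (y * t)) by rewrite /F RintegralD.
by have := FD 0; have := FD x; rewrite !FE; lra.
Qed.

Lemma poisson_fourier (e x : R) : 0 < e ->
  Cint mu (fun t => (expR (- (e * `|t|)))%:C * cexp ('i%C * (x * t)%:C)) =
  (2 * (e / (e ^+ 2 + x ^+ 2)))%:C.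
Proof.
move=> e0; apply: complex_ext.
  rewrite -(poisson_cos x e0); apply: eq_Rintegral => t _.
  by rewrite cexpI /= mul0r subr0.
have iS : mu.-integrable setT (EFin \o (fun t => expR (- (e * `|t|)) * sin (x * t))).
  have := integrable_expR_abs e0; apply: le_integrable => //.
    apply/measurable_EFinP; apply: continuous_measurable_fun.
    apply: cont_mul => [|t]; first exact: cont_expR_abs.
    apply: (@continuous_comp _ _ _ (fun t => x * t) sin).
      exact: mulrl_continuous.
    exact: continuous_sin.
  by move=> t _ /=; rewrite lee_fin normrM ler_piMr// sin_max.
transitivity (\int[mu]_t (expR (- (e * `|t|)) * sin (x * t))).
  by apply: eq_Rintegral => t _; rewrite cexpI /= mul0r addr0.
have := Rintegral_opp iS.
rewrite [LHS](_ : _ = \int[mu]_t (-1 * (expR (- (e * `|t|)) * sin (x * t)))).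
  by rewrite RintegralZl//; move: (Rintegral _ _ _) => I /=; lra.
by apply: eq_Rintegral => t _; rewrite normrN !mulrN sinN mulrN mulN1r.
Qed.

Lemma integrable_oneDsqrV :
  mu.-integrable setT (EFin \o (fun t => (1 + t ^+ 2)^-1)).
Proof.
have c : continuous (fun t : R => (1 + t ^+ 2)^-1).
  exact: continuous_oneDsqrV.
apply: integrable_even => //.
- by move=> t; rewrite invr_ge0 addr_ge0 ?sqr_ge0.
- by move=> t; rewrite sqrrN.
apply: (FTC_pos_ge0 (F := atan) (l0 := atan 0) (l1 := pi / 2)).
- by move=> t _; exact: c.
- by apply: cvg_invS; exact: continuous_atan.
- by apply: cvg_natS; exact: cvgy_atan.
- by move=> t _; rewrite invr_ge0 addr_ge0 ?sqr_ge0.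
Qed.

Lemma FTC2_line (f F : R -> R) (a b : R) : a < b ->
  (forall x, is_derive x 1 F (f x)) -> continuous f ->
  \int[mu]_(x in `[a, b]) f x = F b - F a.
Proof.
move=> ab dF cf; rewrite /Rintegral (@continuous_FTC2 _ f F) -?EFinB//.
- exact: continuous_subspaceT.
- split.
  + by move=> x _; have [] := dF x.
  + by apply: cvg_at_right_filter; exact: is_derive_continuous (dF a).
  + by apply: cvg_at_left_filter; exact: is_derive_continuous (dF b).
- by move=> x _; rewrite derive1E; have [_ ->] := dF x.
Qed.

(** The primitive from minus infinity is constant, and by Lebesgue differentiation its derivative is
    [h] almost everywhere. *)
Lemma ae_eq0_itv (h : R -> R) : mu.-integrable setT (EFin \o h) ->
  (forall a b, a < b -> \int[mu]_(t in `[a, b]) h t = 0) ->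
  {ae mu, forall t, h t = 0}.
Proof.
move=> hi h0.
have hiS (D : set R) : measurable D -> mu.-integrable D (EFin \o h).
  by move=> mD; apply: integrableS hi.
pose F y := \int[mu]_(t in [set` `]-oo, y]]) h t.
have F_cst x y : x < y -> F y = F x.
  move=> xy; have := @Rintegral_itvB _ h -oo%O (BRight y) x
    (hiS _ (measurable_itv _)) isT.
  rewrite bnd_simp (ltW xy) => /(_ isT); rewrite Rintegral_itv_obnd_cbnd; last first.
    exact: hiS (measurable_itv _).
  by rewrite h0// => /eqP; rewrite subr_eq0 => /eqP.
have Fc : F = cst (F 0).
  apply/funext => y /=; have [y0|y0|->//] := ltgtP y 0; last exact: F_cst.
  by rewrite (F_cst y 0).
have loc : locally_integrable [set: R] h.
  exact: open_integrable_locally openT hi.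
have := @FTC1Ny R h (fun y => hiS _ (measurable_itv _)) loc.
apply: filterS; first exact: (ae_filter_ringOfSetsType mu).
move=> t [_]; rewrite -/F => <-.
by rewrite Fc derive1_cst.
Qed.

End WholeLine.

(** * Fourier transforms *)

Section Fourier.
Context d {T : measurableType d} {R : realType}.
Local Notation C := R[i].
Local Notation leb := (@lebesgue_measure R).

Lemma cmeas_expR_abs (e : R) :
  cmeas (fun tau : measurableTypeR R => (expR (- (e * `|tau|)))%:C).
Proof.
apply: cmeasR; apply: (measurableT_comp (@measurable_expR R)).
apply: measurable_funN; apply: measurable_funM; first exact: measurable_cst.
exact: normr_measurable.
Qed.

Variable m : {sigma_finite_measure set T -> \bar R}.
Variables (h : T -> C) (theta : T -> R).
Hypothesis hi : cintegrable m h.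
Hypothesis mtheta : measurable_fun setT theta.

(** The phase [theta] and the measure are left free in order to cover ordinary transforms, Mellin
    transforms and [Gamma] (phase [ln]), and integrals over pairs [(tau, u)] (phase [tau + u]). *)
Definition fourier (tau : R) : C :=
  Cint m (fun t => h t * cexp ('i%C * (tau * theta t)%:C)).

Let ci := integrable_cabs hi.

Let mh := cintegrable_cmeas hi.

Lemma cintegrable_fourier tau :
  cintegrable m (fun t => h t * cexp ('i%C * (tau * theta t)%:C)).
Proof.
apply: (cintegrable_le _ _ ci).
  by apply: cmeasM => //; exact: cmeas_cexpI.
by move=> t; rewrite cabsM cabs_cexpI mulr1.
Qed.

Lemma cabs_fourier_le tau : cabs (fourier tau) <= 2 * \int[m]_t cabs (h t).
Proof.
apply: cabs_Cint_le ci _; first exact: cintegrable_fourier.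
by move=> t; rewrite cabsM cabs_cexpI mulr1.
Qed.

Lemma cmeas_pair1 d1 d2 (T1 : measurableType d1) (T2 : measurableType d2)
  (f : T1 -> C) : cmeas f -> cmeas (fun z : T1 * T2 => f z.1).
Proof.
by move=> [fr fi]; split; [exact: (measurableT_comp fr measurable_fst)|
                           exact: (measurableT_comp fi measurable_fst)].
Qed.

Lemma cmeas_pair2 d1 d2 (T1 : measurableType d1) (T2 : measurableType d2)
  (f : T2 -> C) : cmeas f -> cmeas (fun z : T1 * T2 => f z.2).
Proof.
by move=> [fr fi]; split; [exact: (measurableT_comp fr measurable_snd)|
                           exact: (measurableT_comp fi measurable_snd)].
Qed.

Lemma cmeas_Cint d1 d2 (T1 : measurableType d1) (T2 : measurableType d2)
  (m1 : {sigma_finite_measure set T1 -> \bar R})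
  (m2 : {sigma_finite_measure set T2 -> \bar R}) (f : T1 * T2 -> C) :
  cintegrable (prodm m1 m2) f -> cmeas (fun x => Cint m2 (fun y => f (x, y))).
Proof.
move=> [fr fi]; split.
- have Fi := measurable_fubini_F (fr : (m1 \x m2)%E.-integrable setT _).
  exact: (measurableT_comp (fine_measurable measurableT) Fi).
- have Fi := measurable_fubini_F (fi : (m1 \x m2)%E.-integrable setT _).
  exact: (measurableT_comp (fine_measurable measurableT) Fi).
Qed.

Let cmeas_kernel (q : R) : cmeas (fun z : measurableTypeR R * T =>
  cexp ('i%C * (z.1 * (theta z.2 - q))%:C)).
Proof.
apply: cmeas_cexp; apply: cmeasM; first exact: cmeas_cst.
apply: cmeasR; apply: measurable_funM; first exact: measurable_fst.
apply: measurable_funB; last exact: measurable_cst.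
exact: (measurableT_comp mtheta measurable_snd).
Qed.

Let cintegrable_E (e q : R) : 0 < e -> cintegrable (prodm leb m)
  (fun z : measurableTypeR R * T => (expR (- (e * `|z.1|)))%:C * (h z.2 * cexp ('i%C * (z.1 * (theta z.2 - q))%:C))).
Proof.
move=> e0; have := integrable_prodM (integrable_expR_abs e0) ci.
apply: cintegrable_le.
  apply: cmeasM; first exact: (cmeas_pair1 _ (cmeas_expR_abs e)).
  by apply: cmeasM; [exact: (cmeas_pair2 _ mh)|exact: cmeas_kernel].
move=> [tau t] /=; rewrite !cabsM cabs_cexpI mulr1 cabsR ger0_norm//.
Qed.

(** Measurability in [tau] is drawn from Fubini, which asks for integrability on the product: the
    factor [e^(-|tau|)] is inserted for that purpose and divided out afterwards. *)
Lemma cmeas_fourier : cmeas (fourier : measurableTypeR R -> C).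
Proof.
have h1 := cmeas_Cint (cintegrable_E 0 ltr01).
have e1 : cmeas (fun tau : measurableTypeR R => (expR `|tau|)%:C).
  by apply: cmeasR; apply: (measurableT_comp (@measurable_expR R)); exact: normr_measurable.
have := cmeasM e1 h1.
rewrite (_ : (fun tau => _) = fourier)//; apply/funext => tau /=.
rewrite CintM; last first.
  by under eq_fun do rewrite subr0; exact: cintegrable_fourier.
rewrite mulrA -rmorphM mul1r /= -expRD subrr expR0 mul1r.
by apply: eq_Cint => t; rewrite subr0.
Qed.

(* Fubini: the Poisson kernel is the Fourier transform of [exp (- e |tau|)]. *)
Lemma fourier_poisson (e q : R) : 0 < e ->
  Cint leb (fun tau => (expR (- (e * `|tau|)))%:C * cexp ('i%C * (tau * - q)%:C) * fourier tau) =
  Cint m (fun t => (2 * (e / (e ^+ 2 + (theta t - q) ^+ 2)))%:C * h t).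
Proof.
move=> e0; have F := cintegrable_E q e0.
transitivity (Cint leb (fun tau => Cint m (fun t =>
    (expR (- (e * `|tau|)))%:C * (h t * cexp ('i%C * (tau * (theta t - q))%:C))))).
  apply: eq_Cint => tau; rewrite -CintM; last exact: cintegrable_fourier.
  apply: eq_Cint => t; rewrite -!mulrA; congr (_ * _).
  rewrite mulrCA; congr (_ * _).
  by rewrite -cexpD -mulrDr -rmorphD /= -mulrDr [- q + _]addrC.
rewrite (Cint_fubini1 F) -(Cint_fubini2 F); apply: eq_Cint => t /=.
rewrite -(poisson_fourier (theta t - q) e0) mulrC -CintM.
  apply: eq_Cint => tau; rewrite mulrCA; congr (_ * (_ * cexp (_ * _%:C))).
  by rewrite mulrC.
apply: (cintegrable_le _ _ (integrable_expR_abs e0)).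
  apply: cmeasM; first exact: cmeas_expR_abs.
  apply: cmeas_cexp; apply: cmeasM; first exact: cmeas_cst.
  by apply: cmeasR; exact: measurable_funM.
by move=> tau; rewrite cabsM cabs_cexpI mulr1 cabsR ger0_norm ?expR_ge0.
Qed.

End Fourier.

(** * Parseval's formula against intervals *)

Section IntervalFourier.
Context {R : realType}.
Local Notation C := R[i].
Local Notation leb := (@lebesgue_measure R).
Variables a b : R.
Hypothesis ab : a < b.

Let I : R -> R := \1_(`[a, b]%classic).

Let J q : C := (I q)%:C.

Definition itv_fourier : R -> C := fourier leb J -%R.

(** [2 pi] times the Poisson integral of the indicator of [[a, b]], that is, a smoothing of this
    indicator at scale [e]. *)
Let S (e p : R) := 2 * (atan ((b - p) / e) - atan ((a - p) / e)).

Let I_ge0 q : 0 <= I q.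
Proof. by rewrite /I indicE. Qed.

Let measurable_I : measurable_fun setT (I : measurableTypeR R -> R).
Proof. by apply: measurable_indic; exact: measurable_itv. Qed.

Let integrable_I : leb.-integrable setT (EFin \o I).
Proof. exact: integrable_indic_itv. Qed.

Let Rintegral_I (f : R -> R) : \int[leb]_q (I q * f q) = \int[leb]_(q in `[a, b]) f q.
Proof.
rewrite [RHS]Rintegral_mkcond; apply: eq_Rintegral => q _.
by rewrite /I indicE patchE; case: ifP => _; rewrite ?mul1r ?mul0r.
Qed.

Let integral_cauchy (e p : R) : 0 < e ->
  \int[leb]_q (I q * (2 * (e / (e ^+ 2 + (p - q) ^+ 2)))) = S e p.
Proof.
move=> e0; rewrite Rintegral_I.
have ne0 : e != 0 by rewrite gt_eqF.
have den q : 0 < e ^+ 2 + (p - q) ^+ 2 by rewrite ltr_wpDr ?sqr_ge0 ?exprn_gt0.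
have cpq : continuous (fun q : R => p - q).
  by move=> q; apply: (@continuousB _ R R _ _ q (cvg_cst p) cvg_id).
have cden : continuous (fun q : R => e ^+ 2 + (p - q) ^+ 2).
  move=> q; apply: (@continuousD _ R R (cst (e ^+ 2)) _ q); first exact: cvg_cst.
  exact: (continuous_comp (cpq q) (@exprn_continuous R 2 _)).
have cont : continuous (fun q : R => 2 * (e / (e ^+ 2 + (p - q) ^+ 2))).
  move=> q; apply: (@continuousM _ R (cst 2) _ q); first exact: cvg_cst.
  apply: (@continuousM _ R (cst e) _ q); first exact: cvg_cst.
  by apply: cvgV; [rewrite gt_eqF|exact: cden].
rewrite (@FTC2_line _ _ (fun q => 2 * atan ((q - p) / e)) a b ab _ cont) ?/S; first by ring.
move=> q.
have d1 : is_derive q 1 (fun q : R => (q - p) / e) e^-1.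
  have := @is_deriveZ R R R (id - cst p) e^-1 q 1 _
    (is_deriveB (is_derive_id q 1) (is_derive_cst p q 1)).
  rewrite subr0 /GRing.scale /= mulr1.
  by rewrite (_ : _ \*: _ = fun q => (q - p) / e)//; apply/funext => u /=; rewrite mulrC.
have d2 := is_deriveZ 2 (@is_derive1_comp _ atan _ q _ _ (is_derive1_atan _) d1).
apply: (is_derive_eq d2); rewrite /GRing.scale /=.
have := den q; rewrite -opprB sqrrN => dq.
field; rewrite ne0 /= !gt_eqF//.
Qed.

Let Ji : cintegrable leb J.
Proof.
split; last by apply: eq_integrable (integrable0 leb [set: measurableTypeR R]).
exact: integrable_I.
Qed.

Let mopp : measurable_fun setT (-%R : measurableTypeR R -> measurableTypeR R).
Proof. exact: oppr_measurable. Qed.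

Lemma cmeas_itv_fourier : cmeas (itv_fourier : measurableTypeR R -> C).
Proof. exact: (cmeas_fourier Ji mopp). Qed.

Lemma itv_fourierE tau : itv_fourier tau =
  (\int[leb]_(q in `[a, b]) cos (tau * q)) +i* (\int[leb]_(q in `[a, b]) - sin (tau * q)).
Proof.
apply: complex_ext; rewrite [RHS]/= -Rintegral_I; apply: eq_Rintegral => q _; rewrite cexpI /J /=.
- by rewrite mul0r subr0 mulrN cosN.
- by rewrite mul0r addr0 mulrN sinN.
Qed.

Lemma cabs_itv_fourier_mulr tau : `|tau| * cabs (itv_fourier tau) <= 4.
Proof.
have [->|tau0] := eqVneq tau 0; first by rewrite normr0 mul0r.
rewrite itv_fourierE.
have dx (q : R) : is_derive q 1 (fun q => tau * q) tau.
  have := @is_deriveZ _ _ _ id tau q 1 1 (is_derive_id _ _).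
  by rewrite /GRing.scale /= mulr1.
have ds (q : R) := @is_derive1_comp _ sin (fun t => tau * t) q _ _ (is_derive_sin _) (dx q).
have dc (q : R) := @is_derive1_comp _ cos (fun t => tau * t) q _ _ (is_derive_cos _) (dx q).
have cc : continuous (fun q : R => cos (tau * q)) by move=> q; exact: is_derive_continuous (dc q).
have cs : continuous (fun q : R => - sin (tau * q)).
  by move=> q; exact: is_derive_continuous (is_deriveN (ds q)).
have scaleV (x : R) : tau^-1 *: (tau *: x) = x.
  by rewrite /GRing.scale /= mulKf.
rewrite (@FTC2_line _ _ (fun q => tau^-1 * sin (tau * q)) a b ab _ cc); last first.
  move=> q; apply: (is_derive_eq (is_deriveZ tau^-1 (ds q))).
  by rewrite [_ * tau]mulrC scaleV.
rewrite (@FTC2_line _ _ (fun q => tau^-1 * cos (tau * q)) a b ab _ cs); last first.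
  move=> q; apply: (is_derive_eq (is_deriveZ tau^-1 (dc q))).
  by rewrite [_ * tau]mulrC scaleV.
have c2 (p : R -> R) : (forall x, `|p x| <= 1) ->
    `|tau| * `|tau^-1 * p (tau * b) - tau^-1 * p (tau * a)| <= 2.
  move=> p1; rewrite -normrM -mulrBr mulVKf//.
  by rewrite (le_trans (ler_normB _ _))// (lerD (p1 _) (p1 _)).
have := lerD (c2 _ (@sin_max R)) (c2 _ (@cos_max R)); rewrite -mulrDr => h.
have -> : 4 = 2 + 2 :> R by rewrite -natrD.
by rewrite (le_trans _ h)// ler_wpM2l// cabs_le.
Qed.

(** The trivial bound near 0 and the decay [4 / |tau|] at infinity add up to a square-integrable
    bound, as Cauchy-Schwarz will require. *)
Lemma cabs_itv_fourier_sqr : exists2 K : R, 0 < K & forall tau,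
  cabs (itv_fourier tau) ^+ 2 <= K * (1 + tau ^+ 2)^-1.
Proof.
set M := 2 * \int[leb]_t cabs (J t).
have h1 tau : cabs (itv_fourier tau) <= M by exact: cabs_fourier_le Ji mopp tau.
have M0 : 0 <= M by rewrite (le_trans _ (h1 0))// cabs_ge0.
exists (M ^+ 2 + 4 ^+ 2); first by rewrite ltr_wpDl ?sqr_ge0.
move=> tau; rewrite ler_pdivlMr ?ltr_pwDl ?sqr_ge0// mulrDr mulr1 lerD//.
  by rewrite ler_sqr ?nnegrE ?cabs_ge0.
rewrite -[tau ^+ 2]real_normK ?num_real// -exprMn mulrC.
by rewrite ler_sqr ?nnegrE ?mulr_ge0 ?cabs_ge0 ?cabs_itv_fourier_mulr.
Qed.

Section Transform.
Context d {T : measurableType d}.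
Variable m : {sigma_finite_measure set T -> \bar R}.
Variables (h : T -> C) (theta : T -> R).
Hypothesis hi : cintegrable m h.
Hypothesis mtheta : measurable_fun setT theta.

Let F := fourier m h theta.

Let M := 2 * \int[m]_t cabs (h t).

Let cabs_F tau : cabs (F tau) <= M.
Proof. exact: cabs_fourier_le. Qed.

Let mF : cmeas (F : measurableTypeR R -> C).
Proof. exact: cmeas_fourier. Qed.

Let mh := cintegrable_cmeas hi.

Let cauchy (e q t : R) : C := (2 * (e / (e ^+ 2 + (t - q) ^+ 2)))%:C.

Let cauchy_le (e q t : R) : 0 < e -> cabs (cauchy e q t) <= 2 / e.
Proof.
move=> e0; rewrite /cauchy cabsR.
have den : 0 < e ^+ 2 + (t - q) ^+ 2 by rewrite ltr_wpDr ?sqr_ge0 ?exprn_gt0.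
rewrite ger0_norm; last by rewrite mulr_ge0// divr_ge0// ltW.
by rewrite ler_wpM2l// ler_pdivrMr// mulrC ler_pdivlMr// -expr2 ler_wpDr ?sqr_ge0//.
Qed.

Let cmeas_cauchy (e : R) : 0 < e -> cmeas (fun z : T * measurableTypeR R =>
  cauchy e z.2 (theta z.1)).
Proof.
move=> e0; apply: cmeasR; apply: measurable_funM; first exact: measurable_cst.
apply: measurable_funM; first exact: measurable_cst.
have cden : continuous (fun x : R => e ^+ 2 + x ^+ 2).
  move=> x; apply: (@continuousD _ R R (cst (e ^+ 2)) (fun x => x ^+ 2) x); first exact: cvg_cst.
  exact: (@exprn_continuous R 2).
have cdenV : continuous (fun x : R => (e ^+ 2 + x ^+ 2)^-1).
  move=> x; apply: cvgV; last exact: cden.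
  by rewrite gt_eqF// ltr_wpDr ?sqr_ge0 ?exprn_gt0.
apply: (measurableT_comp (continuous_measurable_fun cdenV)).
apply: measurable_funB; last exact: measurable_snd.
exact: (measurableT_comp mtheta measurable_fst).
Qed.

(** Regularized Parseval formula: [fourier_poisson] integrated over [q] in [[a, b]]. The damping
    [e^(- e |tau|)] justifies the exchange of integrals in [P] although [F] is merely bounded; [Q]
    is the exchange on the other side. *)
Let fourier_itv_fourier (e : R) : 0 < e ->
  Cint leb (fun tau => (expR (- (e * `|tau|)))%:C * (itv_fourier tau * F tau)) =
  Cint m (fun t => (S e (theta t))%:C * h t).
Proof.
move=> e0.
pose P (z : measurableTypeR R * measurableTypeR R) : C :=
  J z.2 * ((expR (- (e * `|z.1|)))%:C * cexp ('i%C * (z.1 * - z.2)%:C) * F z.1).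
have iP : cintegrable (prodm leb leb) P.
  have := integrable_prodM (integrableZr measurableT M (integrable_expR_abs e0))
    integrable_I.
  apply: cintegrable_le.
    apply: cmeasM; first exact: (cmeas_pair2 _ (cintegrable_cmeas Ji)).
    apply: cmeasM; last exact: (cmeas_pair1 _ mF).
    apply: cmeasM; first exact: (cmeas_pair1 _ (cmeas_expR_abs e)).
    apply: cmeas_cexp; apply: cmeasM; first exact: cmeas_cst.
    apply: cmeasR; apply: measurable_funM; first exact: measurable_fst.
    exact: (measurableT_comp mopp measurable_snd).
  move=> [tau q]; rewrite /P; cbn [fst snd]; rewrite !cabsM cabs_cexpI mulr1 /J !cabsR (ger0_norm (I_ge0 q)) (ger0_norm (expR_ge0 _)).
  by rewrite mulrC ler_wpM2r// ler_wpM2l// expR_ge0.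
transitivity (Cint leb (fun tau => Cint leb (fun q => P (tau, q)))).
  apply: eq_Cint => tau; rewrite mulrCA mulrC -CintM; last exact: cintegrable_fourier.
  by apply: eq_Cint => q; rewrite /P; cbn [fst snd]; ring.
rewrite (Cint_fubini1 iP) -(Cint_fubini2 iP).
pose Q (z : T * measurableTypeR R) : C := J z.2 * (cauchy e z.2 (theta z.1) * h z.1).
have iQ : cintegrable (prodm m leb) Q.
  have := integrable_prodM (integrableZr measurableT (2 / e) (integrable_cabs hi))
    integrable_I.
  apply: cintegrable_le.
    apply: cmeasM; first exact: (cmeas_pair2 _ (cintegrable_cmeas Ji)).
    apply: cmeasM; [exact: cmeas_cauchy|exact: (cmeas_pair1 _ mh)].
  move=> [t q]; rewrite /Q; cbn [fst snd]; rewrite !cabsM /J cabsR ger0_norm//.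
  by rewrite mulrC ler_wpM2r// mulrC ler_wpM2l ?cabs_ge0 ?cauchy_le.
transitivity (Cint leb (fun q => Cint m (fun t => Q (t, q)))).
  apply: eq_Cint => q; rewrite /P; cbn [fst snd]; rewrite CintM.
    rewrite (fourier_poisson hi mtheta q e0) -CintM//.
    apply: (cintegrable_le _ _ (integrableZr measurableT (2 / e) (integrable_cabs hi))).
      apply: cmeasM => //.
      have [h1 h2] := cmeas_cauchy e0.
      by split; [exact: (measurable_fun_pair1 q h1)|exact: (measurable_fun_pair1 q h2)].
    by move=> t; rewrite cabsM mulrC ler_wpM2l ?cabs_ge0 ?cauchy_le.
  apply: (cintegrable_le _ _ (integrableZr measurableT M (integrable_expR_abs e0))).
    apply: cmeasM => //; apply: cmeasM; first exact: cmeas_expR_abs.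
    apply: cmeas_cexp; apply: cmeasM; first exact: cmeas_cst.
    by apply: cmeasR; apply: measurable_funM => //; exact: measurable_cst.
  move=> tau; rewrite !cabsM cabs_cexpI mulr1 cabsR (ger0_norm (expR_ge0 _)).
  by rewrite ler_wpM2l ?expR_ge0.
rewrite (Cint_fubini2 iQ) -(Cint_fubini1 iQ); apply: eq_Cint => t.
rewrite /Q; cbn [fst snd]; rewrite -(integral_cauchy (theta t) e0) mulrC.
transitivity (Cint leb (fun q => h t * (I q * (2 * (e / (e ^+ 2 + (theta t - q) ^+ 2))))%:C)).
  by apply: eq_Cint => q; rewrite /J /cauchy !rmorphM; ring.
have iI : leb.-integrable setT (EFin \o
    (fun q : R => I q * (2 * (e / (e ^+ 2 + (theta t - q) ^+ 2))))).
  apply: (le_integrable_real _ _ (integrableZr measurableT (2 / e) integrable_I)).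
    apply: measurable_funM => //.
    have [h1 _] := cmeas_cauchy e0; exact: (measurable_fun_pair2 t h1).
  move=> q; rewrite normrM ger0_norm// ler_wpM2l//.
  by have := cauchy_le q (theta t) e0; rewrite cabsR.
rewrite CintM; last first.
  by split => //; apply: eq_integrable (integrable0 leb [set: measurableTypeR R]).
congr (_ * _); apply: complex_ext => //=.
by rewrite /Rintegral integral0_eq.
Qed.

(** [Num.sg] makes the limit uniform in form: [2 pi] inside the interval, 0 outside, and [pi] at the
    endpoints. *)
Let cvg_S p : S n.+1%:R^-1 p @[n --> \oo] -->
  2 * (Num.sg (b - p) * (pi / 2) - Num.sg (a - p) * (pi / 2)).
Proof.
have cvg_atan (x : R) : atan (x / n.+1%:R^-1) @[n --> \oo] --> Num.sg x * (pi / 2).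
  have pos (y : R) : 0 < y -> atan (y / n.+1%:R^-1) @[n --> \oo] --> pi / 2.
    move=> y0; rewrite (_ : (fun n => _) = fun n => (fun t => atan (y * t)) n.+1%:R).
      apply: (@cvg_natS _ (fun t => atan (y * t))).
      apply: (cvg_comp (fun t => y * t) (@atan R) _ (@cvgy_atan R)).
      exact: gt0_cvgMry.
    by apply/funext => n; rewrite invrK.
  have [x0|x0|->] := ltgtP x 0.
  - rewrite ltr0_sg// mulN1r.
    rewrite (_ : (fun n => _) = fun n => - atan ((- x) / n.+1%:R^-1)).
      by apply: cvgN; apply: pos; rewrite oppr_gt0.
    by apply/funext => n; rewrite mulNr atanN opprK.
  - by rewrite gtr0_sg// mul1r; exact: pos.
  - rewrite sgr0 mul0r (_ : (fun n => _) = cst 0); first exact: cvg_cst.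
    by apply/funext => n; rewrite mul0r atan0.
by apply: cvgMr; apply: cvgB; exact: cvg_atan.
Qed.

Let S_le (e p : R) : `|S e p| <= 2 * pi.
Proof.
rewrite /S normrM ger0_norm// ler_wpM2l//.
have hx (x : R) : `|atan x| <= pi / 2.
  by rewrite ler_norml !ltW ?atan_gtNpi2 ?atan_ltpi2.
by rewrite (le_trans (ler_normB _ _))// (le_trans (lerD (hx _) (hx _)))// -splitr.
Qed.

(* Parseval's formula against an interval, in the form of an a priori bound:
   it does not require [F] to be integrable. *)
Lemma cabs_Cint_sg_le :
  leb.-integrable setT (EFin \o (fun tau => cabs (itv_fourier tau) * cabs (F tau))) ->
  cabs (Cint m (fun t => (2 * (Num.sg (b - theta t) * (pi / 2) -
    Num.sg (a - theta t) * (pi / 2)))%:C * h t)) <=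
  4 * \int[leb]_tau (cabs (itv_fourier tau) * cabs (F tau)).
Proof.
move=> iN; set N := \int[leb]_tau _.
(* One factor 2 comes from the limit in [cvg_Cint_le], the other from [cabs_Cint_le]. *)
have -> : 4 * N = 2 * (2 * N) by ring.
have mS (e : R) : measurable_fun setT (fun t => S e (theta t)).
  apply: measurable_funM; first exact: measurable_cst.
  have matan (x : R) : measurable_fun setT (fun t => atan ((x - theta t) / e)).
    have ca : continuous (@atan R) by move=> y; exact: continuous_atan.
    apply: (measurableT_comp (continuous_measurable_fun ca)).
    apply: measurable_funM; last exact: measurable_cst.
    by apply: measurable_funB => //; exact: measurable_cst.
  by apply: measurable_funB.
apply: (@cvg_Cint_le _ _ _ m (fun n t => (S n.+1%:R^-1 (theta t))%:C * h t) _
  (fun t => 2 * pi * cabs (h t))).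
- by move=> n; apply: cmeasM => //; exact: cmeasR.
- apply: cmeasM => //; apply: cmeasR.
  apply: (@measurable_fun_cvg _ _ _ _ (fun n t => S n.+1%:R^-1 (theta t))) => //.
- move=> t.
  rewrite (_ : (fun n => _) = fun n => `|S n.+1%:R^-1 (theta t) - 2 * (Num.sg (b - theta t) *
    (pi / 2) - Num.sg (a - theta t) * (pi / 2))| * cabs (h t)); last first.
    by apply/funext => n; rewrite -mulrBl -rmorphB /= cabsM cabsR.
  rewrite -[X in _ --> X](mul0r (cabs (h t))); apply: cvgMl.
  apply/cvgrPdistC_le => e e0; have /cvgrPdistC_le /(_ e e0) := @cvg_S (theta t).
  by apply: filterS => n; rewrite subr0 normr_id.
- exact: integrableZl (integrable_cabs hi).
- by move=> n t; rewrite cabsM cabsR ler_wpM2r ?cabs_ge0 ?S_le.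
- move=> n; have n0 : 0 < n.+1%:R^-1 :> R by rewrite invr_gt0 ltr0n.
  rewrite -fourier_itv_fourier//.
  have le1 tau : cabs ((expR (- (n.+1%:R^-1 * `|tau|)))%:C * (itv_fourier tau * F tau)) <=
      cabs (itv_fourier tau) * cabs (F tau).
    rewrite !cabsM cabsR ger0_norm ?expR_ge0//.
    rewrite ler_piMl ?mulr_ge0 ?cabs_ge0//.
  apply: (cabs_Cint_le _ iN le1).
  have mEF : cmeas ((fun tau => (expR (- (n.+1%:R^-1 * `|tau|)))%:C *
      (itv_fourier tau * F tau)) : measurableTypeR R -> C).
    apply: cmeasM; first exact: cmeas_expR_abs.
    by apply: cmeasM => //; exact: cmeas_itv_fourier.
  exact: (cintegrable_le mEF le1 iN).
Qed.

End Transform.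

End IntervalFourier.

(** * Square-integrable functions on the line *)

Section L2.
Context {R : realType}.
Local Notation C := R[i].
Local Notation leb := (@lebesgue_measure R).
Implicit Types (p q r : R -> R).

Let abs_sqrE p : (fun t : measurableTypeR R => `|(EFin \o (fun t => p t ^+ 2)%R) t|)%E =
  (fun t => `|(EFin \o p) t| `^ 2)%E.
Proof.
apply/funext => t; change (`|p t ^+ 2|%:E = (`|p t| `^ 2)%:E).
by rewrite powR_mulrn// ger0_norm ?sqr_ge0// real_normK ?num_real.
Qed.

Lemma integrable_sqr p : measurable_fun setT (p : measurableTypeR R -> R) ->
  ('N[leb]_2%:E[EFin \o p] < +oo)%E ->
  leb.-integrable setT (EFin \o (fun t => p t ^+ 2)).
Proof.
move=> mp fin; apply/integrableP; split.
  by apply/measurable_EFinP; exact: measurable_funX.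
by rewrite abs_sqrE -(@powR_Lnorm _ _ _ leb (EFin \o p) 2)// poweR_lty.
Qed.

Lemma Lnorm2_lty p : leb.-integrable setT (EFin \o (fun t => p t ^+ 2)) ->
  ('N[leb]_2%:E[EFin \o p] < +oo)%E.
Proof.
by move=> /integrableP[_]; rewrite abs_sqrE unlock => fin; exact: poweR_lty.
Qed.

Lemma cauchy_schwarz_le p q (e : R) : (forall t, 0 <= p t) -> (forall t, 0 <= q t) ->
  measurable_fun setT (p : measurableTypeR R -> R) ->
  measurable_fun setT (q : measurableTypeR R -> R) ->
  leb.-integrable setT (EFin \o (fun t => p t ^+ 2)) ->
  ('N[leb]_2%:E[EFin \o q] < e%:E)%E ->
  leb.-integrable setT (EFin \o (fun t => p t * q t)) /\
  \int[leb]_t (p t * q t) <= fine ('N[leb]_2%:E[EFin \o p])%E * e.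
Proof.
move=> p0 q0 mp mq ip iq; have pfin := Lnorm2_lty ip.
have half2 : 2^-1 + 2^-1 = 1 :> R by rewrite [RHS]splitr mul1r.
have := @hoelder _ _ _ leb p q 2 2 mp mq (ltr0n _ 2) (ltr0n _ 2) half2.
rewrite Lnorm1 => H.
have ppos := Lnorm_ge0 leb 2%:E (EFin \o p).
have pE : ('N[leb]_2%:E[EFin \o p] = (fine 'N[leb]_2%:E[EFin \o p])%:E)%E.
  by rewrite fineK// ge0_fin_numE.
have H1 : (\int[leb]_t `|(EFin \o (p \* q)%R) t| <=
    (fine 'N[leb]_2%:E[EFin \o p] * e)%:E)%E.
  rewrite (le_trans H)// EFinM -pE; apply: lee_wpmul2l => //; exact: ltW.
have ipq : leb.-integrable setT (EFin \o (fun t => p t * q t)).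
  apply/integrableP; split; last exact: le_lt_trans H1 (ltry _).
  by apply/measurable_EFinP; exact: measurable_funM.
split => //; rewrite -lee_fin /Rintegral fineK; last by rewrite integrable_fin_num.
rewrite (le_trans _ H1)//.
rewrite le_eqVlt; apply/orP; left; apply/eqP; apply: eq_integral => t _.
by rewrite /= ger0_norm// mulr_ge0.
Qed.

End L2.

(** * Uniqueness for the Fourier and Mellin transforms *)

Section Uniqueness.
Context {R : realType}.
Local Notation C := R[i].
Local Notation leb := (@lebesgue_measure R).
Implicit Types (a b t : R) (h : R -> C).

Lemma ae_neq a : {ae leb, forall t, t != a}.
Proof.
exists [set a]; split => //; first exact: lebesgue_measure_set1.
by move=> t /= /negP; rewrite negbK => /eqP.
Qed.

(** Off the two endpoints the weight with signs is [2 pi] times the indicator of [[a, b]]. *)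
Lemma Rintegral_sg (r : R -> R) a b : leb.-integrable setT (EFin \o r) -> a < b ->
  \int[leb]_t (2 * (Num.sg (b - t) * (pi / 2) - Num.sg (a - t) * (pi / 2)) * r t) =
  2 * pi * \int[leb]_(t in `[a, b]) r t.
Proof.
move=> ir ab.
have /measurable_EFinP mr := measurable_int _ ir.
have rE : r \_ `[a, b] = fun t => \1_(`[a, b]%classic : set R) t * r t.
  by apply/funext => t; rewrite patchE indicE; case: ifP => _; rewrite ?mul1r ?mul0r.
have ri : leb.-integrable setT (EFin \o (r \_ `[a, b])).
  have mri : measurable_fun setT ((r \_ `[a, b]) : measurableTypeR R -> R).
    by rewrite rE; apply: measurable_funM => //; exact: measurable_indic.
  apply: (le_integrable_real mri _ (integrable_norm ir)) => t /=.
  by rewrite patchE; case: ifP => // _; rewrite normr0.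
rewrite [in RHS]Rintegral_mkcond -RintegralZl//.
have msg (x : R) : measurable_fun setT (fun t : measurableTypeR R => Num.sg (x - t) * (pi / 2)).
  apply: measurable_funM; last exact: measurable_cst.
  have mx : measurable_fun setT (fun t : measurableTypeR R => x - t).
    by apply: measurable_funB => //; exact: measurable_cst.
  have sgE (y : R) : Num.sg y = if 0 < y then 1 else if y < 0 then -1 else 0.
    by have [y0|y0|<-] := ltgtP 0 y; [exact: gtr0_sg|exact: ltr0_sg|exact: sgr0].
  under eq_fun do rewrite sgE.
  have mlt : measurable_fun setT (fun t : measurableTypeR R => 0 < x - t).
    by apply: measurable_fun_ltr => //; exact: measurable_cst.
  have mgt : measurable_fun setT (fun t : measurableTypeR R => x - t < 0).
    by apply: measurable_fun_ltr => //; exact: measurable_cst.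
  apply: (measurable_fun_ifT mlt); first exact: measurable_cst.
  by apply: (measurable_fun_ifT mgt); exact: measurable_cst.
rewrite /Rintegral; congr fine; apply: ae_eq_integral => //.
- apply/measurable_EFinP; apply: measurable_funM => //.
  apply: measurable_funM; first exact: measurable_cst.
  exact: measurable_funB.
- apply/measurable_EFinP; apply: measurable_funM; first exact: measurable_cst.
  by have /measurable_EFinP := measurable_int _ ri.
have := ae_neq a; have := ae_neq b; apply: filterS2; first exact: (ae_filter_ringOfSetsType leb).
move=> t tb ta _ /=.
rewrite patchE; case: ifPn; rewrite mem_setE in_itv /= => h.
  have /andP[ta' tb'] := h.
  rewrite gtr0_sg ?subr_gt0 1?lt_neqAle ?tb//.
  rewrite ltr0_sg ?subr_lt0 1?lt_neqAle 1?eq_sym ?ta//.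
  by congr EFin; field.
rewrite mulr0; congr EFin.
move: h; rewrite negb_and -!ltNge => /orP[h|h].
- by rewrite !gtr0_sg ?subr_gt0 ?subrr ?mulr0 ?mul0r// (lt_trans h).
- by rewrite !ltr0_sg ?subr_lt0 ?subrr ?mulr0 ?mul0r// (lt_trans ab).
Qed.

Lemma Cint_sg h a b : cintegrable leb h -> a < b ->
  Cint leb (fun t => (2 * (Num.sg (b - t) * (pi / 2) - Num.sg (a - t) * (pi / 2)))%:C * h t) =
  (2 * pi * \int[leb]_(t in `[a, b]) Re (h t)) +i* (2 * pi * \int[leb]_(t in `[a, b]) Im (h t)).
Proof.
move=> [hr him] ab; apply: complex_ext; rewrite [RHS]/=.
- by rewrite -(Rintegral_sg hr ab); apply: eq_Rintegral => t _; rewrite ReM /= mul0r subr0.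
- by rewrite -(Rintegral_sg him ab); apply: eq_Rintegral => t _; rewrite ImM /= mul0r addr0.
Qed.

(** With a vanishing transform, the right side of [cabs_Cint_sg_le] is 0, so the integral of [h]
    over every interval vanishes. *)
Lemma fourier_eq0_ae h : cintegrable leb h -> (forall tau, fourier leb h id tau = 0) ->
  {ae leb, forall t, h t = 0}.
Proof.
move=> hi h0; have [hr him] := hi.
have N0 a b : (fun tau => cabs (itv_fourier a b tau) * cabs (fourier leb h id tau)) = cst 0.
  by apply/funext => tau; rewrite h0 cabs0 mulr0.
have S0 a b : a < b -> \int[leb]_(t in `[a, b]) Re (h t) = 0 /\
    \int[leb]_(t in `[a, b]) Im (h t) = 0.
  move=> ab; have := @cabs_Cint_sg_le _ a b ab _ _ leb h id hi.
  have mid : measurable_fun setT (id : measurableTypeR R -> R) by exact: measurable_id.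
  rewrite N0 /Rintegral integral0 mulr0 Cint_sg// => /(_ mid) le0.
  have {}le0 := le0 (integrable0 leb [set: measurableTypeR R]).
  have /cabs0_eq0[] : cabs ((2 * pi * \int[leb]_(t in `[a, b]) Re (h t)) +i*
      (2 * pi * \int[leb]_(t in `[a, b]) Im (h t))) = 0.
    by apply/eqP; rewrite eq_le cabs_ge0 andbT.
  have pi2 : 2 * pi != 0 :> R by rewrite mulf_neq0// gt_eqF// pi_gt0.
  have inj (x : R) : 2 * pi * x = 0 -> x = 0.
    by move=> /eqP; rewrite mulf_eq0 (negbTE pi2) => /eqP.
  by move=> /inj r0 /inj i0; split.
have aeR := ae_eq0_itv hr (fun a b ab => (S0 a b ab).1).
have aeI := ae_eq0_itv him (fun a b ab => (S0 a b ab).2).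
move: aeR aeI; apply: filterS2; first exact: (ae_filter_ringOfSetsType leb).
by move=> t hr0 hi0; exact: complex_ext.
Qed.

Lemma Lnorm2_ae_eq (p q : R -> R) : measurable_fun setT (p : measurableTypeR R -> R) ->
  measurable_fun setT (q : measurableTypeR R -> R) -> {ae leb, forall t, p t = q t} ->
  ('N[leb]_2%:E[EFin \o p] = 'N[leb]_2%:E[EFin \o q])%E.
Proof.
move=> mp mq pq; rewrite unlock; congr (_ `^ _)%E.
have msq (r : R -> R) : measurable_fun setT (r : measurableTypeR R -> R) ->
    measurable_fun setT (fun t : measurableTypeR R => `|(EFin \o r) t| `^ 2)%E.
  move=> mr; apply: (measurableT_comp (f := fun x : \bar R => (x `^ 2)%E)).
    exact: measurable_poweR.
  by apply: measurableT_comp => //; exact/measurable_EFinP.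
apply: ae_eq_integral => //; [exact: msq|exact: msq|].
move: pq; apply: filterS; first exact: (ae_filter_ringOfSetsType leb).
by move=> t /= ->.
Qed.

Section MellinUniqueness.
Variables (f : R -> C) (F : C -> C).
Hypothesis fL2 : in_Lp 2%:E Rpos f.
Hypothesis fM : is_mellin f F.
Hypothesis F0 : {ae leb, forall tau, F (sigma tau) = 0}.

Let f0 t : C := (\1_(Rpos : set R) t)%:C * f t.

Let cmeas_f0 : cmeas (f0 : measurableTypeR R -> C).
Proof.
have [[mr mi] _] := fL2.
have ReE : (fun t => Re (f t)) \_ Rpos = fun t => Re (f0 t).
  apply/funext => t; rewrite ReM patchE indicE /=.
  by case: ifP => _; rewrite !mul0r subr0 ?mul1r.
have ImE : (fun t => Im (f t)) \_ Rpos = fun t => Im (f0 t).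
  apply/funext => t; rewrite ImM patchE indicE /=.
  by case: ifP => _; rewrite !mul0r addr0 ?mul1r.
split.
- by move/(measurable_restrictT _ measurable_Rpos) : mr; rewrite ReE.
- by move/(measurable_restrictT _ measurable_Rpos) : mi; rewrite ImE.
Qed.

Let f0_L2 : leb.-integrable setT (EFin \o (fun t => cabs (f0 t) ^+ 2)).
Proof.
apply: integrable_sqr; first exact: measurable_cabs.
have [_] := fL2; rewrite /cLnorm; congr (Lnorm _ _ (EFin \o _) < _)%E.
apply/funext => t; rewrite patchE /f0 indicE cabsM cabsR.
by case: ifP => _; rewrite ?normr1 ?mul1r ?normr0 ?mul0r.
Qed.

(** [t^(-1/2) f(t)], the modulus of the Mellin kernel on the critical line being absorbed; what
    remains of it is the character [e^(i tau ln t)]. *)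
Let g t : C := (expR (- (ln t / 2)))%:C * f0 t.

Let h a t : C := (\1_(`[a^-1, a]%classic : set R) t)%:C * g t.

Let cmeas_g : cmeas (g : measurableTypeR R -> C).
Proof.
apply: cmeasM => //; apply: cmeasR; apply: (measurableT_comp (@measurable_expR R)).
apply: measurable_funN; apply: measurable_funM; last exact: measurable_cst.
exact: measurable_ln.
Qed.

Let cmeas_h a : cmeas (h a : measurableTypeR R -> C).
Proof. by apply: cmeasM => //; apply: cmeasR; exact: measurable_indic. Qed.

Let cintegrable_h a : 0 < a -> cintegrable leb (h a).
Proof.
move=> a0; pose I := \1_(`[a^-1, a]%classic : set R) : R -> R.
have iI : leb.-integrable setT (EFin \o I) by exact: integrable_indic_itv.
(* On [[1/a, a]] one has [t^(-1/2) <= a^(1/2)], and [|f| <= 1 + |f|^2]. *)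
apply: (cintegrable_le (cmeas_h a) _
  (integrableZl measurableT (expR (ln a / 2)) (integrableD measurableT iI f0_L2))).
move=> t; rewrite /h indicE mem_setE in_itv /=.
case: (boolP (a^-1 <= t <= a)) => [/andP[t1 t2]|_]; last first.
  by rewrite mul0r cabs0 mulr_ge0 ?expR_ge0// addr_ge0 ?sqr_ge0.
rewrite mul1r /g cabsM cabsR ger0_norm ?expR_ge0// /I indicE mem_setE in_itv /= t1 t2 /=.
have t0 : 0 < t by rewrite (lt_le_trans _ t1)// invr_gt0.
apply: ler_pM => //; rewrite ?expR_ge0 ?cabs_ge0//.
  rewrite ler_expR -mulNr ler_wpM2r// lerNl -lnV ?posrE// ler_ln ?posrE ?invr_gt0//.
set x := cabs _; have := sqr_ge0 (x - 1); have : 0 <= x by exact: cabs_ge0.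
by rewrite sqrrB; nra.
Qed.

Let truncated_mellinE a tau : 0 < a ->
  truncated_mellin f a (sigma tau) = fourier leb (h a) (@ln R) tau.
Proof.
move=> a0.
have E t : t \in `[a^-1, a] -> f t * cpow t (sigma tau - 1) =
    h a t * cexp ('i%C * (tau * ln t)%:C).
  move=> ht; rewrite /h indicE mem_setE ht mul1r /g /f0 indicE.
  have t0 : 0 < t.
    move: ht; rewrite in_itv /= => /andP[t1 _].
    by rewrite (lt_le_trans _ t1)// invr_gt0.
  rewrite mem_setE in_itv /= t0 mul1r [RHS]mulrC mulrCA [f t * _]mulrC mulrA; congr (_ * _).
  rewrite /cpow -cexpR -cexpD; congr cexp.
  by apply/eqP; rewrite eq_complex /=; apply/andP; split; apply/eqP; field.
have N t : (t \in `[a^-1, a]) = false -> h a t = 0.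
  by move=> ht; rewrite /h indicE mem_setE ht mul0r.
apply: complex_ext; rewrite /= Rintegral_mkcond; apply: eq_Rintegral => t _; rewrite patchE mem_setE.
- by case: ifPn => [/E ->//|/negbTE/N ->]; rewrite mul0r.
- by case: ifPn => [/E ->//|/negbTE/N ->]; rewrite mul0r.
Qed.

Let sg_ln (x t : R) : 0 < x -> 0 < t -> Num.sg (ln x - ln t) = Num.sg (x - t).
Proof.
move=> x0 t0; have [xt|xt|->] := ltgtP x t.
- by rewrite !ltr0_sg// subr_lt0// ltr_ln.
- by rewrite !gtr0_sg// subr_gt0// ltr_ln.
- by rewrite !subrr.
Qed.

Let h_nonpos a t : 0 < a -> t <= 0 -> h a t = 0.
Proof.
move=> a0 t0; rewrite /h indicE mem_setE in_itv /= leNgt.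
by rewrite (le_lt_trans t0) ?invr_gt0//= mul0r.
Qed.

Let cmeas_F : cmeas (F \o sigma : measurableTypeR R -> C).
Proof. by have [[]] := fM. Qed.

(** Since [F] is null, mean-square convergence says that the transforms of the truncations tend to 0
    in norm; [a] can moreover be taken beyond any given [a1]. *)
Let Lnorm_fourier_h (e : R) (a1 : R) : 0 < e ->
  exists2 a, Num.max 1 a1 < a &
    ('N[leb]_2%:E[EFin \o (fun tau => cabs (fourier leb (h a) (@ln R) tau))] < e%:E)%E.
Proof.
move=> e0; have [_ lim] := fM.
have nbhs0 : nbhs (0%E : \bar R) [set x : \bar R | (x < e%:E)%E].
  by apply: open_nbhs_nbhs; split; [exact: lray_open|rewrite /= lte_fin].
have [M [_ HM]] := lim _ nbhs0.
pose a := Num.max M (Num.max 1 a1) + 1.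
have Ma : M < a by rewrite ltr_pwDr// le_max lexx.
have ma : Num.max 1 a1 < a by rewrite ltr_pwDr// le_max lexx orbT.
have a0 : 0 < a by rewrite (lt_trans _ ma)// lt_max ltr01.
exists a => //; apply: le_lt_trans (HM a Ma).
rewrite /cLnorm patch_setT.
have mlnR : measurable_fun setT (@ln R : measurableTypeR R -> R) by exact: measurable_ln.
have mf := cmeas_fourier (cintegrable_h a0) mlnR.
rewrite le_eqVlt; apply/orP; left; apply/eqP; apply: Lnorm2_ae_eq.
- exact: measurable_cabs.
- apply: measurable_cabs; apply: cmeasD; first exact: cmeas_F.
  apply: cmeasN; rewrite (_ : (fun tau => _) = fourier leb (h a) (@ln R))//.
  by apply/funext => tau; rewrite truncated_mellinE.
move: F0; apply: filterS; first exact: (ae_filter_ringOfSetsType leb).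
by move=> tau F0t; rewrite F0t sub0r cabsN truncated_mellinE.
Qed.

(** Parseval against [[ln x, ln y]] in the variable [ln t]: Cauchy-Schwarz pairs a fixed
    square-integrable function with a transform of norm below [e], while the left side does not
    depend on the truncation once [[1/a, a]] contains [[x, y]]. *)
Let itv_g0 (x y : R) : 0 < x -> x < y ->
  \int[leb]_(t in `[x, y]) Re (g t) = 0 /\ \int[leb]_(t in `[x, y]) Im (g t) = 0.
Proof.
move=> x0 xy; have y0 := lt_trans x0 xy.
have lnxy : ln x < ln y by rewrite ltr_ln.
have [K K0 PK] := cabs_itv_fourier_sqr lnxy.
pose p tau := cabs (itv_fourier (ln x) (ln y) tau).
have mp : measurable_fun setT (p : measurableTypeR R -> R).
  by apply: measurable_cabs; exact: cmeas_itv_fourier.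
have p2 : leb.-integrable setT (EFin \o (fun t => p t ^+ 2)).
  have mp2 : measurable_fun setT (fun t : measurableTypeR R => p t ^+ 2).
    exact: measurable_funX.
  apply: (le_integrable_real mp2 _ (integrableZl measurableT K integrable_oneDsqrV)).
  by move=> t; rewrite ger0_norm ?sqr_ge0//; exact: PK.
set c := (2 * pi * \int[leb]_(t in `[x, y]) Re (g t)) +i*
  (2 * pi * \int[leb]_(t in `[x, y]) Im (g t)).
set P := fine ('N[leb]_2%:E[EFin \o p])%E.
have P0 : 0 <= P by exact/fine_ge0/Lnorm_ge0.
have cle (e : R) : 0 < e -> cabs c <= 4 * (P * e).
  move=> e0; have [a ha he] := Lnorm_fourier_h (Num.max y x^-1) e0.
  move: ha; rewrite !gt_max => /and3P[a1 ya xa].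
  have a0 : 0 < a by rewrite (lt_trans _ a1).
  have mlnR : measurable_fun setT (@ln R : measurableTypeR R -> R) by exact: measurable_ln.
  have hi := cintegrable_h a0.
  have [ipq pqe] := cauchy_schwarz_le (fun t => cabs_ge0 (itv_fourier (ln x) (ln y) t))
    (fun t => cabs_ge0 (fourier leb (h a) (@ln R) t)) mp
    (measurable_cabs (cmeas_fourier hi mlnR)) p2 he.
  have := cabs_Cint_sg_le lnxy hi mlnR ipq.
  rewrite (_ : Cint _ _ = c); first by move/le_trans; apply; rewrite ler_wpM2l.
  transitivity (Cint leb (fun t =>
      (2 * (Num.sg (y - t) * (pi / 2) - Num.sg (x - t) * (pi / 2)))%:C * h a t)).
    apply: eq_Cint => t; have [t0|t0] := leP t 0; first by rewrite h_nonpos// !mulr0.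
    by rewrite !sg_ln.
  rewrite Cint_sg// /c.
  have hg t : t \in `[x, y]%classic -> h a t = g t.
    rewrite mem_setE in_itv /= => /andP[xt ty]; rewrite /h indicE mem_setE in_itv /=.
    rewrite (le_trans ty (ltW ya)) (le_trans _ xt) ?mul1r//.
    by rewrite -(invrK x) lef_pV2 ?posrE ?invr_gt0// ltW.
  congr ((2 * pi * _) +i* (2 * pi * _)); apply: eq_Rintegral => t /hg -> //.
have c0 : cabs c = 0.
  apply/eqP; rewrite eq_le cabs_ge0 andbT leNgt; apply/negP => cpos.
  have P4 : 0 < 8 * (P + 1) by rewrite mulr_gt0// ltr_wpDl.
  (* This [e] would give [|c| <= (|c| / 2) P / (P + 1) < |c|]. *)
  have := cle (cabs c / (8 * (P + 1))) (divr_gt0 cpos P4).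
  rewrite leNgt => /negP; apply.
  rewrite !mulrA ltr_pdivrMr//; nra.
have pi2 : 2 * pi != 0 :> R by rewrite mulf_neq0// gt_eqF// pi_gt0.
have inj (u : R) : 2 * pi * u = 0 -> u = 0.
  by move=> /eqP; rewrite mulf_eq0 (negbTE pi2) => /eqP.
by have [/inj r0 /inj i0] := cabs0_eq0 c0.
Qed.

(** [g] is not known to be integrable up to 0 and infinity, so the interval criterion is applied to
    countably many truncations, whose intervals exhaust [Rpos]. *)
Lemma mellin_eq0_ae : zero_ae_Rpos f.
Proof.
pose a n : R := n.+1%:R.
have a0 n : 0 < a n by rewrite ltr0n.
have hn n : {ae leb, forall t, h (a n) t = 0}.
  have [hr him] := cintegrable_h (a0 n).
  have key (pr : C -> R) (u v : R) : (forall t, pr (h (a n) t) =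
      if t \in `[(a n)^-1, a n] then pr (g t) else 0) ->
      (forall x y : R, 0 < x -> x < y -> \int[leb]_(t in `[x, y]) pr (g t) = 0) ->
      u < v -> \int[leb]_(t in `[u, v]) pr (h (a n) t) = 0.
    move=> prE pr0 uv.
    (* The interval is clipped to the range of the truncation, which keeps it inside [Rpos], where
       [itv_g0] applies. *)
    pose x := Num.max u (a n)^-1; pose y := Num.min v (a n).
    transitivity (\int[leb]_(t in `[x, y]) pr (g t)).
      rewrite Rintegral_mkcond [RHS]Rintegral_mkcond; apply: eq_Rintegral => t _.
      rewrite !patchE prE !mem_setE !in_itv /= /x /y ge_max le_min.
      by do 4 case: (_ <= _).
    have [xy|yx|xy] := ltgtP x y.
    - by apply: pr0 => //; rewrite /x lt_max invr_gt0 a0 orbT.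
    - by rewrite set_itv_ge ?Rintegral_set0// bnd_simp -ltNge.
    - by rewrite xy set_itv1 Rintegral_set1.
  have reE t : Re (h (a n) t) = if t \in `[(a n)^-1, a n] then Re (g t) else 0.
    by rewrite /h indicE mem_setE ReM /=; case: ifP => _; rewrite !mul0r subr0 ?mul1r.
  have imE t : Im (h (a n) t) = if t \in `[(a n)^-1, a n] then Im (g t) else 0.
    by rewrite /h indicE mem_setE ImM /=; case: ifP => _; rewrite !mul0r addr0 ?mul1r.
  have := ae_eq0_itv hr (fun u v => key (@Re R) u v reE (fun x y x0 xy => (itv_g0 x0 xy).1)).
  have := ae_eq0_itv him (fun u v => key (@Im R) u v imE (fun x y x0 xy => (itv_g0 x0 xy).2)).
  apply: filterS2; first exact: (ae_filter_ringOfSetsType leb).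
  by move=> t im0 re0; exact: complex_ext.
have hall : {ae leb, forall t, forall n, h (a n) t = 0} by exact: ae_foralln hn.
rewrite /zero_ae_Rpos; move: hall.
apply: filterS; first exact: (ae_filter_ringOfSetsType leb).
move=> t ht tpos; have t0 : 0 < t by move: tpos; rewrite /Rpos /= in_itv /= andbT.
pose n := Num.truncn (Num.max t t^-1).
have an : Num.max t t^-1 < a n by exact: truncnS_gt.
have := ht n; rewrite /h indicE mem_setE in_itv /=.
move: an; rewrite gt_max => /andP[ta tVa].
rewrite (ltW ta) andbT -[leRHS](invrK t) lef_pV2 ?posrE ?invr_gt0// (ltW tVa) mul1r.
rewrite /g /f0 indicE mem_set//= mul1r => /eqP; rewrite mulf_eq0 => /orP[|/eqP//].
by rewrite eq_complex /= gt_eqF ?expR_gt0.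
Qed.

End MellinUniqueness.

End Uniqueness.

(** * Vanishing Fourier transforms *)

Section FourierProduct.
Context {R : realType}.
Local Notation C := R[i].
Local Notation leb := (@lebesgue_measure R).

(** By Fubini, multiplying [k] by a transform averages the translates of its own transform: the new
    integral at [y] is an average of the old ones at [y + eta t]. *)
Lemma fourier_mul_fourier_eq0 d1 d2 (T1 : measurableType d1) (T2 : measurableType d2)
    (m1 : {sigma_finite_measure set T1 -> \bar R})
    (m2 : {sigma_finite_measure set T2 -> \bar R})
    (k : T1 -> C) (theta : T1 -> R) (r : T2 -> C) (eta : T2 -> R) :
  cintegrable m1 k -> measurable_fun setT theta ->
  cintegrable m2 r -> measurable_fun setT eta ->
  (forall y, fourier m1 k theta y = 0) ->
  forall y, fourier m1 (fun z => k z * fourier m2 r eta (theta z)) theta y = 0.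
Proof.
move=> ki mtheta ri meta k0 y.
have mk := cintegrable_cmeas ki; have mr := cintegrable_cmeas ri.
pose P (z : T1 * T2) : C :=
  r z.2 * (k z.1 * cexp ('i%C * ((y + eta z.2) * theta z.1)%:C)).
have iP : cintegrable (prodm m1 m2) P.
  apply: (cintegrable_le _ _ (integrable_prodM (integrable_cabs ki) (integrable_cabs ri))).
    apply: cmeasM; first exact: (cmeas_pair2 _ mr).
    apply: cmeasM; first exact: (cmeas_pair1 _ mk).
    apply: cmeas_cexp; apply: cmeasM; first exact: cmeas_cst.
    apply: cmeasR; apply: measurable_funM.
      apply: measurable_funD; first exact: measurable_cst.
      exact: (measurableT_comp meta measurable_snd).
    exact: (measurableT_comp mtheta measurable_fst).
  by move=> z; rewrite /P !cabsM cabs_cexpI mulr1 mulrC.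
transitivity (Cint m1 (fun z => Cint m2 (fun t => P (z, t)))).
  apply: eq_Cint => z; rewrite mulrAC -CintM; last exact: cintegrable_fourier.
  apply: eq_Cint => t; rewrite /P; cbn [fst snd].
  rewrite mulrCA -!mulrA; congr (_ * (_ * _)); rewrite -cexpD; congr cexp.
  by rewrite -mulrDr -rmorphD /=; congr (_ * _%:C); ring.
rewrite (Cint_fubini1 iP) -(Cint_fubini2 iP).
rewrite -[RHS](Cint0 m2); apply: eq_Cint => t.
rewrite /P; cbn [fst snd]; rewrite CintM; last exact: cintegrable_fourier.
by rewrite -/(fourier m1 k theta (y + eta t)) k0 mulr0.
Qed.

Lemma fourier_prod (A B : R -> C) (y : R) : cintegrable leb A -> cintegrable leb B ->
  fourier (prodm leb leb) (fun z : measurableTypeR R * measurableTypeR R => A z.1 * B z.2)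
    (fun z => z.1 + z.2) y =
  fourier leb A id y * fourier leb B id y.
Proof.
move=> Ai Bi; have mA := cintegrable_cmeas Ai; have mB := cintegrable_cmeas Bi.
have mid : measurable_fun setT (id : measurableTypeR R -> R) by exact: measurable_id.
pose P (z : measurableTypeR R * measurableTypeR R) : C :=
  A z.1 * B z.2 * cexp ('i%C * (y * (z.1 + z.2))%:C).
have iP : cintegrable (prodm leb leb) P.
  apply: (cintegrable_le _ _ (integrable_prodM (integrable_cabs Ai) (integrable_cabs Bi))).
    apply: cmeasM.
      by apply: cmeasM; [exact: (cmeas_pair1 _ mA)|exact: (cmeas_pair2 _ mB)].
    apply: cmeas_cexp; apply: cmeasM; first exact: cmeas_cst.
    apply: cmeasR; apply: measurable_funM; first exact: measurable_cst.
    by apply: measurable_funD; [exact: measurable_fst|exact: measurable_snd].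
  by move=> z; rewrite /P !cabsM cabs_cexpI mulr1.
rewrite /fourier -/P -(Cint_fubini1 iP).
rewrite mulrC -CintM; last exact: (cintegrable_fourier Ai mid y).
apply: eq_Cint => t; rewrite mulrC -CintM; last exact: (cintegrable_fourier Bi mid y).
apply: eq_Cint => u; rewrite /P; cbn [fst snd].
by rewrite mulrDr rmorphD mulrDr cexpD; ring.
Qed.

Section Strip.
Context d {T : measurableType d}.
Variables (m : {sigma_finite_measure set T -> \bar R}) (k : T -> C) (theta : T -> R).
Variable delta : R.
Hypothesis mk : cmeas k.
Hypothesis mtheta : measurable_fun setT theta.
Hypothesis delta_gt0 : 0 < delta.
Hypothesis ik : m.-integrable setT
  (EFin \o (fun t => cabs (k t) * expR (delta * `|theta t|))).

Lemma cintegrable_strip : cintegrable m k.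
Proof.
apply: (cintegrable_le mk _ ik) => t.
by rewrite ler_peMr ?cabs_ge0// -expR0 ler_expR mulr_ge0// ltW.
Qed.

(** The factors [e^(delta theta)] and [e^(- delta theta)] are shifts of [y] by [- i delta] and
    [i delta]. Both are extreme cases of [Cint_cexp_extend], whose disc is closed. *)
Lemma fourier_cosh_eq0 : (forall y, fourier m k theta y = 0) ->
  forall y, fourier m (fun t =>
    (expR (delta * theta t) + expR (- (delta * theta t)))%:C * k t) theta y = 0.
Proof.
move=> k0 y.
have ext (e : R) : `|e| <= delta ->
    Cint m (fun t => k t * (cexp ('i%C * (y * theta t)%:C) * cexp (e%:C * (theta t)%:C))) = 0.
  move=> ed; apply: (Cint_cexp_extend mk mtheta delta_gt0 ik ltr01); last by rewrite cabsR.
  by move=> u _; exact: k0.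
have int (e : R) : `|e| <= delta -> cintegrable m
    (fun t => k t * (cexp ('i%C * (y * theta t)%:C) * cexp (e%:C * (theta t)%:C))).
  move=> ed; apply: (cintegrable_le _ _ ik).
    apply: cmeasM => //; apply: cmeasM; first exact: cmeas_cexpI.
    by apply: cmeas_cexp; apply: cmeasM; [exact: cmeas_cst|exact: cmeasR].
  move=> t; rewrite !cabsM cabs_cexpI mul1r -rmorphM cexpR cabsR ger0_norm ?expR_ge0//.
  rewrite ler_wpM2l ?cabs_ge0// ler_expR (le_trans (ler_norm _))// normrM.
  by rewrite ler_wpM2r.
have dd : `|delta| <= delta by rewrite gtr0_norm.
have dN : `|- delta| <= delta by rewrite normrN gtr0_norm.
rewrite -[RHS](addr0 0) -{1}(ext _ dd) -(ext _ dN) -(CintD (int _ dd) (int _ dN)).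
apply: eq_Cint => t; rewrite -!rmorphM !cexpR mulNr rmorphD; ring.
Qed.

(** Identity theorem on the real line: vanishing near one point spreads to a distance [delta], a
    radius independent of that neighbourhood, so it can be iterated. *)
Lemma fourier_extend_eq0 (y0 r : R) : 0 < r ->
  (forall y, `|y - y0| < r -> fourier m k theta y = 0) ->
  forall y, fourier m k theta y = 0.
Proof.
have step (y1 s : R) : 0 < s -> (forall y, `|y - y1| < s -> fourier m k theta y = 0) ->
    forall y, `|y - y1| <= delta -> fourier m k theta y = 0.
  move=> s0 hs y yd.
  have := Cint_cexp_extend (z := 'i%C * (y - y1)%:C) mk mtheta delta_gt0 ik s0 hs.
  rewrite cabsM cabsi mul1r cabsR => /(_ yd) <-; apply: eq_Cint => t.
  congr (_ * _); rewrite -cexpD -mulrA -mulrDr -rmorphM -rmorphD /=.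
  by congr (cexp (_ * _%:C)); ring.
move=> r0 hr.
have ball (n : nat) : forall y1 s : R, 0 < s ->
    (forall y, `|y - y1| < s -> fourier m k theta y = 0) ->
    forall y, `|y - y1| <= n%:R * (delta / 2) -> fourier m k theta y = 0.
  elim: n => [|n IHn] y1 s s0 hs y.
    by rewrite mul0r normr_le0 subr_eq0 => /eqP ->; apply: hs; rewrite subrr normr0.
  (* The first of [n + 1] equal moves towards [y]. It has length at most [delta / 2], so [step]
     still leaves a neighbourhood of radius [delta / 2] around [y2]. *)
  move=> yn; pose y2 := y1 + (y - y1) / n.+1%:R.
  have n0 : 0 < n.+1%:R :> R by rewrite ltr0n.
  have h2 : `|y2 - y1| <= delta / 2.
    rewrite /y2 addrAC subrr add0r normrM [X in _ * X]ger0_norm ?invr_ge0 ?(ltW n0)//.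
    by rewrite ler_pdivrMr// mulrC.
  apply: (IHn y2 (delta / 2)); first by rewrite divr_gt0.
    move=> u hu; apply: (step y1 s s0 hs).
    rewrite (_ : u - y1 = (u - y2) + (y2 - y1)); last by ring.
    by rewrite (le_trans (ler_normD _ _))// [leRHS]splitr lerD// ltW.
  rewrite (_ : y - y2 = (y - y1) * (n%:R / n.+1%:R)); last first.
    by rewrite /y2 -natr1; field; rewrite natr1 gt_eqF.
  rewrite normrM [X in _ * X]ger0_norm ?divr_ge0 ?ler0n//.
  rewrite [leLHS]mulrA ler_pdivrMr// [leRHS](_ : _ = n.+1%:R * (delta / 2) * n%:R); last by ring.
  by rewrite ler_wpM2r.
move=> y; pose n := (Num.truncn (`|y - y0| / (delta / 2))).+1.
apply: (ball n y0 r r0 hr); rewrite -ler_pdivrMr ?divr_gt0//.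
exact/ltW/truncnS_gt.
Qed.

(** The transform is Lipschitz, because the exponential weight makes [|k| |theta|] integrable. *)
Lemma fourier_neq0_near (y0 : R) : fourier m k theta y0 != 0 ->
  exists2 r, 0 < r & forall y, `|y - y0| < r -> fourier m k theta y != 0.
Proof.
move=> F0; have ki := cintegrable_strip.
have iM : m.-integrable setT (EFin \o (fun t => cabs (k t) * `|theta t|)).
  have := integrableZl measurableT delta^-1 ik.
  apply: le_integrable_real.
    apply: measurable_funM; first exact: measurable_cabs.
    exact: measurableT_comp.
  move=> t; rewrite ger0_norm ?mulr_ge0 ?cabs_ge0// mulrCA ler_wpM2l ?cabs_ge0//.
  rewrite mulrC ler_pdivlMr// mulrC (le_trans _ (expR_ge1Dx _))//.
  by rewrite lerDr.
pose M := \int[m]_t (cabs (k t) * `|theta t|).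
have M0 : 0 <= M by apply: Rintegral_ge0 => t _; rewrite mulr_ge0 ?cabs_ge0.
have lip y : cabs (fourier m k theta y0 - fourier m k theta y) <= 4 * `|y - y0| * M.
  have E : fourier m k theta y0 - fourier m k theta y = Cint m (fun t =>
      k t * cexp ('i%C * (y0 * theta t)%:C) + (-1) * (k t * cexp ('i%C * (y * theta t)%:C))).
    rewrite CintD; last 2 first.
    - exact: cintegrable_fourier.
    - by apply: cintegrableM; exact: cintegrable_fourier.
    by rewrite CintM ?mulN1r//; exact: cintegrable_fourier.
  rewrite E.
  have iD := cintegrableD (cintegrable_fourier ki mtheta y0)
    (cintegrableM (-1) (cintegrable_fourier ki mtheta y)).
  have -> : 4 * `|y - y0| * M = 2 * \int[m]_t (2 * `|y - y0| * (cabs (k t) * `|theta t|)).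
    by rewrite RintegralZl// -/M; ring.
  apply: cabs_Cint_le iD (integrableZl measurableT _ iM) _ => t.
  rewrite (_ : _ + _ = - (k t * cexp ('i%C * (y0 * theta t)%:C) *
    (cexp ('i%C * ((y - y0) * theta t)%:C) - 1))); last first.
    rewrite mulrBr mulr1 -[k t * _ * _]mulrA -cexpD -mulrDr -rmorphD /= -mulrDl [y0 + _]addrC subrK.
    by ring.
  rewrite cabsN !cabsM cabs_cexpI mulr1 [leRHS]mulrCA ler_wpM2l ?cabs_ge0//.
  by rewrite (le_trans (cabs_cexpI_dist0 _))// normrM mulrA.
have c0 : 0 < cabs (fourier m k theta y0).
  rewrite lt_neqAle cabs_ge0 andbT eq_sym; apply: contra F0 => /eqP F0.
  by apply/eqP; exact: cabs0_eq0.
exists (cabs (fourier m k theta y0) / (4 * (M + 1))).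
  by rewrite divr_gt0// mulr_gt0// ltr_wpDl.
move=> y yr; apply/eqP => Fy; have := lip y; rewrite Fy subr0 leNgt => /negP; apply.
rewrite ltr_pdivlMr in yr; last by rewrite mulr_gt0// ltr_wpDl.
have := normr_ge0 (y - y0); have := c0; move: yr.
set q := cabs _; set w := `|_|; nra.
Qed.

End Strip.

End FourierProduct.

(** * The half-Hartley convolution *)

Section HalfHartleyConvolution.
Context {R : realType}.
Local Notation C := R[i].
Local Notation leb := (@lebesgue_measure R).
Implicit Types (tau u v x y : R) (F G : C -> C).

Definition cosh2 x : R := expR x + expR (- x).

Let cosh2_ge x : expR `|x| <= cosh2 x.
Proof.
rewrite /cosh2; have [x0|x0] := leP 0 x; first by rewrite ger0_norm// lerDl expR_ge0.
by rewrite ltr0_norm// lerDr expR_ge0.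
Qed.

Let cosh2_gt0 x : 0 < cosh2 x.
Proof. exact: lt_le_trans (expR_gt0 _) (cosh2_ge x). Qed.

Let cosh2_le x : cosh2 x <= 2 * expR `|x|.
Proof.
by rewrite mulr2n mulrDl mul1r lerD// ler_expR ?ler_norm// -normrN ler_norm.
Qed.

Let cosh2_neq0 x : (cosh2 x)%:C != 0.
Proof. by rewrite eq_complex /= negb_and gt_eqF. Qed.

Let sigmaN tau : 1 - sigma tau = sigma (- tau).
Proof. by apply/eqP; rewrite eq_complex /=; apply/andP; split; apply/eqP; field. Qed.

Let sigmaD tau u : sigma tau + sigma u - 2^-1 = sigma (tau + u).
Proof. by apply/eqP; rewrite eq_complex /=; apply/andP; split; apply/eqP; field. Qed.

Let csin_sigma tau u :
  csin ((pi : R)%:C * (sigma tau + sigma u) / 2) = (cosh2 (pi / 2 * (tau + u)) / 2)%:C.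
Proof.
rewrite /csin.
have -> : 'i%C * ((pi : R)%:C * (sigma tau + sigma u) / 2) =
    (- (pi / 2 * (tau + u)))%:C + 'i%C * (pi / 2)%:C.
  by apply/eqP; rewrite eq_complex /=; apply/andP; split; apply/eqP; field.
rewrite opprD cexpD cexpR cexpI cos_pihalf sin_pihalf cexpD.
rewrite (_ : - ('i%C * _) = 'i%C * (- (pi / 2))%:C); last by rewrite rmorphN mulrN.
rewrite cexpI cosN sinN cos_pihalf sin_pihalf.
rewrite (_ : - (- _)%:C = (pi / 2 * (tau + u))%:C); last by rewrite rmorphN opprK.
rewrite cexpR /cosh2.
by apply/eqP; rewrite eq_complex /=; apply/andP; split; apply/eqP; field.
Qed.

Let ccos_sigma tau u :
  ccos ((pi : R)%:C * (sigma tau - sigma u) / 2) = (cosh2 (pi / 2 * (tau - u)) / 2)%:C.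
Proof.
rewrite /ccos.
have -> : 'i%C * ((pi : R)%:C * (sigma tau - sigma u) / 2) = (- (pi / 2 * (tau - u)))%:C.
  by apply/eqP; rewrite eq_complex /=; apply/andP; split; apply/eqP; field.
rewrite (_ : - (- _)%:C = (pi / 2 * (tau - u))%:C); last by rewrite rmorphN opprK.
rewrite !cexpR /cosh2.
by apply/eqP; rewrite eq_complex /=; apply/andP; split; apply/eqP; field.
Qed.

(** On the line the sine and the cosine become [cosh(pi (tau + u) / 2)] and
    [cosh(pi (tau - u) / 2)]; their sum is [2 cosh(pi tau / 2) cosh(pi u / 2)], which separates the
    variables. *)
Let kernelE tau u : half_hartley_kernel (sigma tau) (sigma u) =
  (Gamma (sigma tau) * (cosh2 (pi / 2 * tau))%:C) *
  (Gamma (sigma u) * (cosh2 (pi / 2 * u))%:C) *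
  ((cosh2 (pi / 2 * (tau + u)))%:C^-1 * (Gamma (sigma (tau + u)))^-1).
Proof.
rewrite /half_hartley_kernel sigmaD csin_sigma ccos_sigma -rmorphD /=.
have -> : cosh2 (pi / 2 * (tau + u)) / 2 + cosh2 (pi / 2 * (tau - u)) / 2 =
    cosh2 (pi / 2 * tau) * cosh2 (pi / 2 * u) / 2.
  by rewrite /cosh2 mulrDr mulrBr opprD opprB !expRD; field.
rewrite ![(_ / 2)%:C]rmorphM /= -mulf_div divff ?mulr1; last first.
  by rewrite eq_complex /= negb_and invr_neq0.
by rewrite rmorphM /=; ring.
Qed.

Let cpowE x tau u : cpow x (sigma tau + sigma u - 3 / 2) =
  (expR (- (ln x / 2)))%:C * cexp ('i%C * (ln x * (tau + u))%:C).
Proof.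
rewrite /cpow -cexpR -cexpD; congr cexp.
by apply/eqP; rewrite eq_complex /=; apply/andP; split; apply/eqP; field.
Qed.

Let Gamma_neq0 v : Gamma (sigma v) != 0.
Proof.
have [c c0 cG] := @cabs_Gamma_sigma_ge R; apply/eqP => G0.
by have := cG v; rewrite G0 cabs0 leNgt mulr_gt0 ?expR_gt0.
Qed.

Lemma cmeasV d (T : measurableType d) (f : T -> C) : cmeas f -> cmeas (fun t => (f t)^-1).
Proof.
move=> mf; have [fr fi] := mf.
(* [q] is the inverse of [|f|^2] wherever [f] is nonzero. At a zero of [f] its value does not
   matter: both components are multiplied by 0, in agreement with the convention that the inverse of
   0 is 0. *)
pose q t := expR (- ln (Re (f t) ^+ 2 + Im (f t) ^+ 2)).
have mq : measurable_fun setT q.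
  apply: (measurableT_comp (@measurable_expR R)); apply: measurable_funN.
  apply: (measurableT_comp (@measurable_ln R)).
  by apply: measurable_funD; exact: measurable_funX.
have inv (a b : R) : (a, b) != (0, 0) ->
    expR (- ln (a ^+ 2 + b ^+ 2)) = (a ^+ 2 + b ^+ 2)^-1.
  move=> ab; rewrite expRN lnK// posrE lt_neqAle addr_ge0 ?sqr_ge0// andbT eq_sym.
  by rewrite paddr_eq0 ?sqr_ge0// !sqrf_eq0 -xpair_eqE.
have fE t : (f t)^-1 = (Re (f t) * q t) +i* (- (Im (f t)) * q t).
  rewrite /q; case: (f t) => a b /=; have [/eqP|ab] := eqVneq (a, b) (0, 0).
    by rewrite xpair_eqE => /andP[/eqP -> /eqP ->]; rewrite oppr0 !mul0r invr0.
  by rewrite inv//; apply/eqP; rewrite eq_complex /= mulNr !eqxx.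
split; under eq_fun do rewrite fE /=; first exact: measurable_funM.
by apply: measurable_funM => //; exact: measurable_funN.
Qed.

Let mln : measurable_fun setT (@ln R : measurableTypeR R -> R).
Proof. exact: measurable_ln. Qed.

Let cintegrable_euler : cintegrable leb (fun t => (euler_density t)%:C).
Proof.
split; first exact: integrable_euler_density.
by apply: eq_integrable (integrable0 leb [set: measurableTypeR R]).
Qed.

Lemma Gamma_fourier v :
  Gamma (sigma v) = fourier leb (fun t => (euler_density t)%:C) (@ln R) v.
Proof. exact: Gamma_sigmaE. Qed.

Let cmeas_Gamma : cmeas (fun v : measurableTypeR R => Gamma (sigma v)).
Proof.
rewrite (_ : (fun v => _) = fourier leb (fun t => (euler_density t)%:C) (@ln R)).
  exact: cmeas_fourier.
by apply/funext => v; exact: Gamma_fourier.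
Qed.

Definition hh_factor F tau : C :=
  Gamma (sigma tau) * (cosh2 (pi / 2 * tau))%:C * F (sigma (- tau)).

Let pi2_gt0 : 0 < pi / 2 :> R.
Proof. by rewrite divr_gt0// pi_gt0. Qed.

Let cmeas_cosh2 : cmeas (fun x : measurableTypeR R => (cosh2 (pi / 2 * x))%:C).
Proof.
apply: cmeasR; rewrite /cosh2.
have mx : measurable_fun setT (fun x : measurableTypeR R => pi / 2 * x).
  by apply: measurable_funM => //; exact: measurable_cst.
apply: measurable_funD; first exact: (measurableT_comp (@measurable_expR R)).
by apply: (measurableT_comp (@measurable_expR R)); exact: measurable_funN.
Qed.

Section Factor.
Variable F : C -> C.
Hypothesis mF : cmeas (F \o sigma : measurableTypeR R -> C).
Hypothesis F_L1 : in_Lp_sigma 1%:E (fun s => (expR (pi * cabs s))%:C * F s).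

Lemma cmeas_hh_factor : cmeas (hh_factor F : measurableTypeR R -> C).
Proof.
apply: cmeasM; first exact: cmeasM.
have [mr mi] := mF.
have mopp : measurable_fun setT (-%R : measurableTypeR R -> measurableTypeR R).
  exact: oppr_measurable.
by split; [exact: (measurableT_comp mr mopp)|exact: (measurableT_comp mi mopp)].
Qed.

(** [Gamma] is merely bounded here. Of the weight [e^(pi |s|)], with [|tau| <= |s|], one half
    controls [cosh2] and the other half is the weight kept in the conclusion. *)
Lemma integrable_hh_factor : leb.-integrable setT
  (EFin \o (fun tau => cabs (hh_factor F tau) * expR (pi / 2 * `|tau|))).
Proof.
pose w tau := expR (pi * cabs (sigma tau)) * cabs (F (sigma tau)).
have iw : leb.-integrable setT (EFin \o w).
  have [mw] := F_L1; rewrite /cLnorm patch_setT Lnorm1 => fin.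
  have wE : w = fun tau => cabs ((expR (pi * cabs (sigma tau)))%:C * F (sigma tau)).
    by apply/funext => tau; rewrite cabsM cabsR ger0_norm ?expR_ge0.
  rewrite wE; apply/integrableP; split.
    by apply/measurable_EFinP; exact: (measurable_cabs mw).
  exact: fin.
have [K K0 GK] := @cabs_Gamma_sigma_le R.
have key tau : `|cabs (hh_factor F tau) * expR (pi / 2 * `|tau|)| <= K * 2 * w (- tau).
  rewrite ger0_norm ?mulr_ge0 ?cabs_ge0 ?expR_ge0// /hh_factor !cabsM cabsR.
  rewrite (gtr0_norm (cosh2_gt0 _)) /w.
  have h1 : cosh2 (pi / 2 * tau) * expR (pi / 2 * `|tau|) <=
      2 * expR (pi * cabs (sigma (- tau))).
    rewrite (le_trans (ler_wpM2r _ (cosh2_le _))) ?expR_ge0//.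
    rewrite -[leLHS]mulrA -expRD ler_wpM2l// ler_expR normrM (gtr0_norm pi2_gt0).
    rewrite -mulrDl -splitr ler_wpM2l ?pi_ge0// -normrN.
    exact: (Im_le_cabs (sigma (- tau))).
  rewrite [leLHS]mulrAC [leRHS]mulrA ler_wpM2r ?cabs_ge0//.
  rewrite -[leLHS]mulrA -[leRHS]mulrA.
  by apply: ler_pM; rewrite ?cabs_ge0 ?mulr_ge0 ?expR_ge0// ltW.
have mhh : measurable_fun setT ((fun tau => cabs (hh_factor F tau) *
    expR (pi / 2 * `|tau|)) : measurableTypeR R -> R).
  apply: measurable_funM; first exact: measurable_cabs cmeas_hh_factor.
  apply: (measurableT_comp (@measurable_expR R)); apply: measurable_funM.
    exact: measurable_cst.
  exact: normr_measurable.
exact: (le_integrable_real mhh key (integrableZl measurableT (K * 2) (integrable_opp iw))).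
Qed.

Lemma hh_factor_eq0_ae : (forall y, fourier leb (hh_factor F) id y = 0) ->
  {ae leb, forall tau, F (sigma tau) = 0}.
Proof.
move=> h0.
have hi : cintegrable leb (hh_factor F).
  exact: (cintegrable_strip cmeas_hh_factor pi2_gt0 integrable_hh_factor).
have := ae_opp (fourier_eq0_ae hi h0).
apply: filterS; first exact: (ae_filter_ringOfSetsType leb).
move=> tau /eqP; rewrite /hh_factor opprK mulf_eq0 => /orP[|/eqP//].
by rewrite mulf_eq0 (negbTE (Gamma_neq0 _)) (negbTE (cosh2_neq0 _)).
Qed.

End Factor.

Section Convolution.
Variables F G : C -> C.
Hypothesis mF : cmeas (F \o sigma : measurableTypeR R -> C).
Hypothesis mG : cmeas (G \o sigma : measurableTypeR R -> C).
Hypothesis F_L1 : in_Lp_sigma 1%:E (fun s => (expR (pi * cabs s))%:C * F s).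
Hypothesis G_L1 : in_Lp_sigma 1%:E (fun s => (expR (pi * cabs s))%:C * G s).
Hypothesis conv0 : forall x, 0 < x -> half_hartley_conv F G x = 0.

Let A := hh_factor F.

Let B := hh_factor G.

Let wA tau := cabs (A tau) * expR (pi / 2 * `|tau|).

Let wB tau := cabs (B tau) * expR (pi / 2 * `|tau|).

Let iwA : leb.-integrable setT (EFin \o wA).
Proof. exact: integrable_hh_factor. Qed.

Let iwB : leb.-integrable setT (EFin \o wB).
Proof. exact: integrable_hh_factor. Qed.

Let mA : cmeas (A : measurableTypeR R -> C).
Proof. exact: cmeas_hh_factor. Qed.

Let mB : cmeas (B : measurableTypeR R -> C).
Proof. exact: cmeas_hh_factor. Qed.

Let iA : cintegrable leb A.
Proof. exact: (cintegrable_strip mA pi2_gt0 iwA). Qed.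

Let iB : cintegrable leb B.
Proof. exact: (cintegrable_strip mB pi2_gt0 iwB). Qed.

Let sum (z : measurableTypeR R * measurableTypeR R) : R := z.1 + z.2.

Let msum : measurable_fun setT sum.
Proof. by apply: measurable_funD; [exact: measurable_fst|exact: measurable_snd]. Qed.

Let AB (z : measurableTypeR R * measurableTypeR R) : C := A z.1 * B z.2.

Let mAB : cmeas AB.
Proof. by apply: cmeasM; [exact: (cmeas_pair1 _ mA)|exact: (cmeas_pair2 _ mB)]. Qed.

Let k1 z : C := AB z * (cosh2 (pi / 2 * sum z))%:C^-1.

Let k z : C := k1 z * (Gamma (sigma (sum z)))^-1.

Let cmeas_comp_sum (f : R -> C) : cmeas (f : measurableTypeR R -> C) ->
  cmeas (fun z => f (sum z)).
Proof.
by move=> [fr fi]; split; [exact: (measurableT_comp fr msum)|exact: (measurableT_comp fi msum)].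
Qed.

Let mk1 : cmeas k1.
Proof. by apply: cmeasM => //; apply: cmeasV; exact: (cmeas_comp_sum cmeas_cosh2). Qed.

Let mk : cmeas k.
Proof. by apply: cmeasM => //; apply: cmeasV; exact: (cmeas_comp_sum cmeas_Gamma). Qed.

Let cabs_coshV v : cabs ((cosh2 (pi / 2 * v))%:C^-1) <= expR (- (pi / 2 * `|v|)).
Proof.
rewrite cabsV cabsR gtr0_norm// expRN lef_pV2 ?posrE ?expR_gt0//.
by rewrite (le_trans _ (cosh2_ge _))// normrM (gtr0_norm pi2_gt0).
Qed.

(** [1 / Gamma] grows at most like [e^(2 |v|)] and [1 / cosh2] gives back [e^(- pi |v| / 2)]. As
    [2 - pi/2 <= pi/2] and [|v| <= |tau| + |u|], the weights of [A] and [B] absorb the rest. *)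
Let k_le : exists2 K : R, 0 < K &
  forall tau u, cabs (k (tau, u)) <= K * (wA tau * wB u).
Proof.
have [c c0 cG] := @cabs_Gamma_sigma_ge R.
exists c^-1; first by rewrite invr_gt0.
move=> tau u; rewrite /k /k1 /AB /sum; cbn [fst snd].
rewrite cabsM cabsM (cabsM (A tau)).
set v := tau + u.
have GV : cabs ((Gamma (sigma v))^-1) <= c^-1 * expR (2 * `|v|).
  rewrite cabsV -[expR _]invrK -invfM -expRN lef_pV2 ?cG// posrE.
    exact: lt_le_trans (mulr_gt0 c0 (expR_gt0 _)) (cG v).
  by rewrite mulr_gt0 ?expR_gt0.
have eV : expR (- (pi / 2 * `|v|)) * expR (2 * `|v|) <=
    expR (pi / 2 * `|tau|) * expR (pi / 2 * `|u|).
  rewrite -!expRD ler_expR -mulrDr -mulNr -mulrDl.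
  rewrite (@le_trans _ _ (pi / 2 * `|v|))//; last first.
    by rewrite ler_wpM2l ?ler_normD// ltW.
  by rewrite ler_wpM2r//; have := @pi_ge2 R; lra.
rewrite -[cabs (A tau) * cabs (B u) * _ * _]mulrA.
rewrite (le_trans (ler_wpM2l _ (ler_pM _ _ (cabs_coshV v) GV))) ?mulr_ge0 ?cabs_ge0//.
rewrite [leLHS](_ : _ = c^-1 * (cabs (A tau) * cabs (B u)) *
  (expR (- (pi / 2 * `|v|)) * expR (2 * `|v|))); last by ring.
rewrite [leRHS](_ : _ = c^-1 * (cabs (A tau) * cabs (B u)) *
  (expR (pi / 2 * `|tau|) * expR (pi / 2 * `|u|))); last by rewrite /wA /wB; ring.
by rewrite ler_wpM2l ?mulr_ge0 ?cabs_ge0 ?invr_ge0// ltW.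
Qed.

Let ik : cintegrable (prodm leb leb) k.
Proof.
have [K K0 kK] := k_le.
apply: (cintegrable_le mk _ (integrableZl measurableT K (integrable_prodM iwA iwB))).
by move=> [tau u]; exact: kK.
Qed.

(** Up to a nonzero factor, this transform at [y] is the convolution at [x = e^y]; [k_le] turns the
    iterated contour integral into an integral over the plane. *)
Let fourier_k_eq0 y : fourier (prodm leb leb) k sum y = 0.
Proof.
pose P z : C := k z * cexp ('i%C * (y * sum z)%:C).
have iP : cintegrable (prodm leb leb) P by exact: cintegrable_fourier.
have [K K0 kK] := k_le.
have cP tau u : cabs (P (tau, u)) <= K * (wA tau * wB u).
  by rewrite /P cabsM cabs_cexpI mulr1.
have iP1 u : cintegrable leb (fun tau => P (tau, u)).
  have mPu : cmeas (fun tau : measurableTypeR R => P (tau, u)).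
    have [pr pi] := cintegrable_cmeas iP.
    by split; [exact: (measurable_fun_pair1 u pr)|exact: (measurable_fun_pair1 u pi)].
  apply: (cintegrable_le mPu _ (integrableZl measurableT (K * wB u) iwA)) => tau.
  by rewrite (le_trans (cP tau u))// [wA tau * _]mulrC mulrA.
(* Needed to move the constant out of the outer integral, through [CintM]. *)
have iP2 : cintegrable leb (fun u => Cint leb (fun tau => P (tau, u))).
  have mP2 : cmeas ((fun u => Cint leb (fun tau => P (tau, u))) : measurableTypeR R -> C).
    have [pr pi] := iP; split.
    - have Gi := measurable_fubini_G (pr : (leb \x leb)%E.-integrable setT _).
      exact: (measurableT_comp (fine_measurable measurableT) Gi).
    - have Gi := measurable_fubini_G (pi : (leb \x leb)%E.-integrable setT _).
      exact: (measurableT_comp (fine_measurable measurableT) Gi).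
  pose N := \int[leb]_tau wA tau.
  apply: (cintegrable_le mP2 _ (integrableZl measurableT (2 * K * N) iwB)) => u.
  rewrite (_ : 2 * K * N * wB u = 2 * \int[leb]_tau (K * wB u * wA tau)).
    apply: cabs_Cint_le (iP1 u) (integrableZl measurableT (K * wB u) iwA) _ => tau.
    by rewrite (le_trans (cP tau u))// [wA tau * _]mulrC mulrA.
  by rewrite RintegralZl// -/N; ring.
have x0 : 0 < expR y by exact: expR_gt0.
have := conv0 x0; rewrite /half_hartley_conv.
rewrite (_ : sigma_integral _ = 'i%C * ('i%C * (expR (- (y / 2)))%:C *
    Cint (prodm leb leb) P)); last first.
  rewrite {1}/sigma_integral; congr (_ * _).
  transitivity (Cint leb (fun u => ('i%C * (expR (- (y / 2)))%:C) *
      Cint leb (fun tau => P (tau, u)))); last by rewrite (CintM _ iP2) (Cint_fubini2 iP).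
  apply: eq_Cint => u.
  change ('i%C * Cint leb (fun tau => half_hartley_kernel (sigma tau) (sigma u) *
    F (1 - sigma tau) * G (1 - sigma u) *
    cpow (expR y) (sigma tau + sigma u - 3 / 2)) =
    ('i%C * (expR (- (y / 2)))%:C) * Cint leb (fun tau => P (tau, u))).
  rewrite -[RHS]mulrA -(CintM _ (iP1 u)); congr (_ * _); apply: eq_Cint => tau.
  rewrite kernelE cpowE !sigmaN expRK /P /k /k1 /AB /sum /A /B /hh_factor.
  by cbn [fst snd]; ring.
move=> /eqP; rewrite !mulf_eq0 => H; apply/eqP; move: H.
have i0 : 'i%C != 0 :> C by rewrite eq_complex /= negb_and oner_neq0 orbT.
have e0 : (expR (- (y / 2)))%:C != 0 :> C by rewrite eq_complex /= negb_and gt_eqF ?expR_gt0.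
rewrite (negbTE i0) (negbTE e0) /= => /orP[|//].
have pi0 : (pi : R)%:C != 0 :> C by rewrite eq_complex /= negb_and gt_eqF ?pi_gt0.
by rewrite invr_eq0 expf_eq0 /= !mulf_eq0 (negbTE i0) (negbTE pi0) pnatr_eq0.
Qed.

Let fourier_k1_eq0 y : fourier (prodm leb leb) k1 sum y = 0.
Proof.
rewrite -[RHS](fourier_mul_fourier_eq0 ik msum cintegrable_euler mln fourier_k_eq0 y).
apply: eq_Cint => z; congr (_ * _).
by rewrite -Gamma_fourier /k -mulrA mulVf ?mulr1.
Qed.

(** The shift by [pi / 2] is admissible since [|k1| e^(pi |v| / 2)] is at most [|A| |B|], which is
    integrable. *)
Let fourier_AB_eq0 y : fourier (prodm leb leb) AB sum y = 0.
Proof.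
have iw : (prodm leb leb).-integrable setT
    (EFin \o (fun z => cabs (k1 z) * expR (pi / 2 * `|sum z|))).
  have := integrable_prodM (integrable_cabs iA) (integrable_cabs iB).
  apply: le_integrable_real.
    apply: measurable_funM; first exact: measurable_cabs.
    apply: (measurableT_comp (@measurable_expR R)); apply: measurable_funM.
      exact: measurable_cst.
    exact: (measurableT_comp (@normr_measurable R setT) msum).
  move=> z; rewrite ger0_norm ?mulr_ge0 ?cabs_ge0 ?expR_ge0// /k1 /AB cabsM cabsM.
  rewrite -[leLHS]mulrA ler_piMr ?mulr_ge0 ?cabs_ge0//.
  rewrite (le_trans (ler_wpM2r _ (cabs_coshV _))) ?expR_ge0//.
  by rewrite -expRD addNr expR0.
rewrite -[RHS](fourier_cosh_eq0 mk1 msum pi2_gt0 iw fourier_k1_eq0 y).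
apply: eq_Cint => z; congr (_ * _).
by rewrite /k1 mulrCA (mulfV (cosh2_neq0 _)) mulr1.
Qed.

(** If the transform of [A] is nonzero at [y0], it is so near [y0] by continuity; that of [B] then
    vanishes near [y0], hence everywhere. *)
Lemma hh_factor_fourier_eq0 :
  (forall y, fourier leb A id y = 0) \/ (forall y, fourier leb B id y = 0).
Proof.
have mid : measurable_fun setT (id : measurableTypeR R -> R) by exact: measurable_id.
have AB0 y : fourier leb A id y * fourier leb B id y = 0.
  by rewrite -(fourier_prod y iA iB); exact: fourier_AB_eq0.
have [[y0 A0]|A0] := pselect (exists y0, fourier leb A id y0 != 0); last first.
  by left => y; apply/eqP/negPn/negP => Ay; apply: A0; exists y.
right; have [r r0 Ar] := fourier_neq0_near mA mid pi2_gt0 iwA A0.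
apply: (fourier_extend_eq0 mB mid pi2_gt0 iwB r0 (y0 := y0)) => y /Ar Ay.
by have /eqP := AB0 y; rewrite mulf_eq0 (negbTE Ay) => /eqP.
Qed.

End Convolution.

End HalfHartleyConvolution.

Theorem theorem3 (R : realType) (f g : R -> R[i]) (fstar gstar : R[i] -> R[i])
    (f_L2 : in_Lp 2%:E Rpos f) (g_L2 : in_Lp 2%:E Rpos g)
    (f_mellin : is_mellin f fstar) (g_mellin : is_mellin g gstar)
    (f_L1 : in_Lp_sigma 1%:E (fun s => (expR (pi * cabs s))%:C * fstar s))
    (g_L1 : in_Lp_sigma 1%:E (fun s => (expR (pi * cabs s))%:C * gstar s))
    (conv0 : forall x : R, 0 < x -> half_hartley_conv fstar gstar x = 0) :
  zero_ae_Rpos f \/ zero_ae_Rpos g.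
Proof.
have [[mF _] _] := f_mellin; have [[mG _] _] := g_mellin.
have [A0|B0] := hh_factor_fourier_eq0 mF mG f_L1 g_L1 conv0.
- by left; apply: (mellin_eq0_ae f_L2 f_mellin); exact: hh_factor_eq0_ae A0.
- by right; apply: (mellin_eq0_ae g_L2 g_mellin); exact: hh_factor_eq0_ae B0.
Qed.
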